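(* Let $\alpha\in(0,1]$, $\eta,\sigma>0$, fix $a=-(\eta/\sigma)$ and $b=+(\eta/\sigma)$, and let $X^+$ be the reflected Brownian motion on $[a,b]$ with $X^+_0$ uniformly distributed on $\{a,b\}$. Then, for each fixed $t\ge0$, $$\gamma^+_{\tilde V^{-1}_t}(a)-\gamma^+_{\tilde V^{-1}_t}(b)\ \stackrel{d}{=}\ Z^{\mathtt{tel}}_t .$$
   Context: Reflected Brownian motion and local times. $X^+=\{X^+_t\}_{t\ge0}$ is the reflected Brownian motion on $[a,b]$ (generator $\varphi''$), satisfying the Skorokhod decomposition $$X^+_t=X^+_0+B_t+\gamma^+_t(a)-\gamma^+_t(b),$$ where $B$ is a Brownian motion with variance $2t$ and $\gamma^+_t(a)$, $\gamma^+_t(b)$ are the continuous non-decreasing boundary local times at $a$ and $b$ (started at $0$, increasing only when $X^+$ is at $a$, respectively at $b$). The total boundary local time is $\gamma^+_t=\gamma^+_t(a)+\gamma^+_t(b)$. Time change. $H=\{H_t\}_{t\ge0}$ is an $\alpha$-stable subordinator, $\mathbf{E}[e^{-\lambda H_t}]=e^{-t\lambda^\alpha}$ for $\lambda>0$ (for $\alpha=1$, $H_t=t$), independent of $X^+$. Set $\tilde V_t:=H_{\gamma^+_t}$ and $\tilde V^{-1}_t:=\inf\{s:\tilde V_s>t\}$. The process $Z^{\mathtt{tel}}$. Let $\{\theta_j\}_{j\ge1}$ be i.i.d. with $\mathbf{P}(\theta_j=\pm1)=1/2$, let $\{e_j\}_{j\ge1}$ be i.i.d. with $\mathbf{P}(e_j>t)=e^{-(\sigma/\eta)t}$,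 $t\ge 0$, and let $H$ be an $\alpha$-stable subordinator with $\mathbf{E}[e^{-\lambda H_t}]=e^{-t\lambda^\alpha}$ for $\lambda>0$ (for $\alpha=1$, $H_t=t$), with inverse $L_t=\inf\{s\ge0:H_s>t\}$; the families $\{\theta_j\},\{e_j\},H$ are mutually independent. Put $T_0=0$, $T_n=\sum_{j=1}^n e_j$, $N_t=\max\{n\ge0:T_n\le t\}$, $N^L_t=N_{L_t}$. Then $$Z^{\mathtt{tel}}_t=\sum_{j=1}^{N^L_t}\theta_j e_j+\theta_{1+N^L_t}\,\big(L_t-T_{N^L_t}\big).$$ *)

(* Defs.v *)
From HB Require Import structures.
From mathcomp Require Import all_boot all_order all_algebra.
From mathcomp Require Import all_classical all_reals all_analysis.
Import Order.TTheory GRing.Theory Num.Theory.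
Import numFieldNormedType.Exports.

Set Implicit Arguments.
Unset Strict Implicit.
Unset Printing Implicit Defensive.

Local Open Scope classical_set_scope.
Local Open Scope ring_scope.

(* A real process is a family of random variables indexed by R; only its values
   at times t >= 0 are ever constrained or used. *)

Section independence.
Context (R : realType) (d : measure_display) (Omega : measurableType d).
Variable P : probability Omega R.

Definition sigma_rv (f : Omega -> R) : set_system Omega :=
  preimage_set_system setT f measurable.

Definition sigma_family (I : Type) (D : set I) (X : I -> {RV P >-> R}) :
    set_system Omega :=
  <<s \bigcup_(i in D) sigma_rv (X i) >>.

Definition sigma_process (X : R -> {RV P >-> R}) : set_system Omega :=
  sigma_family [set t | 0 <= t] X.

Definition natural_filtration (X : R -> {RV P >-> R}) (t : R) :
    set_system Omega :=
  sigma_family [set s | 0 <= s <= t] X.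

Definition completed (F : set_system Omega) : set_system Omega :=
  [set A | measurable A /\ exists2 A', F A' & P (A `+` A') = 0%E].

Definition adapted (F : R -> set_system Omega) (X : R -> {RV P >-> R}) : Prop :=
  forall t : R, 0 <= t -> sigma_rv (X t) `<=` F t.

Definition independent (F G : set_system Omega) : Prop :=
  forall A B, F A -> G B -> P (A `&` B) = (P A * P B)%E.

Definition mutually_independent (I : choiceType) (F : I -> set_system Omega) :
    Prop :=
  forall (s : seq I) (A : I -> set Omega), uniq s ->
    (forall i, i \in s -> F i (A i)) ->
    P (\bigcap_(i in [set` s]) A i) = (\prod_(i <- s) P (A i))%E.

End independence.

Definition eq_in_law (R : realType)
    (d : measure_display) (Omega : measurableType d) (P : probability Omega R)
    (d' : measure_display) (Omega' : measurableType d')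
    (P' : probability Omega' R)
    (f : Omega -> R) (g : Omega' -> R) : Prop :=
  [/\ measurable_fun setT f, measurable_fun setT g &
      forall A : set R, measurable A -> P (f @^-1` A) = P' (g @^-1` A)].

(* Brownian motion with variance c * t, relative to the filtration F. The
   second parameter of normal_prob is the standard deviation. *)
Record brownian_motion (R : realType) (d : measure_display)
    (Omega : measurableType d) (P : probability Omega R)
    (F : R -> set_system Omega) (c : R) (B : R -> {RV P >-> R}) : Prop := {
  bm_start : forall w, B 0 w = 0 ;
  bm_continuous : forall w,
    {within `[0, +oo[, continuous (fun t : R => B t w)} ;
  bm_adapted : adapted F B ;
  bm_gaussian : forall s t : R, 0 <= s -> s < t ->
    forall A : set R, measurable A ->
    P ((fun w => B t w - B s w) @^-1` A) =
      normal_prob 0 (Num.sqrt (c * (t - s))) A ;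
  bm_independent : forall s t : R, 0 <= s -> s < t ->
    independent P (F s) (sigma_rv (fun w => B t w - B s w)) }.

(* g is a boundary local time of X at x: a continuous non-decreasing process
   started at 0, constant on any time interval during which X does not visit x,
   and, as a functional of X, adapted to the completed filtration of X. *)
Record boundary_local_time (R : realType) (d : measure_display)
    (Omega : measurableType d) (P : probability Omega R)
    (X : R -> {RV P >-> R}) (x : R) (g : R -> {RV P >-> R}) : Prop := {
  lt_start : forall w, g 0 w = 0 ;
  lt_continuous : forall w,
    {within `[0, +oo[, continuous (fun t : R => g t w)} ;
  lt_nondecreasing : forall w (s t : R), 0 <= s -> s <= t -> g s w <= g t w ;
  lt_support : forall w (s t : R), 0 <= s -> s <= t ->
    (forall u : R, s <= u <= t -> X u w <> x) -> g t w = g s w ;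
  lt_adapted : adapted (fun t => completed P (natural_filtration X t)) g }.

(* Reflected Brownian motion on [a, b] with generator phi'', given with its
   Skorokhod decomposition: B drives X in the (completed) filtration of X, so
   that in particular B is independent of X 0. *)
Record reflected_brownian_motion (R : realType) (d : measure_display)
    (Omega : measurableType d) (P : probability Omega R) (a b : R)
    (X B ga gb : R -> {RV P >-> R}) : Prop := {
  rbm_range : forall w (t : R), 0 <= t -> a <= X t w <= b ;
  rbm_driving :
    brownian_motion (fun t => completed P (natural_filtration X t)) 2 B ;
  rbm_local_a : boundary_local_time X a ga ;
  rbm_local_b : boundary_local_time X b gb ;
  rbm_skorokhod : forall w (t : R), 0 <= t ->
    X t w = X 0 w + B t w + ga t w - gb t w }.

Record stable_subordinator (R : realType) (d : measure_display)
    (Omega : measurableType d) (P : probability Omega R) (alpha : R)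
    (H : R -> {RV P >-> R}) : Prop := {
  sub_start : forall w, H 0 w = 0 ;
  sub_nondecreasing : forall w (s t : R), 0 <= s -> s <= t -> H s w <= H t w ;
  sub_right_continuous : forall w (t : R), 0 <= t ->
    H s w @[s --> t^'+] --> H t w ;
  sub_independent : forall s t : R, 0 <= s -> s <= t ->
    independent P (natural_filtration H s)
                  (sigma_rv (fun w => H t w - H s w)) ;
  sub_stationary : forall s h : R, 0 <= s -> 0 <= h ->
    eq_in_law P P (fun w => H (s + h) w - H s w) (H h) ;
  sub_laplace : forall t lambda : R, 0 <= t -> 0 < lambda ->
    ('E_P[fun w => expR (- lambda * H t w)] =
      (expR (- t * lambda `^ alpha))%:E)%E ;
  sub_one : alpha = 1 -> forall w (t : R), 0 <= t -> H t w = t }.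

(* The infimum of the empty set is 0 here, instead of +oo; below, the set is
   almost surely nonempty. *)
Definition inverse_time (R : realType) (f : R -> R) (t : R) : R :=
  inf [set s | 0 <= s /\ t < f s].

Definition time_changed_local_difference (R : realType) (Omega : Type)
    (ga gb H : R -> Omega -> R) (t : R) (w : Omega) : R :=
  let gamma s := ga s w + gb s w in
  let V s := H (gamma s) w in
  ga (inverse_time V t) w - gb (inverse_time V t) w.

(* theta and e are indexed from 0: theta j and e j stand for the variables of
   index j + 1. *)
Section telegraph.
Context (R : realType) (Omega : Type).
Variables (theta e : nat -> Omega -> R) (H : R -> Omega -> R).

Definition renewal_time (n : nat) (w : Omega) : R := \sum_(j < n) e j w.

(* The largest n with T_n <= t, which exists almost surely; 0 otherwise. *)
Definition renewal_count (t : R) (w : Omega) : nat :=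
  xget 0%N [set n | renewal_time n w <= t /\
                    forall m, renewal_time m w <= t -> (m <= n)%N].

Definition Ztel (t : R) (w : Omega) : R :=
  let L := inverse_time (fun s => H s w) t in
  let N := renewal_count L w in
  \sum_(j < N) theta j w * e j w + theta N w * (L - renewal_time N w).

End telegraph.

(* Main.v *)
Require Import Defs.
From HB Require Import structures.
From mathcomp Require Import all_boot all_order all_algebra.
From mathcomp Require Import all_classical all_reals all_analysis measurable_realfun.
From mathcomp Require Import ring lra.
Import Order.TTheory GRing.Theory Num.Theory.
Import numFieldNormedType.Exports.

Set Implicit Arguments.
Unset Strict Implicit.
Unset Printing Implicit Defensive.

Local Open Scope classical_set_scope.
Local Open Scope ring_scope.

(** Write gamma for the total boundary local time and [D u] for the difference of the
    two local times at the first time gamma exceeds [u].  Since gamma at the inverse of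
    [H o gamma] equals the inverse [L] of [H], the time-changed difference is [D L] with
    [L] independent of [D]; the telegraph process is likewise [Z L'] with [L'] independent
    of [Z].  So it suffices that [D u] and [Z u] have the same Laplace transform for each
    [u].
    On the Brownian side, with [l = b - a] and [rho <> 0], a function affine in [X] times
    [exp (lam * ga + mu * gb)] is a martingale for suitable rates, because an affine
    function has no second-order term and the rates cancel the boundary terms at [a] and
    [b]; no stochastic integral is needed, only Riemann sums along a grid.  Stopping it at
    local time [u] for the two values [rho] and [- 1 / rho], which have the same value of
    [beta = (rho - 1 / rho) / (2 l)], and eliminating [X] gives [E exp (- beta D u)].
    On the telegraph side, that function of [u] satisfies the renewal equation obtained by
    conditioning on the first pair [(theta, e)], and the renewal times are unbounded, so
    it is also [E exp (- beta Z u)]. *)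

(** * Independence *)

(** The obstacle is stopping the martingale on a grid. An indicator of local time at most [u], read
    at the right end of a step, keeps every exponential weight bounded: the Riemann sums are then
    bounded uniformly in the path and the grid, and dominated convergence applies. That indicator is
    not known when the step begins. Read at the left end it is adapted and the weighted increments
    have mean zero, but the local time may overshoot [u] within the step. The two versions differ in
    at most one increment, whose mean size is controlled by fourth moments of Brownian increments;
    this is why Gaussian moments are needed. Only positive values of [beta] have to be treated: at
    local time [u] both signed quantities lie almost surely in [[-u, u]], and after a shift by [u]
    they are nonnegative variables, whose laws are determined by Laplace transforms on the positive
    half-line. The local times are adapted only to the completed filtration of [X], so independence
    from [H] has to be carried through completion. *)

Section independence_theory.
Context (R : realType) (d : measure_display) (Omega : measurableType d).
Variable P : probability Omega R.
Implicit Types (F G : set_system Omega).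

Lemma independentC F G : independent P F G -> independent P G F.
Proof. by move=> h A B GA FB; rewrite setIC h// muleC. Qed.

Lemma independent_subl F G F' : F' `<=` F ->
  independent P F G -> independent P F' G.
Proof. by move=> FF' h A B /FF' FA GB; exact: h. Qed.

Lemma independent_subr F G G' : G' `<=` G ->
  independent P F G -> independent P F G'.
Proof. by move=> GG' h A B FA /GG' GB; exact: h. Qed.

Lemma sigma_measurable F : F `<=` measurable -> <<s F >> `<=` measurable.
Proof. by apply: smallest_sub; exact: sigma_algebra_measurable. Qed.

(** Dynkin's pi-lambda argument on one side: the sets independent of every member of [G] form a
    lambda-system. [G] is an arbitrary family, so the two-sided version follows by applying this
    twice. *)
Lemma independent_sigmal F G : setI_closed F -> F `<=` measurable ->
  G `<=` measurable -> independent P F G -> independent P <<s F >> G.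
Proof.
move=> FI Fm Gm h.
suff: <<s F >> `<=` [set A | measurable A /\
    forall B, G B -> P (A `&` B) = (P A * P B)%E].
  by move=> s A B /s[_]; apply.
apply: lambda_system_subset; [by []| | |by []].
- apply/dynkin_lambda_system; split.
  + split=> // B GB; rewrite setTI.
    by have /= -> := probability_setT P; rewrite mul1e.
  + move=> A [mA hA]; split; first exact: measurableC.
    move=> B GB; have mB := Gm _ GB.
    have -> : P (~` A `&` B) = (P B - P (A `&` B))%E.
      by rewrite setIC -setDE measureD ?[A `&` B]setIC// ltey_eq fin_num_measure.
    rewrite hA// probability_setC// muleBl ?mul1e ?fin_num_measure//.
  + move=> A tA hA; split; first by apply: bigcup_measurable => k _; apply hA.
    move=> B GB; have mB := Gm _ GB.
    rewrite setI_bigcupl !measure_semi_bigcup//.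
    - rewrite muleC -[P B]fineK ?fin_num_measure// -nneseriesZl//.
      apply: eq_eseriesr => i _; rewrite fineK ?fin_num_measure// muleC.
      by apply hA.
    - by move=> i; apply hA.
    - by apply: bigcup_measurable => k _; apply hA.
    - by move=> i; apply: measurableI; [apply hA|].
    - exact: trivIset_setIr.
    - by apply: bigcup_measurable => k _; apply: measurableI; [apply hA|].
- by move=> A FA; split; [exact: Fm|move=> B GB; exact: h].
Qed.

Lemma independent_sigma F G : setI_closed F -> setI_closed G ->
  F `<=` measurable -> G `<=` measurable ->
  independent P F G -> independent P <<s F >> <<s G >>.
Proof.
move=> FI GI Fm Gm h; apply: independent_sigmal => //.
  exact: sigma_measurable.
by apply/independentC/independent_sigmal => //; exact: independentC.
Qed.

(** Regroup the four events by ambient family, [S1] or [S2], factor across the families, then within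
    each. It serves to separate the past pairs [(theta, e)] from the next one. *)
Lemma independent_setI F1 F2 G1 G2 S1 S2 : setI_closed S1 -> setI_closed S2 ->
  F1 `<=` S1 -> G1 `<=` S1 -> F2 `<=` S2 -> G2 `<=` S2 ->
  independent P S1 S2 -> independent P F1 G1 -> independent P F2 G2 ->
  independent P [set A1 `&` A2 | A1 in F1 & A2 in F2]
                [set B1 `&` B2 | B1 in G1 & B2 in G2].
Proof.
move=> S1I S2I F1S G1S F2S G2S hS h1 h2 _ _ [A1 FA1 [A2 FA2 <-]] [B1 GB1 [B2 GB2 <-]].
rewrite setIACA hS; [|by apply: S1I; [exact: F1S|exact: G1S]
  |by apply: S2I; [exact: F2S|exact: G2S]].
rewrite h1// h2// !hS; [|exact: G1S|exact: G2S|exact: F1S|exact: F2S].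
by rewrite muleACA.
Qed.

Lemma sigma_family_sigma_algebra (I : Type) (D : set I) (X : I -> {RV P >-> R}) :
  sigma_algebra setT (sigma_family D X).
Proof. exact: smallest_sigma_algebra. Qed.

Lemma sigma_rv_sigma_algebra (f : Omega -> R) : sigma_algebra setT (sigma_rv f).
Proof. exact/sigma_algebra_preimage/sigma_algebra_measurable. Qed.

Lemma sigma_rv_measurable (f : Omega -> R) : measurable_fun setT f ->
  sigma_rv f `<=` measurable.
Proof. by move=> mf _ [B mB <-]; exact: mf. Qed.

Lemma sigma_family_measurable (I : Type) (D : set I) (X : I -> {RV P >-> R}) :
  sigma_family D X `<=` measurable.
Proof.
by apply: sigma_measurable => A [i _]; exact/sigma_rv_measurable/measurable_funPT.
Qed.

Lemma sigma_family_rv (I : Type) (D : set I) (X : I -> {RV P >-> R}) (i : I)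
  (A : set R) : D i -> measurable A -> sigma_family D X (X i @^-1` A).
Proof.
by move=> Di mA; apply: sub_sigma_algebra; exists i => //; exists A => //; rewrite setTI.
Qed.

Lemma sigma_family_subset (I : Type) (D D' : set I) (X : I -> {RV P >-> R}) :
  D `<=` D' -> sigma_family D X `<=` sigma_family D' X.
Proof.
move=> DD'; apply: sub_sigma_algebra2 => A [i Di XA]; exists i => //; exact: DD'.
Qed.

Lemma sigma_algebra_setI F : sigma_algebra setT F -> setI_closed F.
Proof.
move=> sF A B FA FB; have e := sigma_algebra_id sF.
suff: <<s F >> (A `&` B) by rewrite e.
apply: (@measurableI _ (g_sigma_algebraType F)); exact: sub_sigma_algebra.
Qed.

(** Cylinders over the indices below [n] form a pi-system generating the past. On them, mutual
    independence over [iota 0 n.+1] and over [iota 0 n] gives two products that differ by the factor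
    of index [n]. *)
Lemma mutually_independent_prefix (X : nat -> {RV P >-> R}) (n : nat) :
  mutually_independent P (fun j => sigma_rv (X j)) ->
  independent P (sigma_family [set j | (j < n)%N] X) (sigma_rv (X n)).
Proof.
move=> hX.
pose G := [set A | exists2 C : nat -> set R, (forall j, measurable (C j)) &
  A = \bigcap_(j in [set j | (j < n)%N]) (X j @^-1` (C j))].
have Gm : G `<=` measurable.
  move=> _ [C mC ->]; apply: bigcap_measurableType => j _.
  exact: (measurable_funPTI (X j)).
have GX : sigma_family [set j | (j < n)%N] X `<=` <<s G >>.
  apply: smallest_sub; first exact: smallest_sigma_algebra.
  move=> _ [j jn] [B mB <-]; apply: sub_sigma_algebra.
  exists (fun i => if i == j then B else setT).
    by move=> i; case: ifP.
  rewrite setTI; apply/seteqP; split => [w XB i /= ni|w /(_ j jn)/=].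
    by case: eqP => [->|].
  by rewrite eqxx.
apply: independent_subl GX _; apply: independent_sigmal => //.
- move=> _ _ [C mC ->] [D mD ->]; exists (fun j => C j `&` D j).
    by move=> j; exact: measurableI.
  by rewrite -bigcapI.
- exact/sigma_rv_measurable/measurable_funPT.
- move=> _ _ [C mC ->] [B mB <-]; rewrite setTI.
  (* One family of sets carries both the cylinder below [n] and the event [B] at [n], so that the
     same family serves for both index ranges. *)
  pose C' j := if (j < n)%N then C j else B.
  have mC' j : measurable (C' j) by rewrite /C'; case: ifP.
  have := hX (iota 0 n.+1) (fun j => X j @^-1` (C' j)) (iota_uniq _ _) _.
  have := hX (iota 0 n) (fun j => X j @^-1` (C' j)) (iota_uniq _ _) _.
  have -> : \bigcap_(i in [set` iota 0 n]) X i @^-1` C' i =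
      \bigcap_(j in [set j | (j < n)%N]) X j @^-1` C j.
    apply/seteqP; split=> w h j jn.
      have /h/= : j \in iota 0 n by rewrite mem_iota.
      by rewrite /C' [(j < n)%N]jn.
    have {}jn : (j < n)%N by move: jn => /=; rewrite mem_iota.
    by rewrite /= /C' jn; exact: h.
  have -> : \bigcap_(i in [set` iota 0 n.+1]) X i @^-1` C' i =
      \bigcap_(j in [set j | (j < n)%N]) X j @^-1` C j `&` X n @^-1` B.
    apply/seteqP; split=> [w h|w [h1 h2] j jn].
      split=> [j jn|].
        have /h/= : j \in iota 0 n.+1 by rewrite mem_iota/= ltnS ltnW.
        by rewrite /C' [(j < n)%N]jn.
      have /h/= : n \in iota 0 n.+1 by rewrite mem_iota/= add0n.
      by rewrite /C' ltnn.
    have : j \in iota 0 n.+1 by exact: jn.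
    rewrite mem_iota /= ltnS.
    rewrite leq_eqVlt /= /C' => /orP[/eqP ->|{}jn]; first by rewrite ltnn.
    by rewrite jn; exact: h1.
  move=> -> ; last by move=> i _; exists (C' i); rewrite ?setTI.
  move=> ->; last by move=> i _; exists (C' i); rewrite ?setTI.
  rewrite -addn1 iotaD big_cat/= big_seq1 add0n; congr (_ * P _)%E.
  by rewrite /C' ltnn.
Qed.

(** The joint law of [U] and [V] is the product of their laws, so this is Tonelli pulled back to
    [Omega]. The targets are arbitrary measurable spaces so that [V] can later be the identity into
    a coarser sigma-algebra, that is, a whole path. *)
Lemma independent_fubini d1 d2 (T1 : measurableType d1) (T2 : measurableType d2)
    (U : Omega -> T1) (V : Omega -> T2) (f : T1 * T2 -> \bar R) :
  measurable_fun setT U -> measurable_fun setT V ->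
  (forall A B, measurable A -> measurable B ->
    P (U @^-1` A `&` V @^-1` B) = (P (U @^-1` A) * P (V @^-1` B))%E) ->
  measurable_fun setT f -> (forall x, 0 <= f x)%E ->
  (\int[P]_w f (U w, V w) = \int[P]_w \int[P]_w' f (U w, V w'))%E.
Proof.
move=> mU mV h mf f0.
have mUV : measurable_fun setT (fun w => (U w, V w)) by exact: measurable_fun_pair.
pose U' : {mfun Omega >-> T1} := mfun_Sub (mem_set mU).
pose V' : {mfun Omega >-> T2} := mfun_Sub (mem_set mV).
pose UV : {mfun Omega >-> (T1 * T2)%type} := mfun_Sub (mem_set mUV).
pose m1 := distribution P U'; pose m2 := distribution P V'.
transitivity (\int[distribution P UV]_z f z)%E.
  by rewrite ge0_integral_distribution.
transitivity (\int[m1 \x m2]_z f z)%E.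
  apply: eq_measure_integral => A mA _; apply/esym.
  apply: (@product_measure_unique _ _ _ _ _ m1 m2 (distribution P UV)) => //.
rewrite fubini_tonelli1// /fubini_F ge0_integral_distribution//=.
- apply: eq_integral => w _; rewrite /= ge0_integral_distribution//.
  exact: measurableT_comp.
- exact: measurable_fun_fubini_tonelli_F.
- by move=> x; exact: integral_ge0.
Qed.

Lemma completed_measurable F : completed P F `<=` measurable.
Proof. by move=> A []. Qed.

Lemma sub_completed F : F `<=` measurable -> F `<=` completed P F.
Proof.
by move=> Fm A FA; split; [exact: Fm|exists A => //; rewrite setYK measure0].
Qed.

Lemma completedS F G : F `<=` G -> completed P F `<=` completed P G.
Proof. by move=> FG A [mA [A' FA PA]]; split=> //; exists A' => //; exact: FG. Qed.

Lemma completed_sigma_algebra F : sigma_algebra setT F -> F `<=` measurable ->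
  sigma_algebra setT (completed P F).
Proof.
move=> [F0 FC FU] Fm; split.
- by apply: sub_completed.
- move=> A [mA [A' FA' PA]]; split; first exact: measurableD.
  exists (setT `\` A'); first exact: FC.
  rewrite -PA; congr (P _); apply/seteqP; split=> w; rewrite /setY/=;
    have := pselect (A w); have := pselect (A' w); tauto.
- move=> A hA.
  have [B hB] : {B : nat -> set Omega & forall n, F (B n) /\ P (A n `+` B n) = 0%E}.
    apply: (@choice _ _ (fun n B => F B /\ P (A n `+` B) = 0%E)) => n.
    by have [_ [B FB PB]] := hA n; exists B.
  split; first by apply: bigcup_measurable => k _; apply hA.
  exists (\bigcup_k B k); first by apply: FU => k; apply hB.
  have mAB k : measurable (A k `+` B k).
    have mA : measurable (A k) by apply hA.
    have mB : measurable (B k) by apply: Fm; apply hB.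
    by apply: measurableU; exact: measurableD.
  apply: (@subset_measure0 _ _ _ P _ (\bigcup_k (A k `+` B k))) => //.
  + have mA : measurable (\bigcup_k A k) by apply: bigcup_measurable => k _; apply hA.
    have mB : measurable (\bigcup_k B k).
      by apply: bigcup_measurable => k _; apply: Fm; apply hB.
    by apply: measurableU; exact: measurableD.
  + exact: bigcup_measurable.
  + move=> w [[[k _ Ak] nB]|[[k _ Bk] nA]]; exists k => //; [left|right]; split => //.
      by move=> Bk; apply: nB; exists k.
    by move=> Ak; apply: nA; exists k.
  + apply/negligibleP; first exact: bigcup_measurable.
    apply: negligible_bigcup => k; apply/negligibleP => //.
    by apply hB.
Qed.

(** This makes completion harmless for independence: [P] is monotone up to the null set where [A]
    and its representative differ, so each bounds the other on every [B]. *)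
Lemma completedP F A : completed P F A -> F `<=` measurable -> exists2 A', F A' &
  forall B, measurable B -> P (A `&` B) = P (A' `&` B).
Proof.
move=> [mA [A' FA' PA]] Fm; exists A' => // B mB; have mA' := Fm _ FA'.
have mD : measurable (A `+` A') by apply: measurableU; exact: measurableD.
have e C C' : measurable C -> measurable C' -> C `<=` C' `|` (A `+` A') -> (P C <= P C')%E.
  move=> mC mC' CC'; apply: (@le_trans _ _ (P (C' `|` (A `+` A')))).
    by apply: le_measure => //; rewrite inE//; exact: measurableU.
  have : (P (C' `|` (A `+` A')) <= P C' + P (A `+` A'))%E by exact: measureU2.
  by rewrite PA adde0.
apply/eqP; rewrite eq_le !e//; try exact: measurableI.
- move=> w [A'w Bw]; have [Aw|nAw] := pselect (A w); first by left.
  by right; right.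
- move=> w [Aw Bw]; have [A'w|nA'w] := pselect (A' w); first by left.
  by right; left.
Qed.

Lemma independent_completed F G : F `<=` measurable -> G `<=` measurable ->
  independent P F G -> independent P (completed P F) G.
Proof.
move=> Fm Gm h A B /completedP/(_ Fm)[A' FA' e] GB.
rewrite e; last exact: Gm.
by rewrite h// -[A in RHS]setIT -[A']setIT e// setIT.
Qed.

End independence_theory.

Section sub_sigma_algebra_measurability.
Context (R : realType) (Omega : pointedType) (G : set_system Omega).

(** With its converse below, this passes between inclusion of generated sigma-algebras and
    measurability of a function on [g_sigma_algebraType G]; closure properties of measurable
    functions then apply relative to a smaller sigma-algebra. *)
Lemma adapted_measurable_fun (f : Omega -> R) :
  preimage_set_system setT f measurable `<=` <<s G >> ->
  measurable_fun setT (f : g_sigma_algebraType G -> R).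
Proof. by move=> fG _ A mA; rewrite setTI; apply: fG; exists A => //; rewrite setTI. Qed.

Lemma measurable_fun_sigma_rv (f : Omega -> R) :
  measurable_fun setT (f : g_sigma_algebraType G -> R) ->
  preimage_set_system setT f measurable `<=` <<s G >>.
Proof. by move=> mf _ [A mA <-]; exact: (mf measurableT A mA). Qed.

End sub_sigma_algebra_measurability.

(** * Processes at random times *)

Section random_time.
Context (R : realType) (d : measure_display) (T : measurableType d).
Implicit Types (V X : R -> T -> R) (t tau : T -> R).

Lemma inverse_time_ge0 (f : R -> R) (t : R) : 0 <= inverse_time f t.
Proof.
rewrite /inverse_time; have [->|/set0P S0] := eqVneq [set s | 0 <= s /\ t < f s] set0.
  by rewrite inf0.
by apply: lb_le_inf => // s [].
Qed.

(** The witness is a genuine hypothesis: the infimum of the empty set is 0, so a small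
    [inverse_time] alone does not show that the level is ever exceeded. *)
Lemma inverse_time_lt (f : R -> R) (t s : R) :
  (exists2 u, 0 <= u & t < f u) -> inverse_time f t < s ->
  exists u, [/\ 0 <= u, u < s & t < f u].
Proof.
move=> [u u0 tu] /inf_lt[|v [v0 tv] vs]; first by exists u; split.
by exists v.
Qed.

Lemma inverse_time_le (f : R -> R) (t s : R) : 0 <= s -> t < f s ->
  inverse_time f t <= s.
Proof. by move=> s0 ts; apply: ge_inf; [exists 0 => u []|split]. Qed.

Lemma measurable_fun_lt_ray (f : T -> R) :
  (forall s, measurable [set w | f w < s]) -> measurable_fun setT f.
Proof.
move=> h; apply: (measurability (@RGenInftyO.G R)); first exact: RGenInftyO.measurableE.
move=> _ [_ [s ->] <-]; rewrite setTI.
have -> // : f @^-1` `]-oo, s[ = [set w | f w < s].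
by apply/seteqP; split => w /=; rewrite in_itv.
Qed.

(** By monotonicity the level is exceeded before [s] exactly when it is exceeded at a rational time
    before [s]. The level is itself a function of the sample point, which later gives joint
    measurability in level and path. *)
Lemma measurable_inverse_time V t :
  (forall s, 0 <= s -> measurable_fun setT (V s)) ->
  (forall w s s', 0 <= s -> s <= s' -> V s w <= V s' w) ->
  measurable_fun setT t ->
  measurable_fun setT (fun w => inverse_time (V ^~ w) (t w)).
Proof.
move=> mV ndV mt; apply: measurable_fun_lt_ray => s.
have mtV u : 0 <= u -> measurable [set w | t w < V u w].
  move=> u0; rewrite -[X in measurable X]setTI.
  exact: (measurable_fun_ltr mt (mV _ u0) measurableT (Y := [set true])).
pose A (q : rat) := if (0 <= ratr q :> R) && (ratr q < s) then
  [set w | t w < V (ratr q) w] else set0.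
(* [N] collects the paths that never exceed the level; their inverse time is the default 0, which is
   below [s] only when [s] is positive. *)
pose N := [set w | 0 < s] `&` \bigcap_n (~` [set w | t w < V n%:R w]).
have -> : [set w | inverse_time (V ^~ w) (t w) < s] = (\bigcup_q A q) `|` N.
  apply/seteqP; split=> w /=.
    move=> ts; have [[u u0 tu]|nex] := pselect (exists2 u, 0 <= u & t w < V u w).
      have [|v [v0 vs tv]] := inverse_time_lt _ ts; first by exists u.
      have [q] := rat_in_itvoo vs; rewrite in_itv/= => /andP[vq qs].
      left; exists q => //; rewrite /A (le_trans v0 (ltW vq)) qs/=.
      by rewrite (lt_le_trans tv)// ndV// ltW.
    right; split; first by rewrite (le_lt_trans _ ts)//; exact: inverse_time_ge0.
    by move=> n _ tn; apply: nex; exists n%:R.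
  move=> [[q _]|[s0 h]].
    rewrite /A; case: ifPn => // /andP[q0 qs] /= tq.
    by rewrite (le_lt_trans _ qs)//; exact: inverse_time_le.
  rewrite /inverse_time.
  suff -> : [set s0 | 0 <= s0 /\ t w < V s0 w] = set0 by rewrite inf0.
  rewrite -subset0 => u [u0 tu]; apply: (h (Num.truncn u).+1) => //=.
  rewrite (lt_le_trans tu)// ndV// ltW//.
  by have /andP[] := truncn_itv u0.
apply: measurableU.
  apply: bigcupT_measurable_rat => q; rewrite /A; case: ifPn => // /andP[q0 _].
  exact: mtV.
apply: measurableI.
  by have [s0|s0] := boolP (0 < s); [rewrite (_ : [set _ | _] = setT)//|
    rewrite (_ : [set _ | _] = set0)//]; apply/seteqP; split.
by apply: bigcapT_measurable => n; apply: measurableC; exact: mtV.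
Qed.

Lemma measurable_truncn (f : T -> R) : measurable_fun setT f ->
  (forall w, 0 <= f w) -> forall k, measurable [set w | Num.truncn (f w) = k].
Proof.
move=> mf f0 k.
have -> : [set w | Num.truncn (f w) = k] = f @^-1` `[k%:R, k.+1%:R[.
  apply/seteqP; split=> w /=; rewrite in_itv/=; first by move=> <-; exact: truncn_itv.
  by move=> h; apply/eqP; rewrite truncn_eq// f0.
by rewrite -[X in measurable X]setTI; exact: mf.
Qed.

Lemma measurable_fun_countable_glue d' (T' : measurableType d') (N : T -> nat)
    (f : nat -> T -> T') : (forall k, measurable [set w | N w = k]) ->
  (forall k, measurable_fun setT (f k)) -> measurable_fun setT (fun w => f (N w) w).
Proof.
move=> mN mf _ A mA; rewrite setTI.
have -> : (fun w => f (N w) w) @^-1` A =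
    \bigcup_k ([set w | N w = k] `&` f k @^-1` A).
  apply/seteqP; split=> [w Aw|w [k _ [<-]]//]; by exists (N w).
apply: bigcup_measurable => k _; apply: measurableI => //.
by rewrite -[X in measurable X]setTI; exact: mf.
Qed.

(** Approximate [tau] from the right by times with countably many values, glue, and pass to the
    limit by right continuity. *)
Lemma measurable_at_random_time X tau :
  (forall s, 0 <= s -> measurable_fun setT (X s)) ->
  (forall w s, 0 <= s -> X s' w @[s' --> s^'+] --> X s w) ->
  (forall w, 0 <= tau w) -> measurable_fun setT tau ->
  measurable_fun setT (fun w => X (tau w) w).
Proof.
move=> mX rcX tau0 mtau.
pose k n w := Num.truncn (n.+1%:R * tau w).
(* The successor makes the approximation strictly larger than [tau], as convergence along [^'+]
   requires. *)
pose taun n w := (k n w).+1%:R / n.+1%:R : R.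
apply: (@measurable_realfun.measurable_fun_cvg _ _ _ _ (fun n w => X (taun n w) w)).
  move=> n; apply: (@measurable_fun_countable_glue _ _ (k n)
    (fun j w => X (j.+1%:R / n.+1%:R) w)).
    apply: measurable_truncn; first exact: measurable_funM.
    by move=> w; rewrite mulr_ge0.
  by move=> j; apply: mX; rewrite divr_ge0.
move=> w _.
have taun_gt n : tau w < taun n w.
  rewrite /taun ltr_pdivlMr// mulrC.
  by have /andP[] : (k n w)%:R <= n.+1%:R * tau w < (k n w).+1%:R
    by apply: truncn_itv; rewrite mulr_ge0.
have taun_le n : taun n w <= tau w + n.+1%:R^-1.
  rewrite /taun ler_pdivrMr// mulrDl mulVf// -natr1 lerD2r mulrC.
  by have /andP[] : (k n w)%:R <= n.+1%:R * tau w < (k n w).+1%:R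
    by apply: truncn_itv; rewrite mulr_ge0.
have cv : taun n w @[n --> \oo] --> (tau w)^'+.
  move=> A /=; rewrite /at_right/= => -[e e0 eA].
  have := near_infty_natSinv_lt (PosNum e0); apply: filterS => n /= ne.
  apply: eA => //=; rewrite distrC gtr0_norm ?subr_gt0//.
  by rewrite ltrBlDl (le_lt_trans (taun_le n))// ltrD2l.
exact: (cvg_comp _ _ cv (rcX w _ (tau0 w))).
Qed.

End random_time.

(** * Laws and Laplace transforms *)

Section bounded_expectation.
Context (R : realType) (d : measure_display) (Omega : measurableType d).
Variable P : probability Omega R.

Lemma bounded_integrable (f : Omega -> R) (C : R) : measurable_fun setT f ->
  (forall w, `|f w| <= C) -> P.-integrable setT (EFin \o f).
Proof.
move=> mf fC; apply: (@le_integrable _ _ _ P setT measurableT _ (cst C%:E)).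
- exact/measurable_EFinP.
- by move=> w _; rewrite /= lee_fin (le_trans (fC w))// ler_norm.
- exact: finite_measure_integrable_cst.
Qed.

Lemma cvg_bounded_expectation (F : nat -> Omega -> R) (f : Omega -> R) (C : R) :
  (forall n, measurable_fun setT (F n)) -> measurable_fun setT f ->
  {ae P, forall w, forall n, `|F n w| <= C} ->
  {ae P, forall w, F n w @[n --> \oo] --> f w} ->
  (\int[P]_w (F n w)%:E)%E @[n --> \oo] --> (\int[P]_w (f w)%:E)%E.
Proof.
move=> mF mf FC Ff.
have [] := @dominated_convergence _ _ _ P setT measurableT
  (fun n => EFin \o F n) (EFin \o f) (cst C%:E).
- by move=> n; exact/measurable_EFinP.
- exact/measurable_EFinP.
- apply: filterS Ff => w Ffw _.
  by apply: cvg_EFin; [exact: nearW|exact: Ffw].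
- exact: finite_measure_integrable_cst.
- by apply: filterS FC => w FCw n _; rewrite /= lee_fin.
- by [].
Qed.

Lemma cvg_of_harmonic_bound (u : nat -> R) (l C : R) :
  (forall n, `|u n - l| <= C * n.+1%:R^-1) -> u n @[n --> \oo] --> l.
Proof.
move=> h; apply/(@cvgrPdist_lt _ R^o) => e e0.
have C0 : 0 <= C by have := h 0%N; rewrite invr1 mulr1; exact: le_trans.
have eC : 0 < e / (C + 1) by rewrite divr_gt0// ltr_wpDl.
have := near_infty_natSinv_lt (PosNum eC); apply: filterS => n /= ne.
rewrite distrC (le_lt_trans (h n))//.
move: ne; rewrite ltr_pdivlMr ?ltr_wpDl// mulrC; apply: le_lt_trans.
by rewrite ler_wpM2r// lerDl.
Qed.

End bounded_expectation.

Section law_characterization.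
Context (R : realType).
Context (d1 : measure_display) (T1 : measurableType d1) (P1 : probability T1 R).
Context (d2 : measure_display) (T2 : measurableType d2) (P2 : probability T2 R).
Variables (f : T1 -> R) (g : T2 -> R).
Hypotheses (mf : measurable_fun setT f) (mg : measurable_fun setT g).

Lemma measurable_gt_ray d (T : measurableType d) (h : T -> R) (x : R) :
  measurable_fun setT h -> measurable [set w | x < h w].
Proof.
move=> mh; have -> : [set w | x < h w] = h @^-1` `]x, +oo[.
  by apply/seteqP; split => w /=; rewrite in_itv/= andbT.
by rewrite -[X in measurable X]setTI; exact: mh.
Qed.

Lemma eq_in_law_of_rays :
  (forall x, P1 [set w | x < f w] = P2 [set w | x < g w]) -> eq_in_law P1 P2 f g.
Proof.
move=> h; split => //.
pose f' : {mfun T1 >-> R} := mfun_Sub (mem_set mf).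
pose g' : {mfun T2 >-> R} := mfun_Sub (mem_set mg).
move=> A mA; change (distribution P1 f' A = distribution P2 g' A).
apply: (@measure_unique _ _ _ (@RGenOInfty.G R) (fun k => `](- k%:R), +oo[%classic)).
- exact: RGenOInfty.measurableE.
- move=> _ _ [x ->] [y ->]; exists (Num.max x y).
  by apply/seteqP; split=> z /=; rewrite !in_itv/= !andbT gt_max; [move=> [-> ->]|move/andP].
- by move=> k; eexists.
- apply/seteqP; split=> // x _; exists (Num.truncn `|x|).+1 => //=.
  rewrite in_itv/= andbT ltrNl (le_lt_trans (ler_norm _))// normrN.
  by have /andP[] := truncn_itv (normr_ge0 x).
- move=> _ [x ->]; change (P1 (f @^-1` `]x, +oo[) = P2 (g @^-1` `]x, +oo[)).
  have -> : f @^-1` `]x, +oo[ = [set w | x < f w].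
    by apply/seteqP; split => w /=; rewrite in_itv/= andbT.
  have -> : g @^-1` `]x, +oo[ = [set w | x < g w].
    by apply/seteqP; split => w /=; rewrite in_itv/= andbT.
  exact: h.
- by move=> k; rewrite ltey_eq fin_num_measure.
- exact: mA.
Qed.

End law_characterization.

(* The kernel [(1 - exp(-N x)) ^ m] with [m] of order [N exp(N y)] converges to the
   indicator of [x > y], and its mean only involves the Laplace transform. *)
Section laplace.
Context (R : realType).

Lemma bernoulli_ge (z : R) (m : nat) : 0 <= z <= 1 -> 1 - m%:R * z <= (1 - z) ^+ m.
Proof.
move=> /andP[z0 z1]; elim: m => [|m IH]; first by rewrite expr0 mul0r subr0.
rewrite exprS -natr1.
have m0 : (0 : R) <= m%:R by [].
have : (1 - z) * (1 - m%:R * z) <= (1 - z) * (1 - z) ^+ m.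
  by rewrite ler_wpM2l// subr_ge0.
nra.
Qed.

Definition laplace_order (n : nat) (y : R) : nat :=
  (Num.truncn (n.+1%:R * expR (n.+1%:R * y))).+1.

Definition laplace_kernel (n : nat) (y x : R) : R :=
  (1 - expR (- (n.+1%:R * x))) ^+ laplace_order n y.

Let N0 (n : nat) : (0 : R) < n.+1%:R. Proof. by []. Qed.

Lemma laplace_orderP n y : n.+1%:R * expR (n.+1%:R * y) <= (laplace_order n y)%:R
  <= n.+1%:R * expR (n.+1%:R * y) + 1.
Proof.
have /truncn_itv/andP[h1 h2] : 0 <= n.+1%:R * expR (n.+1%:R * y).
  by rewrite mulr_ge0// expR_ge0.
by rewrite /laplace_order (ltW h2)/= -natr1 lerD2r.
Qed.

Let expN01 n (x : R) : 0 <= x -> 0 <= expR (- (n.+1%:R * x)) <= 1.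
Proof. by move=> x0; rewrite expR_ge0 -expR0 ler_expR oppr_le0 mulr_ge0. Qed.

Lemma laplace_kernel01 n y x : 0 <= x -> 0 <= laplace_kernel n y x <= 1.
Proof.
move=> /(expN01 n)/andP[z0 z1]; rewrite exprn_ge0 ?subr_ge0//=.
by rewrite exprn_ile1// ?subr_ge0// gerBl.
Qed.

(** With [N = n.+1], [z = exp(- N x)] and [m] the order, [(1 - z) ^ m <= exp(- m z)] and
    [m z >= N exp(N (y - x)) >= N]. The extra factor [N] in the order gives decay even at [x = y],
    so that the limit is the indicator of the strict inequality. *)
Lemma laplace_kernel_le n y x : 0 <= x -> x <= y -> laplace_kernel n y x <= n.+1%:R^-1.
Proof.
move=> x0 xy; have /andP[z0 z1] := expN01 n x0.
apply: (@le_trans _ _ (expR (- expR (- (n.+1%:R * x))) ^+ laplace_order n y)).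
  by rewrite lerXn2r ?nnegrE ?subr_ge0 ?expR_ge0//; exact: expR_ge1Dx.
rewrite -expRM_natl mulrN expRN lef_pV2 ?posrE ?expR_gt0//.
have h : n.+1%:R <= (laplace_order n y)%:R * expR (- (n.+1%:R * x)) :> R.
  have /andP[h _] := laplace_orderP n y.
  apply: (@le_trans _ _ (n.+1%:R * expR (n.+1%:R * y) * expR (- (n.+1%:R * x)))).
    by rewrite -mulrA -expRD ler_peMr// -expR0 ler_expR -mulrBr mulr_ge0// subr_ge0.
  by rewrite ler_wpM2r.
by rewrite (le_trans h)// (le_trans _ (expR_ge1Dx _))// lerDr.
Qed.

(** Bernoulli's inequality bounds the defect by [m z], hence by [2 N exp(- N c)] with [c = x - y];
    then [r ^ 2 exp(- r) <= 2] at [r = N c] gives the constant 4. *)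
Lemma laplace_kernel_ge n y x : 0 <= y -> y < x ->
  1 - laplace_kernel n y x <= 4 / (x - y) ^+ 2 * n.+1%:R^-1.
Proof.
move=> y0 yx; have x0 : 0 <= x by rewrite (le_trans y0)// ltW.
have := bernoulli_ge (laplace_order n y) (expN01 n x0); rewrite -/(laplace_kernel n y x).
have /andP[_ h] := laplace_orderP n y.
have N1 : (1 : R) <= n.+1%:R by rewrite ler1n.
have := expN01 n x0.
set N : R := n.+1%:R in h N1 *.
set z := expR (- (N * x)) => /andP[z0 z1] hb.
have c0 : 0 < x - y by rewrite subr_gt0.
set c := x - y in c0 *.
have zE : expR (N * y) * z = expR (- (N * c)).
  by rewrite /z -expRD; congr expR; rewrite /c; ring.
have zle : z <= expR (- (N * c)).
  by rewrite -zE ler_peMl// -expR0 ler_expR mulr_ge0//; lra.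
have ec : expR (- (N * c)) * (N * c) ^+ 2 <= 2.
  have Nc0 : 0 <= N * c by apply: mulr_ge0; lra.
  have := expR_ge1Dxn 1 Nc0; rewrite (_ : 2`!%:R = 2 :> R)// => h2.
  have e0 := expR_gt0 (N * c).
  rewrite expRN ler_pdivrMl//; lra.
have hz : 1 - laplace_kernel n y x <= 2 * N * expR (- (N * c)).
  have : (laplace_order n y)%:R * z <= (N * expR (N * y) + 1) * z by rewrite ler_wpM2r.
  rewrite mulrDl -mulrA zE mul1r => h3.
  have e0 := expR_gt0 (- (N * c)).
  have : expR (- (N * c)) <= N * expR (- (N * c)) by rewrite ler_peMl// ltW.
  lra.
apply: (le_trans hz).
have cN : 0 < c ^+ 2 * N by rewrite mulr_gt0 ?exprn_gt0//; lra.
rewrite (_ : 4 / c ^+ 2 / N = 4 / (c ^+ 2 * N)); last by rewrite (invfM (c ^+ 2)) mulrA.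
rewrite ler_pdivlMr//; nra.
Qed.

Lemma cvg_laplace_kernel y x : 0 <= y -> 0 <= x ->
  laplace_kernel n y x @[n --> \oo] --> ((y < x)%R%:R : R).
Proof.
move=> y0 x0; case: ltP => [yx|xy].
  apply: (@cvg_of_harmonic_bound _ _ _ (4 / (x - y) ^+ 2)) => n.
  have /andP[_ k1] := laplace_kernel01 n y x0.
  by rewrite distrC ger0_norm ?subr_ge0//; exact: laplace_kernel_ge.
apply: (@cvg_of_harmonic_bound _ _ _ 1) => n; have /andP[k0 _] := laplace_kernel01 n y x0.
by rewrite subr0 ger0_norm// mul1r; exact: laplace_kernel_le.
Qed.

Context (d1 : measure_display) (T1 : measurableType d1) (P1 : probability T1 R).
Context (d2 : measure_display) (T2 : measurableType d2) (P2 : probability T2 R).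
Variables (f : T1 -> R) (g : T2 -> R).
Hypotheses (mf : measurable_fun setT f) (mg : measurable_fun setT g).
Hypotheses (f0 : forall w, 0 <= f w) (g0 : forall w, 0 <= g w).
Hypothesis laplace_fg : forall l, 0 < l ->
  (\int[P1]_w (expR (- (l * f w)))%:E = \int[P2]_w (expR (- (l * g w)))%:E)%E.

Lemma measurable_laplace_term d (T : measurableType d) (h : T -> R) (N l : R) m :
  measurable_fun setT h ->
  measurable_fun setT (fun w => (1 - expR (- (N * h w))) ^+ m * expR (- (l * h w))).
Proof.
move=> mh; apply: measurable_funM.
  apply: measurable_funX; apply: measurable_funB => //.
  by apply: measurableT_comp => //; apply: measurableT_comp => //; exact: measurable_funM.
by apply: measurableT_comp => //; apply: measurableT_comp => //; exact: measurable_funM.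
Qed.

Lemma laplace_term_le1 (N l x : R) m : 0 <= N -> 0 <= l -> 0 <= x ->
  `|(1 - expR (- (N * x))) ^+ m * expR (- (l * x))| <= 1.
Proof.
move=> N0' l0 x0.
have h k : 0 <= k -> 0 <= expR (- (k * x)) <= 1.
  by move=> k0; rewrite expR_ge0 -expR0 ler_expR oppr_le0 mulr_ge0.
have /andP[a0 a1] := h _ N0'; have /andP[b0 b1] := h _ l0.
rewrite ger0_norm; last by rewrite mulr_ge0// exprn_ge0// subr_ge0.
by rewrite mulr_ile1// ?exprn_ge0 ?subr_ge0// exprn_ile1 ?subr_ge0// gerBl.
Qed.

(** Induction on [m] for all [l] at once replaces the binomial expansion: peeling off one factor
    produces the same expression at [l] and at [l + N]. At [m = 0] and [l = 0], where the hypothesis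
    on Laplace transforms is silent, both sides are total masses. *)
Lemma laplace_term_eq (N l : R) m : 0 <= N -> 0 <= l ->
  (\int[P1]_w ((1 - expR (- (N * f w))) ^+ m * expR (- (l * f w)))%:E =
   \int[P2]_w ((1 - expR (- (N * g w))) ^+ m * expR (- (l * g w)))%:E)%E.
Proof.
move=> N0'; elim: m l => [|m IH] l l0.
  under eq_integral do rewrite expr0 mul1r.
  under [RHS]eq_integral do rewrite expr0 mul1r.
  have [->|ln0] := eqVneq l 0; last by apply: laplace_fg; rewrite lt_neqAle eq_sym ln0.
  under eq_integral do rewrite mul0r oppr0 expR0.
  under [RHS]eq_integral do rewrite mul0r oppr0 expR0.
  by rewrite !integral_cst//= !probability_setT.
have e (x : R) : (1 - expR (- (N * x))) ^+ m.+1 * expR (- (l * x)) =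
    (1 - expR (- (N * x))) ^+ m * expR (- (l * x)) -
    (1 - expR (- (N * x))) ^+ m * expR (- ((l + N) * x)).
  by rewrite exprSr mulrDl opprD expRD; ring.
under eq_integral do rewrite e EFinB.
under [RHS]eq_integral do rewrite e EFinB.
rewrite !integralB_EFin//; last 4 first.
- by apply: bounded_integrable => [|w]; [exact: measurable_laplace_term|exact: laplace_term_le1].
- by apply: bounded_integrable => [|w]; [exact: measurable_laplace_term|
    apply: laplace_term_le1 => //; exact: addr_ge0].
- by apply: bounded_integrable => [|w]; [exact: measurable_laplace_term|exact: laplace_term_le1].
- by apply: bounded_integrable => [|w]; [exact: measurable_laplace_term|
    apply: laplace_term_le1 => //; exact: addr_ge0].
by rewrite !IH// addr_ge0.
Qed.

Lemma cvg_laplace_kernel_expectation d (T : measurableType d) (P : probability T R)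
    (h : T -> R) (y : R) : measurable_fun setT h -> (forall w, 0 <= h w) -> 0 <= y ->
  (\int[P]_w (laplace_kernel n y (h w))%:E)%E @[n --> \oo] --> P [set w | y < h w].
Proof.
move=> mh h0 y0.
have -> : P [set w | y < h w] = (\int[P]_w (\1_[set w | y < h w] w)%:E)%E.
  by rewrite integral_indic// ?setIT//; exact: measurable_gt_ray.
apply: (@cvg_bounded_expectation _ _ _ _ _ _ 1).
- move=> n; apply: eq_measurable_fun (@measurable_laplace_term _ _ h n.+1%:R 0
    (laplace_order n y) mh) => w _.
  by rewrite mul0r oppr0 expR0 mulr1.
- by apply: measurable_indic; exact: measurable_gt_ray.
- by apply: aeW => w n; have /andP[k0 k1] := laplace_kernel01 n y (h0 w); rewrite ger0_norm.
- apply: aeW => w; have := cvg_laplace_kernel y0 (h0 w).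
  rewrite indicE; case: ltP => yh; first by rewrite mem_set.
  by rewrite memNset//= => /(le_lt_trans yh); rewrite ltxx.
Qed.

Lemma eq_in_law_of_laplace : eq_in_law P1 P2 f g.
Proof.
apply: eq_in_law_of_rays => // y; have [y0|y0] := leP 0 y; last first.
  have -> : [set w | y < f w] = setT by apply/seteqP; split=> // w _ /=; exact: lt_le_trans (f0 w).
  have -> : [set w | y < g w] = setT by apply/seteqP; split=> // w _ /=; exact: lt_le_trans (g0 w).
  by rewrite !probability_setT.
have := cvg_laplace_kernel_expectation (P := P2) mg g0 y0.
have := cvg_laplace_kernel_expectation (P := P1) mf f0 y0.
have -> : (fun n => \int[P1]_w (laplace_kernel n y (f w))%:E)%E =
          (fun n => \int[P2]_w (laplace_kernel n y (g w))%:E)%E.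
  apply/funext => n; have := @laplace_term_eq n.+1%:R 0 (laplace_order n y) (ltW (N0 n)) (lexx 0).
  under eq_integral do rewrite mul0r oppr0 expR0 mulr1.
  by under [in RHS]eq_integral do rewrite mul0r oppr0 expR0 mulr1.
by move=> h1 h2; exact: (cvg_unique _ h1 h2).
Qed.

End laplace.

(** * Integration against a measure with a density *)

Section density.
Context d (T : measurableType d) (R : realType).
Variables (mu nu : {measure set T -> \bar R}) (p : T -> R).
Hypotheses (mp : measurable_fun setT p) (p0 : forall x, 0 <= p x).
Hypothesis nuE : forall A, measurable A -> nu A = (\int[mu]_(x in A) (p x)%:E)%E.

Let integral_density_indic E : measurable E ->
  (\int[nu]_x (\1_E x)%:E = \int[mu]_x ((\1_E x)%:E * (p x)%:E))%E.
Proof.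
move=> mE; rewrite integral_indic//= setIT nuE// [LHS]integral_mkcond/=.
apply: eq_integral => x _; rewrite !patchE indicE.
by case: ifPn => xE; rewrite ?mul1e ?mul0e.
Qed.

Import HBNNSimple.

Let integral_density_nnsfun (f : {nnsfun T >-> R}) :
  (\int[nu]_x (f x)%:E = \int[mu]_x ((f x)%:E * (p x)%:E))%E.
Proof.
under [LHS]eq_integral do rewrite fimfunE -fsumEFin//.
rewrite [LHS]ge0_integral_fsum//; last 2 first.
  - by move=> r; exact/measurable_EFinP/measurableT_comp.
  - by move=> n x _; rewrite EFinM nnfun_muleindic_ge0.
under [RHS]eq_integral.
  move=> x xD; rewrite fimfunE -fsumEFin// ge0_mule_fsuml; last first.
    by move=> r; rewrite EFinM nnfun_muleindic_ge0.
  over.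
rewrite [RHS]ge0_integral_fsum//; last 2 first.
  - move=> r; apply/measurable_EFinP; apply: measurable_funM => //.
    exact: measurableT_comp.
  - move=> n x _; apply: mule_ge0; last by rewrite lee_fin.
    by rewrite EFinM nnfun_muleindic_ge0.
apply: eq_fsbigr => r _.
under [RHS]eq_integral do rewrite EFinM -muleA.
rewrite integralZl_indic_nnsfun//= integral_density_indic//.
have [r0|r0] := leP 0 r.
  rewrite ge0_integralZl//.
  + apply: emeasurable_funM; [exact/measurable_EFinP/measurable_indic|exact/measurable_EFinP].
  + by move=> x _; rewrite mule_ge0 ?lee_fin.
have -> : f @^-1` [set r] = set0.
  by rewrite preimage_nnfun0.
have z x : ((\1_(set0 : set T) x)%:E * (p x)%:E = 0)%E by rewrite indic0 mul0e.
rewrite integral0_eq => [|x _]; last exact: z.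
by rewrite mule0 integral0_eq// => x _; rewrite z mule0.
Qed.

Lemma ge0_integral_density (f : T -> \bar R) :
  measurable_fun setT f -> (forall x, 0 <= f x)%E ->
  (\int[nu]_x f x = \int[mu]_x (f x * (p x)%:E))%E.
Proof.
move=> mf f0.
pose f_ := nnsfun_approx measurableT mf.
transitivity (lim (\int[nu]_x (f_ n x)%:E @[n --> \oo])%E).
  rewrite -monotone_convergence//=.
  - apply: eq_integral => ? /[!inE] xD; apply/esym/cvg_lim => //=.
    exact: cvg_nnsfun_approx.
  - by move=> n; exact/measurable_EFinP/measurable_funTS.
  - by move=> n ? _; rewrite lee_fin.
  - by move=> ? _ ? ? mn; rewrite lee_fin; exact/lefP/nd_nnsfun_approx.
under eq_fun do rewrite integral_density_nnsfun.
rewrite -monotone_convergence//=.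
- apply: eq_integral => x _; apply/cvg_lim => //.
  by apply: cvgeMr => //; exact: cvg_nnsfun_approx.
- by move=> n; apply: emeasurable_funM; exact/measurable_EFinP.
- by move=> n x _; rewrite mule_ge0 ?lee_fin.
- move=> x _ m n mn; rewrite lee_wpmul2r ?lee_fin//.
  exact/lefP/nd_nnsfun_approx.
Qed.

End density.

(** * Moments and anti-concentration of a centred Gaussian variable *)

Section gaussian_increment.
Context (R : realType) (d : measure_display) (Omega : measurableType d).
Variables (P : probability Omega R) (N : Omega -> R) (s : R).
Hypotheses (mN : measurable_fun setT N) (s0 : 0 < s).
Hypothesis lawN : forall A : set R, measurable A -> P (N @^-1` A) = normal_prob 0 s A.

Local Notation mu := (@lebesgue_measure R).

Lemma gaussian_ge0_expectation (f : R -> \bar R) : measurable_fun setT f ->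
  (forall x, 0 <= f x)%E ->
  (\int[P]_w f (N w) = \int[mu]_x (f x * (normal_pdf 0 s x)%:E))%E.
Proof.
move=> mf f0; pose N' : {mfun Omega >-> measurableTypeR R} :=
  @mfun_Sub _ _ Omega (measurableTypeR R) N (mem_set mN).
rewrite -(@ge0_integral_density _ (measurableTypeR R) _ mu (distribution P N'))//.
- by rewrite ge0_integral_distribution.
- exact: measurable_normal_pdf.
- by move=> x; exact: normal_pdf_ge0.
Qed.

Let sn0 : s != 0. Proof. by rewrite gt_eqF. Qed.
Let t0 : 0 < s * Num.sqrt 2. Proof. by rewrite mulr_gt0// sqrtr_gt0. Qed.

(** Half of the Gaussian exponent absorbs the fourth power. With [y = x ^ 2 / (4 s ^ 2)] the left
    side is [16 y ^ 2 s ^ 4] times the peak times [exp(- 2 y)], and [y ^ 2 exp(- y) <= 2]; the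
    remaining [exp(- y)] belongs to the density of standard deviation [s sqrt 2], whose peak is
    smaller by [sqrt 2 <= 2]. Hence [64 = 16 * 2 * 2]. *)
Let gaussian_pdf_fourth_power (x : R) :
  x ^+ 4 * normal_pdf 0 s x <= 64 * s ^+ 4 * normal_pdf 0 (s * Num.sqrt 2) x.
Proof.
rewrite !normal_pdfE ?gt_eqF//.
rewrite /normal_peak /normal_fun subr0 exprMn sqr_sqrtr//.
have s2 : 0 < s ^+ 2 by rewrite exprn_gt0.
have -> : s ^+ 2 * 2 * pi *+ 2 = s ^+ 2 * pi *+ 2 * 2 by ring.
rewrite [Num.sqrt (_ * 2)]sqrtrM; last first.
  by rewrite mulrn_wge0// mulr_ge0 ?pi_ge0// ltW.
have c0 : 0 < Num.sqrt (s ^+ 2 * pi *+ 2).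
  by rewrite sqrtr_gt0 mulrn_wgt0// mulr_gt0 ?pi_gt0.
rewrite invfM.
set c := (Num.sqrt (s ^+ 2 * pi *+ 2))^-1.
have {}c0 : 0 < c by rewrite invr_gt0.
pose y := x ^+ 2 / (4 * s ^+ 2).
have yE : x ^+ 2 = y * (4 * s ^+ 2) by rewrite /y divfK// gt_eqF// mulr_gt0.
have -> : - x ^+ 2 / (s ^+ 2 *+ 2) = (- y) + (- y).
  by rewrite yE -mulr_natl; field; rewrite gt_eqF.
have -> : - x ^+ 2 / ((s ^+ 2 * 2) *+ 2) = - y.
  by rewrite yE -mulr_natl; field; rewrite gt_eqF.
have -> : x ^+ 4 = y ^+ 2 * 16 * s ^+ 4.
  by rewrite (exprM x 2 2) yE; ring.
rewrite expRD.
have y0 : 0 <= y by rewrite /y divr_ge0 ?sqr_ge0// mulr_ge0// ltW.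
have e0 := expR_gt0 (- y).
have ye : y ^+ 2 * expR (- y) <= 2.
  have := @expR_ge1Dxn R y 1 y0; rewrite (_ : 2`!%:R = 2 :> R)// => h2.
  by rewrite expRN ler_pdivrMr ?expR_gt0//; lra.
have r2 : (Num.sqrt 2)^-1 >= 1 / 2 :> R.
  have r2 : (Num.sqrt 2) ^+ 2 = 2 :> R by rewrite sqr_sqrtr.
  have r20 : 0 < Num.sqrt 2 :> R by rewrite sqrtr_gt0.
  rewrite div1r lef_pV2 ?posrE//; nra.
have s4 : 0 <= s ^+ 4 by rewrite exprn_ge0// ltW.
have k : 0 <= s ^+ 4 * c * expR (- y) by rewrite mulr_ge0// ?mulr_ge0// ltW.
rewrite [leLHS](_ : _ = (s ^+ 4 * c * expR (- y)) * (16 * (y ^+ 2 * expR (- y)))); last by ring.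
rewrite [leRHS](_ : _ = (s ^+ 4 * c * expR (- y)) * (64 * (Num.sqrt 2)^-1)); last by ring.
rewrite ler_wpM2l//; lra.
Qed.

Lemma gaussian_fourth_moment :
  (\int[P]_w ((N w) ^+ 4)%:E <= (64 * s ^+ 4)%:E)%E.
Proof.
have mx4 : measurable_fun setT (fun x : R => (x ^+ 4)%:E).
  by apply/measurable_EFinP; exact: exprn_measurable.
have x40 (x : R) : 0 <= x ^+ 4 by rewrite exprn_even_ge0.
rewrite (@gaussian_ge0_expectation (fun x => (x ^+ 4)%:E))//.
apply: (@le_trans _ _ (\int[mu]_x ((64 * s ^+ 4)%:E * (normal_pdf 0 (s * Num.sqrt 2) x)%:E))%E).
  apply: ge0_le_integral => //=.
  - by move=> x _; rewrite mule_ge0 ?lee_fin ?normal_pdf_ge0.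
  - by apply: emeasurable_funM => //; apply/measurable_EFinP; exact: measurable_normal_pdf.
  - by apply: emeasurable_funM => //; apply/measurable_EFinP; exact: measurable_normal_pdf.
  by move=> x _; rewrite -!EFinM lee_fin; exact: gaussian_pdf_fourth_power.
rewrite ge0_integralZl//.
- by rewrite integral_normal_pdf mule1.
- by apply/measurable_EFinP; exact: measurable_normal_pdf.
- by move=> x _; rewrite lee_fin normal_pdf_ge0.
- by rewrite lee_fin mulr_ge0// exprn_ge0// ltW.
Qed.

Lemma gaussian_integrable : P.-integrable setT (EFin \o N).
Proof.
apply/integrableP; split; first exact/measurable_EFinP.
have m4 : measurable_fun setT (fun w => ((N w) ^+ 4)%:E).
  by apply/measurable_EFinP; exact: measurable_funX.
apply: (@le_lt_trans _ _ (\int[P]_w (1%:E + ((N w) ^+ 4)%:E))%E).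
  apply: ge0_le_integral => //=.
  - by apply/measurable_EFinP; exact: measurableT_comp.
  - exact: emeasurable_funD.
  - move=> w _; rewrite -EFinD lee_fin.
    have a0 := normr_ge0 (N w).
    have -> : (N w) ^+ 4 = `|N w| ^+ 4.
      by rewrite -normrX ger0_norm// exprn_even_ge0.
    have [h|h] := leP `|N w| 1; first by rewrite ler_wpDr// exprn_ge0.
    have h2 : 1 <= `|N w| ^+ 3 by rewrite exprn_ege1// ltW.
    rewrite exprS; nra.
rewrite ge0_integralD//; last by move=> w _; rewrite lee_fin exprn_even_ge0.
rewrite integral_cst//= probability_setT mule1.
have := gaussian_fourth_moment.
by case: (\int[P]_w _)%E => // r h; rewrite -EFinD ltry.
Qed.

(** The positive and negative parts have the same finite mean, because the density is even and
    Lebesgue measure is invariant under [x -> - x]. *)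
Lemma gaussian_mean0 : (\int[P]_w (N w)%:E)%E = 0%E.
Proof.
have mpos : measurable_fun setT (fun x : R => (Num.max x 0)%:E).
  by apply/measurable_EFinP; exact: measurable_maxr.
have mneg : measurable_fun setT (fun x : R => (Num.max (- x) 0)%:E).
  by apply/measurable_EFinP; apply: measurable_maxr.
have pos0 (x : R) : (0 <= (Num.max x 0)%:E)%E by rewrite lee_fin le_max lexx orbT.
have mpdf : measurable_fun setT (fun x : R => (normal_pdf 0 s x)%:E).
  by apply/measurable_EFinP; exact: measurable_normal_pdf.
rewrite integralE.
rewrite [X in (X - _)%E](_ : _ = \int[P]_w (Num.max (N w) 0)%:E)%E; last first.
  by apply: eq_integral => w _; rewrite funeposE/= -EFin_max.
rewrite [X in (_ - X)%E](_ : _ = \int[P]_w (Num.max (- N w) 0)%:E)%E; last first.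
  by apply: eq_integral => w _; rewrite funenegE/= -EFin_max.
rewrite (@gaussian_ge0_expectation (fun x => (Num.max x 0)%:E))//.
rewrite (@gaussian_ge0_expectation (fun x => (Num.max (- x) 0)%:E))//.
have fin : (\int[mu]_x ((Num.max x 0)%:E * (normal_pdf 0 s x)%:E))%E \is a fin_num.
  rewrite -(@gaussian_ge0_expectation (fun x => (Num.max x 0)%:E))//.
  rewrite ge0_fin_numE; last exact: integral_ge0.
  have /integrableP[_] := gaussian_integrable; apply: le_lt_trans.
  apply: ge0_le_integral => //=.
  - by apply: (measurableT_comp mpos).
  - by apply/measurable_EFinP; exact: measurableT_comp.
  - by move=> w _; rewrite lee_fin ge_max ler_norm/=.
suff <- : (\int[mu]_x ((Num.max x 0)%:E * (normal_pdf 0 s x)%:E) =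
   \int[mu]_x ((Num.max (- x) 0)%:E * (normal_pdf 0 s x)%:E))%E by rewrite subee.
pose G (x : R) := ((Num.max (- x) 0)%:E * (normal_pdf 0 s x)%:E)%E.
have mG : measurable_fun setT G by exact: emeasurable_funM.
have G0 x : (0 <= G x)%E by rewrite mule_ge0// lee_fin normal_pdf_ge0.
have mopp : @measurable_fun _ _ (measurableTypeR R) (measurableTypeR R) setT (-%R : R -> R).
  exact: oppr_measurable.
transitivity (\int[mu]_x G (- (x : R))%R)%E.
  apply: eq_integral => x _; rewrite /G opprK !normal_pdfE// /normal_fun.
  by rewrite !subr0 sqrrN.
rewrite -(@ge0_integral_pushforward _ _ (measurableTypeR R) (measurableTypeR R) _ (-%R : R -> R) mopp mu setT G)//.
apply: eq_measure_integral => A mA _.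
exact: lebesgue_measureN.
Qed.

(** Length of the interval times the maximum of the density. Since the peak decays like [1 / s], a
    Brownian path cannot stay bounded, which is how unboundedness of the local time is obtained. *)
Lemma gaussian_concentration (K : R) : 0 <= K ->
  (P [set w | (`|N w| <= K)%R] <= (2 * K * normal_peak s)%:E)%E.
Proof.
move=> K0; have -> : [set w | (`|N w| <= K)%R] = N @^-1` `[- K, K].
  by apply/seteqP; split=> w /=; rewrite in_itv/= ler_norml.
rewrite lawN// /normal_prob.
apply: (@le_trans _ _ (\int[mu]_(x in `[(- K)%R, K]) (normal_peak s)%:E)%E).
  apply: ge0_le_integral => //=.
  - by move=> x _; rewrite lee_fin normal_pdf_ge0.
  - by apply/measurable_EFinP/measurable_funTS; exact: measurable_normal_pdf.
  - by move=> x _; rewrite lee_fin normal_pdf_ub.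
rewrite integral_cst//= lebesgue_measure_itv/= lte_fin.
case: ifPn => _; last by rewrite mule0 lee_fin mulr_ge0 ?normal_peak_ge0// mulr_ge0.
by rewrite -EFinB -EFinM lee_fin; have := normal_peak_ge0 s; nra.
Qed.

End gaussian_increment.

(** * Exponential martingales along a path *)

Section pathwise.
Context (R : realType).
Implicit Types f : R -> R.

(** Composing with [Num.max 0] freezes the path before time 0 and turns continuity on the half-line
    into plain continuity on the line. *)
Lemma continuous_extension f : {within `[0, +oo[, continuous f} ->
  continuous (fun t : R => f (Num.max 0 t)).
Proof.
move=> cf t; apply/(@cvgrPdist_lt _ R^o) => e e0.
have m0 (v : R) : 0 <= Num.max 0 v by rewrite le_max lexx.
have := (continuous_within_itvcyP 0 f).1 cf => -[cf1 cf2].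
have [t0|t0] := ltP 0 t.
  have := cf1 t; rewrite in_itv/= t0 => /(_ isT)/(@cvgrPdist_lt _ R^o)/(_ e e0) [r /= r0 rP].
  exists (Num.min r t); rewrite /= ?lt_min ?r0// => v /=; rewrite lt_min => /andP[vr vt].
  by rewrite !max_r ?(ltW t0)//; [exact: rP|move: vt; rewrite ltr_norml; lra].
have [tn|tz] := ltP t 0.
  exists (- t); rewrite /= ?oppr_gt0// => v /=; rewrite ltr_norml => vt.
  by rewrite !max_l ?subrr ?normr0//; lra.
have {t0 tz} -> : t = 0 by apply/eqP; rewrite eq_le t0.
move/(@cvgrPdist_lt _ R^o)/(_ e e0) : cf2 => [r /= r0 rP].
exists r => //= v /=; rewrite sub0r normrN => vr.
have [v0|v0] := leP v 0; first by rewrite subrr normr0.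
by apply: rP => //=; rewrite sub0r normrN.
Qed.

Lemma segment_unif_continuous f (S e : R) : continuous f -> 0 < e ->
  exists2 d, 0 < d & forall v w, 0 <= v <= S -> `|v - w| < d -> `|f v - f w| < e.
Proof.
move=> cf e0.
have := (compact_near_coveringP _).1 (@segment_compact R 0 S).
move=> /(_ R 0^'+ (fun d v => forall w, `|v - w| < d -> `|f v - f w| < e) _) [].
  move=> x _; have := cf x => /(@cvgrPdist_lt _ R^o)/(_ (e / 2)).
  rewrite divr_gt0// => /(_ isT)[d /= d0 dP].
  have d20 : 0 < d / 2 by rewrite divr_gt0.
  exists (ball x (d / 2), [set r | r < d / 2]).
    split; first by apply/nbhs_ballP; exists (d / 2).
    by exact: nbhs_right_lt.
  move=> [v r] /= [xv rd] w vw.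
  have xv' : `|x - v| < d / 2 by [].
  have h1 : `|f x - f v| < e / 2 by apply: dP => /=; lra.
  have h2 : `|f x - f w| < e / 2.
    apply: dP => /=; have -> : x - w = (x - v) + (v - w) by ring.
    by apply: le_lt_trans (ler_normD _ _) _; lra.
  have -> : f v - f w = (f x - f w) - (f x - f v) by ring.
  by apply: le_lt_trans (ler_normB _ _) _; lra.
move=> d /= d0 dP; exists (d / 2); first by rewrite divr_gt0.
move=> v w vS vw; apply: (dP (d / 2)) => //=.
- by rewrite sub0r normrN gtr0_norm ?divr_gt0//; lra.
- by rewrite divr_gt0.
Qed.

Lemma expR_taylor1 (z : R) : `|expR z - 1 - z| <= z ^+ 2 * expR `|z|.
Proof.
have h1 := expR_ge1Dx z; have h2 := expR_ge1Dx (- z).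
have e0 : 0 < expR z := expR_gt0 z.
have eV : expR (- z) * expR z = 1 by rewrite -expRD addNr expR0.
have h3 : expR z - 1 <= z * expR z by nra.
rewrite ger0_norm; last lra.
have [z0|z0] := leP 0 z; first by rewrite ger0_norm//; nra.
rewrite ltr0_norm//.
have h4 : 1 <= expR (- z) by lra.
have h5 : 0 <= z ^+ 2 by exact: sqr_ge0.
nra.
Qed.

(** As [g] is nondecreasing, the indicators are a block of ones followed by zeros. The index [j] is
    the last grid point, up to [m], that has not passed the level, and it is the same for all
    summands [F]. *)
Lemma sum_stopped (u : R) (g : nat -> R) (m : nat) : g 0%N <= u ->
  (forall i, g i <= g i.+1) ->
  exists j, [/\ (j <= m)%N, g j <= u, j = m \/ u < g j.+1 &
   forall F : nat -> R, \sum_(i < m) (g i.+1 <= u)%R%:R * F i = \sum_(i < j) F i].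
Proof.
move=> g0 ndg; elim: m => [|m [j [jm gj jE IH]]].
  by exists 0%N; split => //; [left|move=> F; rewrite !big_ord0].
have [gm|gm] := leP (g m.+1) u.
- have {jE} jE : j = m.
    case: jE => // gj1; exfalso; move: gj1; rewrite ltNge => /negP; apply.
    rewrite (le_trans _ gm)//.
    have : {homo g : i k / (i <= k)%N >-> i <= k}.
      by apply: homo_leq => //; exact: le_trans.
    by apply.
  exists m.+1; split => //; first by left.
  by move=> F; rewrite big_ord_recr/= IH gm mul1r jE big_ord_recr.
- exists j; split => //; first by rewrite ltnW.
    by case: jE => [->|]; right.
  by move=> F; rewrite big_ord_recr/= IH leNgt gm/= mul0r addr0.
Qed.

Variables (a b u rho : R).
Hypotheses (ab : a < b) (rho0 : rho != 0) (u0 : 0 <= u).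
Variables (x B p q : R -> R).
Hypothesis xE : forall t : R, 0 <= t -> x t = x 0 + B t + p t - q t.
Hypothesis xab : forall t : R, 0 <= t -> a <= x t <= b.
Hypotheses (p0 : p 0 = 0) (q0 : q 0 = 0).
Hypothesis ndp : forall s t : R, 0 <= s -> s <= t -> p s <= p t.
Hypothesis ndq : forall s t : R, 0 <= s -> s <= t -> q s <= q t.
Hypothesis supp_p : forall s t : R, 0 <= s -> s <= t ->
  (forall v : R, s <= v <= t -> x v <> a) -> p t = p s.
Hypothesis supp_q : forall s t : R, 0 <= s -> s <= t ->
  (forall v : R, s <= v <= t -> x v <> b) -> q t = q s.
Hypotheses (cp : continuous (fun t : R => p (Num.max 0 t)))
  (cq : continuous (fun t : R => q (Num.max 0 t)))
  (cx : continuous (fun t : R => x (Num.max 0 t))).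

Definition slope : R := (rho - 1) / (b - a).
(** [affine_weight] is 1 at [a] and [rho] at [b]. In the differential of the martingale the
    coefficient of [dp] at [a] is [slope + rate_a] and that of [dq] at [b] is
    [- slope + rate_b * rho]; both rates are chosen to make these vanish. *)
Definition rate_a : R := - slope.
Definition rate_b : R := slope / rho.
Definition affine_weight (y : R) : R := 1 + slope * (y - a).
Definition exp_weight (t : R) : R := expR (rate_a * p t + rate_b * q t).
Definition exp_martingale (t : R) : R := affine_weight (x t) * exp_weight t.
(* Discretisation of the martingale stopped at local time [u]; the indicator looks at
   the right end of each step, so that every exponential weight stays bounded. *)
Definition stopped_sum (s : nat -> R) (m : nat) : R :=
  exp_martingale 0 + slope * \sum_(i < m)
    ((p (s i.+1) + q (s i.+1) <= u)%R%:R * (exp_weight (s i) * (B (s i.+1) - B (s i)))).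

Let L := `|rate_a| + `|rate_b|.
Let h := affine_weight.
Let A := exp_weight.
Let M := exp_martingale.
Let Hm := 1 + `|slope| * (b - a).

Let Hm0 : 0 <= Hm.
Proof. by rewrite /Hm addr_ge0// mulr_ge0// subr_ge0 ltW. Qed.

Let L0 : 0 <= L. Proof. by rewrite addr_ge0. Qed.

Let pge0 t : 0 <= t -> 0 <= p t. Proof. by move=> t0; rewrite -p0 ndp. Qed.
Let qge0 t : 0 <= t -> 0 <= q t. Proof. by move=> t0; rewrite -q0 ndq. Qed.

Let h_bound t : 0 <= t -> `|h (x t)| <= Hm.
Proof.
move=> t0; have /andP[ax xb] := xab t0.
rewrite /h /affine_weight (le_trans (ler_normD _ _))// normr1 lerD2l normrM.
by rewrite ler_wpM2l// ger0_norm; lra.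
Qed.

Let lin_bound y z : 0 <= y -> 0 <= z -> `|rate_a * y + rate_b * z| <= L * (y + z).
Proof.
move=> y0 z0; rewrite (le_trans (ler_normD _ _))// (normrM rate_a) (normrM rate_b).
rewrite (ger0_norm y0) (ger0_norm z0).
have := mulr_ge0 (normr_ge0 rate_a) z0; have := mulr_ge0 (normr_ge0 rate_b) y0.
rewrite /L; lra.
Qed.

Lemma exp_weight_bound t : 0 <= t -> p t + q t <= u ->
  0 <= exp_weight t <= expR ((`|rate_a| + `|rate_b|) * u).
Proof.
move=> t0 tu; rewrite /exp_weight expR_ge0 ler_expR/=.
rewrite (le_trans (ler_norm _))// (le_trans (lin_bound (pge0 t0) (qge0 t0)))//.
by rewrite ler_wpM2l.
Qed.

Let Cr := expR (L * u) * (Hm * L ^+ 2 * expR (L * u) + slope ^+ 2 * (1 + `|rho|^-1)).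

Let Cr0 : 0 <= Cr.
Proof.
rewrite mulr_ge0 ?expR_ge0// addr_ge0// mulr_ge0 ?expR_ge0 ?sqr_ge0//.
by rewrite mulr_ge0 ?sqr_ge0.
Qed.

Definition step_error (s t : R) : R :=
  M t - M s - slope * (A s * (B t - B s)).

(** An exact identity in place of a stochastic calculus formula: the increment of an affine function
    of [x] is linear, so the Brownian term cancels completely. There remain the second-order part of
    the exponential and, because the rates balance only at [a] and [b], terms carrying the distance
    of [x t] from the boundary point. *)
Lemma step_errorE s t : 0 <= s -> s <= t -> step_error s t =
  A s * (h (x t) * (expR (rate_a * (p t - p s) + rate_b * (q t - q s)) - 1
     - (rate_a * (p t - p s) + rate_b * (q t - q s)))
    - slope ^+ 2 * (x t - a) * (p t - p s)
    + slope ^+ 2 / rho * (x t - b) * (q t - q s)).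
Proof.
move=> s0 st; have t0 : 0 <= t by exact: le_trans st.
have BE : B t - B s = (x t - x s) - (p t - p s) + (q t - q s).
  by rewrite (xE t0) (xE s0); ring.
have AE : A t = A s * expR (rate_a * (p t - p s) + rate_b * (q t - q s)).
  by rewrite /A /exp_weight -expRD; congr expR; ring.
rewrite /step_error /M /exp_martingale -/A AE BE -/h.
set E := expR (_ + _); set As := A s.
have ba : b - a != 0 by rewrite subr_eq0 gt_eqF.
rewrite /h /affine_weight /rate_a /rate_b /slope; field.
by rewrite rho0 ba.
Qed.

(** If [p] grows on the step, then [x] visits [a] there, so [x t - a] is at most the oscillation
    [D]; likewise for [q] and [b]. Every term is thus a local time increment times a small quantity,
    and sums to something small. *)
Lemma step_error_bound s t D : 0 <= s -> s <= t -> p t + q t <= u ->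
  (forall v : R, s <= v <= t -> `|x t - x v| <= D) ->
  `|step_error s t| <=
  Cr * ((p t + q t) - (p s + q s)) * ((p t + q t) - (p s + q s) + D).
Proof.
move=> s0 st tu hD; have t0 : 0 <= t by exact: le_trans st.
have D0 : 0 <= D by rewrite (le_trans _ (hD t _)) ?st ?lexx.
have dp : 0 <= p t - p s by rewrite subr_ge0 ndp.
have dq : 0 <= q t - q s by rewrite subr_ge0 ndq.
have su : p s + q s <= u by lra.
have /andP[A0 Au] := exp_weight_bound s0 su.
rewrite step_errorE// normrM (ger0_norm A0).
set z := rate_a * _ + rate_b * _.
set g := p t + q t - _.
have gE : g = (p t - p s) + (q t - q s) by rewrite /g; ring.
have g0 : 0 <= g by lra.
have gu : g <= u by have := pge0 s0; have := qge0 s0; rewrite /g; lra.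
have zg : `|z| <= L * g by rewrite gE; exact: lin_bound.
have T1 : `|h (x t) * (expR z - 1 - z)| <= Hm * (L ^+ 2 * g ^+ 2 * expR (L * u)).
  rewrite normrM ler_pM// ?h_bound// (le_trans (expR_taylor1 z))//.
  apply: ler_pM; rewrite ?sqr_ge0 ?expR_ge0//.
    by rewrite -exprMn -real_normK ?num_real// lerXn2r ?nnegrE ?mulr_ge0.
  by rewrite ler_expR (le_trans zg)// ler_wpM2l.
have T2 : `|slope ^+ 2 * (x t - a) * (p t - p s)| <= slope ^+ 2 * (D * (p t - p s)).
  rewrite normrM (normrM (slope ^+ 2)) (ger0_norm dp) ger0_norm ?sqr_ge0//.
  rewrite -mulrA ler_wpM2l ?sqr_ge0//.
  have [[v [sv xv]]|nv] := pselect (exists v, s <= v <= t /\ x v = a).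
    by rewrite ler_wpM2r// -xv; exact: hD.
  rewrite (_ : p t - p s = 0) ?mulr0//; apply/eqP; rewrite subr_eq0; apply/eqP.
  by apply: supp_p => // v sv xv; apply: nv; exists v.
have T3 : `|slope ^+ 2 / rho * (x t - b) * (q t - q s)| <=
    slope ^+ 2 * `|rho|^-1 * (D * (q t - q s)).
  rewrite normrM (normrM (slope ^+ 2 / rho)) (ger0_norm dq).
  have -> : `|slope ^+ 2 / rho| = slope ^+ 2 * `|rho|^-1.
    by rewrite normrM normfV ger0_norm ?sqr_ge0.
  rewrite -(mulrA (slope ^+ 2 * `|rho|^-1)) ler_wpM2l//.
    by rewrite mulr_ge0 ?sqr_ge0 ?invr_ge0.
  have [[v [sv xv]]|nv] := pselect (exists v, s <= v <= t /\ x v = b).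
    by rewrite ler_wpM2r// -xv; exact: hD.
  rewrite (_ : q t - q s = 0) ?mulr0//; apply/eqP; rewrite subr_eq0; apply/eqP.
  by apply: supp_q => // v sv xv; apply: nv; exists v.
have -> : Cr * g * (g + D) = expR (L * u) *
    ((Hm * L ^+ 2 * expR (L * u) + slope ^+ 2 * (1 + `|rho|^-1)) * (g * (g + D))).
  by rewrite /Cr; ring.
apply: ler_pM => //.
apply: (le_trans (ler_normD _ _)); apply: (le_trans (lerD (ler_normB _ _) T3)).
apply: (le_trans (lerD (lerD T1 T2) (lexx _))).
have k1 : 0 <= Hm * L ^+ 2 * expR (L * u).
  by rewrite mulr_ge0 ?expR_ge0// mulr_ge0 ?sqr_ge0// /Hm addr_ge0// mulr_ge0//; lra.
have k2 : 0 <= slope ^+ 2 by exact: sqr_ge0.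
have k3 : 0 <= slope ^+ 2 * `|rho|^-1 by rewrite mulr_ge0 ?invr_ge0.
have e1 : Hm * (L ^+ 2 * g ^+ 2 * expR (L * u)) <= Hm * L ^+ 2 * expR (L * u) * (g * (g + D)).
  rewrite [leLHS](_ : _ = Hm * L ^+ 2 * expR (L * u) * (g * g)); last by ring.
  by rewrite ler_wpM2l// ler_wpM2l//; lra.
have gD : 0 <= g * g by rewrite mulr_ge0.
have e2 : slope ^+ 2 * (D * (p t - p s)) <= slope ^+ 2 * (g * (g + D)).
  by rewrite ler_wpM2l//; nra.
have e3 : slope ^+ 2 * `|rho|^-1 * (D * (q t - q s)) <=
    slope ^+ 2 * `|rho|^-1 * (g * (g + D)).
  by rewrite ler_wpM2l//; nra.
rewrite (le_trans (lerD (lerD e1 e2) e3))//.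
by rewrite le_eqVlt; apply/orP; left; apply/eqP; ring.
Qed.

Section grid.
Variables (s : nat -> R) (m : nat).
Hypotheses (s0 : s 0%N = 0) (nds : forall i, s i <= s i.+1).

Let nds' : {homo s : i j / (i <= j)%N >-> i <= j}.
Proof. by apply: homo_leq => //; exact: le_trans. Qed.

Let sge0 i : 0 <= s i. Proof. by rewrite -s0; exact: nds'. Qed.

(** The step errors are proportional to local time increments, which telescope to at most [u]. The
    index [j] is fixed before [D] and [g], so the same statement serves with crude values for
    boundedness and with small ones for convergence. *)
Lemma stopped_sum_error : exists j, [/\ (j <= m)%N, p (s j) + q (s j) <= u,
  j = m \/ u < p (s j.+1) + q (s j.+1) &
  forall D, 0 <= D -> (forall i v, (i < j)%N -> s i <= v <= s i.+1 ->
      `|x (s i.+1) - x v| <= D) ->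
   forall g, 0 <= g -> (forall i, (i < j)%N ->
     p (s i.+1) + q (s i.+1) - (p (s i) + q (s i)) <= g) ->
   `|stopped_sum s m - M (s j)| <= Cr * u * (g + D)].
Proof.
have [|i|j [jm gj jE hF]] := @sum_stopped u (fun i => p (s i) + q (s i)) m.
- by rewrite s0 p0 q0 addr0.
- by rewrite lerD ?ndp ?ndq.
exists j; split => // D D0 hD g g0 hg.
have gam i : (i <= j)%N -> p (s i) + q (s i) <= u.
  move=> ij; rewrite (le_trans _ gj)// lerD//; [apply: ndp|apply: ndq] => //; exact: nds'.
have E : stopped_sum s m - M (s j) = - \sum_(i < j) step_error (s i) (s i.+1).
  rewrite /stopped_sum (hF (fun i => exp_weight (s i) * (B (s i.+1) - B (s i)))) mulr_sumr.
  have -> : M (s j) = M 0 + \sum_(i < j) (M (s i.+1) - M (s i)).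
    rewrite -(big_mkord xpredT (fun i => M (s i.+1) - M (s i))).
    by rewrite telescope_sumr// s0 -/(M 0); ring.
  rewrite /step_error [in RHS]sumrB -/M; ring.
rewrite E normrN (le_trans (ler_norm_sum _ _ _))//.
apply: (@le_trans _ _ (\sum_(i < j) Cr * (g + D) *
   ((p (s i.+1) + q (s i.+1)) - (p (s i) + q (s i))))).
  apply: ler_sum => i _.
  apply: (le_trans (@step_error_bound (s i) (s i.+1) D _ _ _ _)) => //.
  - exact: gam.
  - by move=> v; exact: hD.
  - have d0 : 0 <= p (s i.+1) + q (s i.+1) - (p (s i) + q (s i)).
      by rewrite subr_ge0 lerD ?ndp ?ndq.
    rewrite -mulrA -[leRHS]mulrA (ler_wpM2l Cr0)// mulrC (ler_wpM2r d0)// lerD2r.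
    exact: hg.
rewrite -mulr_sumr -(big_mkord xpredT (fun i => p (s i.+1) + q (s i.+1) - (p (s i) + q (s i)))).
rewrite telescope_sumr// s0 p0 q0 addr0 subr0.
rewrite (_ : _ * u * _ = Cr * (g + D) * u); last by ring.
by rewrite ler_wpM2l// mulr_ge0// addr_ge0.
Qed.

(** The crude choices [D = b - a] and [g = u] need no continuity, so the bound depends neither on
    the path nor on the grid. *)
Lemma stopped_sum_bounded :
  `|stopped_sum s m| <= Cr * u * (u + (b - a)) + Hm * expR (L * u).
Proof.
have [j [jm gj _ /(_ (b - a))]] := stopped_sum_error.
rewrite subr_ge0 (ltW ab) => /(_ isT) h1.
have {h1} : `|stopped_sum s m - M (s j)| <= Cr * u * (u + (b - a)).
  apply: h1 => //.
    move=> i v ij /andP[sv vs]; have v0 : 0 <= v by rewrite (le_trans _ sv).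
    have /andP[] := xab v0; have /andP[] := xab (sge0 i.+1).
    by rewrite ler_norml => *; apply/andP; split; lra.
  move=> i ij; have p1 := pge0 (sge0 i); have q1 := qge0 (sge0 i).
  have : p (s i.+1) + q (s i.+1) <= p (s j) + q (s j).
    by rewrite lerD//; [apply: ndp|apply: ndq] => //; exact: nds'.
  lra.
have : `|M (s j)| <= Hm * expR (L * u).
  have /andP[A0 Au] := exp_weight_bound (sge0 j) gj.
  by rewrite /M /exp_martingale normrM ler_pM// ?h_bound// ger0_norm.
by have := ler_normD (stopped_sum s m - M (s j)) (M (s j)); rewrite subrK; lra.
Qed.

End grid.

Let max0 (t : R) : 0 <= t -> Num.max 0 t = t. Proof. exact: max_r. Qed.

Lemma stopped_sum_cvg (sig e : R) : 0 <= sig -> p sig + q sig <= u ->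
  (forall t, sig < t -> u < p t + q t) -> 0 < e ->
  exists2 d, 0 < d & forall (s : nat -> R) m, s 0%N = 0 ->
    (forall i, s i <= s i.+1) -> (forall i, s i.+1 - s i < d) -> sig < s m ->
    `|stopped_sum s m - M sig| <= e.
Proof.
move=> sig0 sigu sigP e0.
have cpq : continuous (fun t : R => p (Num.max 0 t) + q (Num.max 0 t)).
  by move=> t; apply: cvgD; [exact: cp|exact: cq].
have cM : continuous (fun t : R => M (Num.max 0 t)).
  move=> t; apply: cvgM.
    apply: cvgD; first exact: cvg_cst.
    apply: cvgM; first exact: cvg_cst.
    by apply: cvgB; [exact: cx|exact: cvg_cst].
  apply: (cvg_comp _ expR); last exact: continuous_expR.
  apply: cvgD.
    by apply: cvgM; [exact: cvg_cst|exact: cp].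
  by apply: cvgM; [exact: cvg_cst|exact: cq].
have Cu : 0 <= Cr * u by rewrite mulr_ge0.
(* The accumulated step errors are at most [Cr * u * (e1 + e1)], half of [e]; the other half pays
   for moving from [s j] to [sig]. The [+ 1] covers [Cr * u = 0]. *)
pose e1 := e / (4 * (Cr * u + 1)).
have e10 : 0 < e1 by rewrite divr_gt0// mulr_gt0//; lra.
have e1e : Cr * u * (e1 + e1) <= e / 2.
  have e1E : e1 * (4 * (Cr * u + 1)) = e by rewrite /e1 mulfVK// gt_eqF// mulr_gt0//; lra.
  nra.
have e20 : 0 < e / 2 by rewrite divr_gt0.
have [d1 d10 d1P] := segment_unif_continuous sig cpq e10.
have [d2 d20 d2P] := segment_unif_continuous sig cx e10.
have [d3 d30 d3P] := segment_unif_continuous sig cM e20.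
exists (Num.min d1 (Num.min d2 d3)); first by rewrite !lt_min d10 d20.
move=> s m s0 nds sd sm.
have nds' : {homo s : i j / (i <= j)%N >-> i <= j}.
  by apply: homo_leq => //; exact: le_trans.
have sge0 i : 0 <= s i by rewrite -s0; exact: nds'.
have [j [jm gj jE /(_ e1 (ltW e10)) h1]] := stopped_sum_error m s0 nds.
(* The last grid point before the level is passed and its successor enclose [sig], so [s j] is
   within one mesh of it. *)
have sj : s j <= sig by rewrite leNgt; apply/negP => /sigP; rewrite ltNge gj.
have sj1 : sig < s j.+1.
  case: jE => [jE|]; first by move: sm; rewrite -jE ltNge sj.
  apply: contraTT; rewrite -!leNgt => sj1.
  by rewrite (le_trans _ sigu)// lerD// ?ndp ?ndq.
have {}h1 : `|stopped_sum s m - M (s j)| <= Cr * u * (e1 + e1).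
  apply: h1.
  - move=> i v ij /andP[sv vs]; have v0 : 0 <= v by rewrite (le_trans _ sv).
    have := d2P (s i.+1) v; rewrite !max0// sge0/= => h2; apply/ltW/h2.
      by rewrite (le_trans _ sj)//; exact: nds'.
    have := sd i; rewrite !lt_min => /and3P[_ + _].
    by rewrite ger0_norm ?subr_ge0//; apply: le_lt_trans; rewrite lerB.
  - exact: ltW.
  - move=> i ij; have := d1P (s i.+1) (s i); rewrite !max0// sge0/= => h2.
    apply: (le_trans (ler_norm _)); apply/ltW/h2.
      by rewrite (le_trans _ sj)//; exact: nds'.
    have := sd i; rewrite !lt_min => /and3P[+ _ _].
    by rewrite ger0_norm ?subr_ge0.
have h3 : `|M sig - M (s j)| < e / 2.
  have := d3P sig (s j); rewrite !max0// sig0 lexx/=; apply => //.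
  have := sd j; rewrite !lt_min => /and3P[_ _ +].
  by rewrite ger0_norm ?subr_ge0//; apply: le_lt_trans; rewrite lerB// ltW.
have -> : stopped_sum s m - M sig = (stopped_sum s m - M (s j)) - (M sig - M (s j)) by ring.
by apply: (le_trans (ler_normB _ _)); lra.
Qed.

End pathwise.

(** * The telegraph process *)

Section telegraph_transform.
Context (R : realType).
Implicit Types (ell rho u s : R).

(** With [mu = 1 / ell] and [beta = (rho - 1 / rho) / (2 ell)], the two exponents are the classical
    telegraph rates [- mu + sqrt(mu ^ 2 + beta ^ 2)] and [- mu - sqrt(mu ^ 2 + beta ^ 2)]: the
    parameter [rho] makes the square root rational, equal to [(rho + 1 / rho) / (2 ell)]. Here [mu]
    is half the renewal rate, since a fresh direction is a reversal with probability one half. *)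
Definition telegraph_transform ell rho u : R :=
  ((rho + 1) ^+ 2 * expR (- ((2 - rho - rho^-1) / (2 * ell) * u)) +
   (rho - 1) ^+ 2 * expR (- ((2 + rho + rho^-1) / (2 * ell) * u))) /
  (2 * (rho ^+ 2 + 1)).

Lemma telegraph_transform_ge0 ell rho u : 0 <= telegraph_transform ell rho u.
Proof.
rewrite divr_ge0//; first by rewrite addr_ge0// mulr_ge0 ?sqr_ge0 ?expR_ge0.
by rewrite mulr_ge0// addr_ge0// sqr_ge0.
Qed.

Lemma measurable_telegraph_transform ell rho :
  measurable_fun setT (telegraph_transform ell rho).
Proof.
have mexp c : measurable_fun setT (fun u : R => expR (- (c * u))).
  by apply: measurableT_comp => //; apply: measurableT_comp => //; exact: measurable_funM.
apply: measurable_funM => //.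
by apply: measurable_funD; apply: measurable_funM.
Qed.

Lemma is_derive_expRM (c s : R) : is_derive s 1 (fun x : R => expR (c * x)) (c * expR (c * s)).
Proof.
have h1 : is_derive (c * s) 1 expR (expR (c * s)) by exact: is_derive_expR.
have h2 : is_derive s 1 (fun x : R => c * x) c.
  have := @is_deriveM R R^o (cst c) id s 1 0 1 (is_derive_cst _ _ _) (is_derive_id _ _).
  by rewrite /cst/= scaler0 addr0 [c *: _]mulr1.
by have := is_derive1_comp h1 h2; rewrite mulrC.
Qed.

Lemma continuous_expRM (c : R) : continuous (fun x : R => expR (c * x)).
Proof.
move=> x; apply: (cvg_comp _ expR); last exact: continuous_expR.
by apply: cvgM; [exact: cvg_cst|exact: cvg_id].
Qed.

Lemma integral_expRM2 (c1 c2 a1 a2 v : R) : c1 != 0 -> c2 != 0 -> 0 < v ->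
  (\int[lebesgue_measure]_(s in `[0%R, v]) (a1 * expR (c1 * s) + a2 * expR (c2 * s))%:E =
   (a1 * (expR (c1 * v) - 1) / c1 + a2 * (expR (c2 * v) - 1) / c2)%:E)%E.
Proof.
move=> c10 c20 v0.
pose F (s : R) : R := a1 / c1 * expR (c1 * s) + a2 / c2 * expR (c2 * s).
have dF (s : R) : is_derive s 1 F (a1 * expR (c1 * s) + a2 * expR (c2 * s)).
  have h (c a : R) : c != 0 ->
      is_derive s 1 (fun x : R => a / c * expR (c * x)) (a * expR (c * s)).
    move=> c0; have := @is_deriveM R R^o (cst (a / c)) _ s 1 0 _ (is_derive_cst _ _ _) (is_derive_expRM c s).
    by rewrite /cst/= scaler0 addr0 [_ *: _]mulrA divfK.
  exact: (@is_deriveD R R^o R^o _ _ s 1 _ _ (h _ _ c10) (h _ _ c20)).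
have cF : continuous F.
  move=> s; apply: cvgD; (apply: cvgM; [exact: cvg_cst|exact: continuous_expRM]).
rewrite (@continuous_FTC2 _ _ F)//.
- rewrite -EFinB; congr EFin; rewrite /F !mulr0 expR0; field.
  by rewrite c10 c20.
- apply: continuous_subspaceT => s.
  by apply: cvgD; (apply: cvgM; [exact: cvg_cst|exact: continuous_expRM]).
- split.
  + by move=> s _; exact: (@ex_derive _ _ _ _ _ _ _ (dF s)).
  + by apply: cvg_at_right_filter; exact: cF.
  + by apply: cvg_at_left_filter; exact: cF.
- by move=> s _; rewrite derive1E; exact: (@derive_val _ _ _ _ _ _ _ (dF s)).
Qed.


(** This is the contribution of a first direction [z] kept until a renewal at a time [s <= v]. In
    [s] the integrand is a combination of two exponentials of rates [d1] and [d2], and [rho > 1]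
    keeps both nonzero for either direction. *)
Lemma integral_telegraph_transform ell rho (z v : R) : 0 < ell -> 1 < rho -> 0 <= v ->
  z = 1 \/ z = - 1 ->
  let r := 2 / ell in let beta := (rho - rho^-1) / (2 * ell) in
  let K1 := (2 - rho - rho^-1) / (2 * ell) in
  let K2 := (2 + rho + rho^-1) / (2 * ell) in
  let d1 := K1 - beta * z - r in let d2 := K2 - beta * z - r in
  let B := expR (- ((beta * z + r) * v)) in
  (\int[lebesgue_measure]_(s in `[0%R, v])
     (expR (- (beta * (z * s))) * telegraph_transform ell rho (v - s) *
        (r * expR (- r * s)))%:E =
   (r / (2 * (rho ^+ 2 + 1)) * ((rho + 1) ^+ 2 * (B - expR (- (K1 * v))) / d1 +
      (rho - 1) ^+ 2 * (B - expR (- (K2 * v))) / d2))%:E)%E.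
Proof.
move=> ell0 rho1 v0 zE r beta K1 K2 d1 d2 B.
have r2 : rho ^+ 2 + 1 != 0 by rewrite gt_eqF// ltr_wpDl ?sqr_ge0.
have rn0 : rho != 0 by rewrite gt_eqF//; lra.
have ln0 : ell != 0 by rewrite gt_eqF.
have rm1 : rho - 1 != 0 by rewrite gt_eqF// subr_gt0.
have rp1 : rho + 1 != 0 by rewrite gt_eqF//; lra.
have d10 : d1 != 0.
  case: zE => zE; rewrite /d1 zE.
    rewrite (_ : _ - _ = - (rho + 1) / ell); last by rewrite /K1 /beta /r; field; rewrite ln0 rn0.
    by rewrite mulf_neq0 ?invr_eq0// oppr_eq0.
  rewrite (_ : _ - _ = - (rho + 1) / (rho * ell)); last by rewrite /K1 /beta /r; field; rewrite ln0 rn0.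
  by rewrite mulf_neq0 ?invr_eq0 ?oppr_eq0// mulf_neq0.
have d20 : d2 != 0.
  case: zE => zE; rewrite /d2 zE.
    rewrite (_ : _ - _ = - (rho - 1) / (rho * ell)); last by rewrite /K2 /beta /r; field; rewrite ln0 rn0.
    by rewrite mulf_neq0 ?invr_eq0 ?oppr_eq0// mulf_neq0.
  rewrite (_ : _ - _ = (rho - 1) / ell); last by rewrite /K2 /beta /r; field; rewrite ln0 rn0.
  by rewrite mulf_neq0 ?invr_eq0.
pose q := r / (2 * (rho ^+ 2 + 1)).
pose a1 := q * (rho + 1) ^+ 2 * expR (- (K1 * v)).
pose a2 := q * (rho - 1) ^+ 2 * expR (- (K2 * v)).
(* The fundamental theorem is used on a nondegenerate interval, so [v = 0] is treated apart; both
   sides vanish there. *)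
move: v0; rewrite le_eqVlt => /predU1P[v0|v0].
  rewrite -v0 set_itv1 integral_set1; congr EFin.
  by rewrite /B -v0 !mulr0 oppr0 subrr !mulr0 !mul0r addr0 mulr0.
transitivity (\int[lebesgue_measure]_(s in `[0%R, v])
    (a1 * expR (d1 * s) + a2 * expR (d2 * s))%:E)%E.
  apply: eq_integral => s _; congr EFin.
  have e1 : expR (- (K1 * v)) * expR (d1 * s) =
      expR (- (beta * (z * s))) * expR (- (K1 * (v - s))) * expR (- r * s).
    by rewrite -!expRD; congr expR; rewrite /d1; ring.
  have e2 : expR (- (K2 * v)) * expR (d2 * s) =
      expR (- (beta * (z * s))) * expR (- (K2 * (v - s))) * expR (- r * s).
    by rewrite -!expRD; congr expR; rewrite /d2; ring.
  rewrite /a1 /a2 -!(mulrA (q * _)) e1 e2 /telegraph_transform -/K1 -/K2 /q.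
  set x := expR (- (beta * _)); set y := expR (- r * s).
  by set x1 := expR _; set x2 := expR _; field.
rewrite integral_expRM2//; congr EFin.
have e1 : expR (- (K1 * v)) * expR (d1 * v) = B.
  by rewrite -!expRD; congr expR; rewrite /d1; ring.
have e2 : expR (- (K2 * v)) * expR (d2 * v) = B.
  by rewrite -!expRD; congr expR; rewrite /d2; ring.
rewrite /a1 /a2 -!(mulrA (q * _)) !mulrBr e1 e2 !mulr1.
by rewrite -/q; field; rewrite d10 d20.
Qed.

(* In the renewal identity the boundary terms [B] cancel for each of the two directions
   separately. *)
Lemma telegraph_transform_renewal ell rho (v : R) : 0 < ell -> 1 < rho ->
  let r := 2 / ell in let beta := (rho - rho^-1) / (2 * ell) in
  let K1 := (2 - rho - rho^-1) / (2 * ell) in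
  let K2 := (2 + rho + rho^-1) / (2 * ell) in
  let d1 z := K1 - beta * z - r in let d2 z := K2 - beta * z - r in
  let B z := expR (- ((beta * z + r) * v)) in
  let J z := r / (2 * (rho ^+ 2 + 1)) * ((rho + 1) ^+ 2 * (B z - expR (- (K1 * v))) / d1 z +
      (rho - 1) ^+ 2 * (B z - expR (- (K2 * v))) / d2 z) in
  1 / 2 * (J 1 + B 1) + 1 / 2 * (J (- 1) + B (- 1)) = telegraph_transform ell rho v.
Proof.
move=> ell0 rho1 r beta K1 K2 d1 d2 B J.
have r2 : rho ^+ 2 + 1 != 0 by rewrite gt_eqF// ltr_wpDl ?sqr_ge0.
have rn0 : rho != 0 by rewrite gt_eqF//; lra.
have ln0 : ell != 0 by rewrite gt_eqF.
have rm1 : rho - 1 != 0 by rewrite gt_eqF// subr_gt0.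
have rp1 : rho + 1 != 0 by rewrite gt_eqF//; lra.
have d11 : d1 1 = - (rho + 1) / ell by rewrite /d1 /K1 /beta /r; field; rewrite ln0 rn0.
have d21 : d2 1 = - (rho - 1) / (rho * ell) by rewrite /d2 /K2 /beta /r; field; rewrite ln0 rn0.
have d1N : d1 (- 1) = - (rho + 1) / (rho * ell) by rewrite /d1 /K1 /beta /r; field; rewrite ln0 rn0.
have d2N : d2 (- 1) = (rho - 1) / ell by rewrite /d2 /K2 /beta /r; field; rewrite ln0 rn0.
rewrite /J d11 d21 d1N d2N /telegraph_transform -/K1 -/K2 /r.
set x1 := B 1; set x2 := B (- 1); set y1 := expR _; set y2 := expR _.
by field; rewrite r2 rm1 rp1 rn0 ln0.
Qed.

(** With [c = ell * beta], [rho] is the positive root of [rho ^ 2 - 2 c rho - 1], whose inverse is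
    the conjugate expression. *)
Lemma laplace_parameter (ell beta : R) : 0 < ell -> 0 < beta ->
  exists2 rho, 1 < rho & (rho - rho^-1) / (2 * ell) = beta.
Proof.
move=> l0 b0; pose c := ell * beta; have c0 : 0 < c by rewrite mulr_gt0.
pose s := Num.sqrt (c ^+ 2 + 1).
have s2 : s ^+ 2 = c ^+ 2 + 1 by rewrite sqr_sqrtr// addr_ge0// sqr_ge0.
have s0 : 0 <= s by exact: sqrtr_ge0.
have s1 : 1 <= s by rewrite -(@ler_pXn2r _ 2)// ?nnegrE// s2 expr1n lerDr sqr_ge0.
exists (c + s); first by lra.
have -> : (c + s)^-1 = s - c.
  apply: (mulfI (_ : c + s != 0)); first by rewrite gt_eqF//; lra.
  rewrite divff; last by rewrite gt_eqF//; lra.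
  by rewrite (_ : (c + s) * (s - c) = s ^+ 2 - c ^+ 2); [rewrite s2; ring|ring].
by rewrite /c; field; rewrite gt_eqF.
Qed.

End telegraph_transform.

(** * Laws of the renewal intervals and directions *)

Section exponential_law.
Context (R : realType) d (Omega : measurableType d) (P : probability Omega R).
Variables (e : Omega -> R) (r : R).
Hypotheses (me : measurable_fun setT e) (r0 : 0 < r).
Hypothesis tail : forall t, 0 <= t -> P [set w | t < e w] = (expR (- r * t))%:E.

Let expo : probability (measurableTypeR R) R :=
  exponential_distribution_exponential_prob__canonical__probability_measure_Probability r0.

Lemma exponential_prob_gt (x : R) :
  expo [set s | x < s] = (if 0 <= x then expR (- r * x) else 1)%:E.
Proof.
have -> : [set s : measurableTypeR R | x < s] = ~` [set s | s <= x].
  by apply/seteqP; split => s /=; rewrite ltNge => /negP.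
have -> : [set s : measurableTypeR R | s <= x] = `]-oo, x]%classic.
  by apply/seteqP; split => s /=; rewrite in_itv.
rewrite probability_setC; last exact: measurable_itv.
have h0 (s : R) : s < 0 -> (exponential_pdf r s)%:E = 0%E.
  by move=> s0; rewrite lt0_exponential_pdf.
have [x0|x0] := leP 0 x; last first.
  have -> : expo `]-oo, x]%classic = 0%E.
    apply: integral0_eq => s /=; rewrite in_itv/= => sx.
    by apply: h0; exact: le_lt_trans sx x0.
  by rewrite sube0.
have -> : expo `]-oo, x]%classic = (1 - expR (- r * x))%:E.
  transitivity (exponential_prob r `[0, x]%classic).
    rewrite /expo/= /exponential_prob integral_mkcond [RHS]integral_mkcond.
    apply: eq_integral => s _; rewrite !patchE !mem_setE !in_itv/=.
    by have [//|s0] := leP 0 s; case: ifPn => // _; exact: h0.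
  move: x0; rewrite le_eqVlt => /predU1P[<-|x0].
    by rewrite set_itv1 /exponential_prob integral_set1 mulr0 expR0 subrr.
  by rewrite exponential_prob_itv0c.
by rewrite -EFinB opprB addrC subrK.
Qed.

Lemma exponential_expectation (g : R -> \bar R) :
  measurable_fun setT g -> (forall s, 0 <= g s)%E ->
  (\int[P]_w g (e w) = \int[lebesgue_measure]_s (g s * (exponential_pdf r s)%:E))%E.
Proof.
move=> mg g0.
have [_ _ lawE] : eq_in_law P expo e id.
  apply: eq_in_law_of_rays => // x; rewrite exponential_prob_gt.
  have [x0|x0] := leP 0 x; first exact: tail.
  (* The tail is prescribed only at nonnegative levels; for [x < 0] the ray contains the event
     [0 < e], which has probability one. *)
  apply/eqP; rewrite eq_le; apply/andP; split; first by apply: probability_le1; exact: measurable_gt_ray.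
  have <- : P [set w | 0 < e w] = 1%E by rewrite tail// mulr0 expR0.
  apply: le_measure; rewrite ?inE; [exact: measurable_gt_ray|exact: measurable_gt_ray|].
  by move=> w /=; exact: lt_trans.
have p0 x : 0 <= exponential_pdf r x by rewrite exponential_pdf_ge0// ltW.
have := @ge0_integral_density _ (measurableTypeR R) R lebesgue_measure
  (distribution P (@mfun_Sub _ _ Omega (measurableTypeR R) e (mem_set me))) (exponential_pdf r)
  (measurable_exponential_pdf r) p0 (fun A mA => lawE A mA) g mg g0.
by move=> <-; rewrite ge0_integral_distribution.
Qed.

Lemma exponential_expectation_itv (g : R -> R) (v : R) :
  measurable_fun setT g -> (forall s, 0 <= g s) ->
  (\int[P]_w (if 0 <= e w <= v then g (e w) else 0)%:E =
   \int[lebesgue_measure]_(s in `[0%R, v]) (g s * (r * expR (- r * s)))%:E)%E.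
Proof.
move=> mg g0.
rewrite (@exponential_expectation (fun s => (if 0 <= s <= v then g s else 0)%:E)); last 2 first.
- apply/measurable_EFinP; apply: measurable_fun_if => //.
    apply: measurable_and; exact: measurable_fun_ler.
  exact: measurable_funTS.
- by move=> s; rewrite lee_fin; case: ifP.
rewrite [RHS]integral_mkcond; apply: eq_integral => s _.
rewrite patchE mem_setE in_itv/=; case: ifPn => [/andP[s0 _]|_].
  by rewrite -EFinM exponential_pdfE.
by rewrite mul0e.
Qed.

Lemma exponential_gt0 : {ae P, forall w, 0 < e w}.
Proof.
exists (~` [set w | 0 < e w]); split => //.
  by apply: measurableC; exact: measurable_gt_ray.
have h : P [set w | 0 < e w] = 1%E by rewrite tail// mulr0 expR0.
have : P (~` [set w | 0 < e w]) = 0%E.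
  by rewrite probability_setC ?h ?subee//; exact: measurable_gt_ray.
by [].
Qed.

End exponential_law.

Section two_point_law.
Context (R : realType) d (Omega : measurableType d) (P : probability Omega R).
Variable theta : Omega -> R.
Hypothesis mtheta : measurable_fun setT theta.
Hypothesis theta1 : P [set w | theta w = 1] = (1 / 2)%:E.
Hypothesis thetaN1 : P [set w | theta w = - 1] = (1 / 2)%:E.

Lemma measurable_level (y : R) : measurable [set w | theta w = y].
Proof.
rewrite (_ : [set _ | _] = setT `&` theta @^-1` [set y]); first exact: mtheta.
by rewrite setTI.
Qed.

Lemma two_point_ae : {ae P, forall w, theta w = 1 \/ theta w = - 1}.
Proof.
have m1 := measurable_level 1; have m2 := measurable_level (- 1).
exists (~` ([set w | theta w = 1] `|` [set w | theta w = - 1])); split => //.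
  by apply: measurableC; exact: measurableU.
have e1 : P ([set w | theta w = 1] `|` [set w | theta w = - 1]) = 1%E.
  have -> : P ([set w | theta w = 1] `|` [set w | theta w = - 1]) =
      (P [set w | theta w = 1%R] + P [set w | theta w = (- 1)%R])%E.
    apply: measureU => //; rewrite -subset0 => w [/= -> h].
    by have : (1 : R) = - 1 by []; lra.
  by rewrite theta1 thetaN1 -EFinD; congr EFin; field.
have : P (~` ([set w | theta w = 1] `|` [set w | theta w = - 1])) = 0%E.
  by rewrite probability_setC ?e1 ?subee//; exact: measurableU.
by [].
Qed.

Lemma two_point_expectation (g : R -> \bar R) : (forall s, 0 <= g s)%E ->
  measurable_fun setT g ->
  (\int[P]_w g (theta w) = (1 / 2)%:E * g 1%R + (1 / 2)%:E * g (- 1)%R)%E.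
Proof.
move=> g0 mg.
have m1 := measurable_level 1; have m2 := measurable_level (- 1).
transitivity (\int[P]_w (g 1%R * (\1_[set w | theta w = 1%R] w)%:E +
   g (- 1)%R * (\1_[set w | theta w = (- 1)%R] w)%:E))%E.
  apply: ae_eq_integral => //.
  - exact: measurableT_comp.
  - apply: emeasurable_funD; apply: emeasurable_funM => //; apply/measurable_EFinP;
      exact: measurable_indic.
  apply: filterS two_point_ae => w h _; rewrite !indicE.
  have n1 : (1 : R) <> - 1 by move=> ?; lra.
  case: h => wE.
    by rewrite mem_set// memNset/= ?wE// mule1 mule0 adde0.
  rewrite memNset/= ?wE; last by move=> /esym.
  by rewrite mem_set// mule1 mule0 add0e.
rewrite ge0_integralD//; last 4 first.
- by move=> w _; rewrite mule_ge0// lee_fin.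
- by apply: emeasurable_funM => //; apply/measurable_EFinP; exact: measurable_indic.
- by move=> w _; rewrite mule_ge0// lee_fin.
- by apply: emeasurable_funM => //; apply/measurable_EFinP; exact: measurable_indic.
rewrite !ge0_integralZl//; try by apply/measurable_EFinP; exact: measurable_indic.
rewrite !integral_indic// !setIT.
by rewrite -theta1 muleC; congr (_ + _)%E; rewrite theta1 -thetaN1 muleC.
Qed.

End two_point_law.

Section telegraph_position.
Context (R : realType) d (T : measurableType d).
Variables (theta e : nat -> T -> R).
Hypotheses (mtheta : forall j, measurable_fun setT (theta j)).
Hypotheses (me : forall j, measurable_fun setT (e j)).

Definition telegraph_sum n w : R := \sum_(j < n) theta j w * e j w.

(** [Ztel] before its time change: evaluating this at the inverse of the subordinator is [Ztel] by
    definition. *)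
Definition telegraph_position u w : R :=
  let N := renewal_count e u w in
  telegraph_sum N w + theta N w * (u - renewal_time e N w).

Lemma renewal_timeS n w : renewal_time e n.+1 w = renewal_time e n w + e n w.
Proof. by rewrite /renewal_time big_ord_recr. Qed.

Lemma telegraph_sumS n w : telegraph_sum n.+1 w = telegraph_sum n w + theta n w * e n w.
Proof. by rewrite /telegraph_sum big_ord_recr. Qed.

Lemma measurable_renewal_time n : measurable_fun setT (renewal_time e n).
Proof. by apply: measurable_sum => j. Qed.

Lemma measurable_telegraph_sum n : measurable_fun setT (telegraph_sum n).
Proof. by apply: measurable_sum => j; exact: measurable_funM. Qed.

Let last_renewal (f : T -> R) k := [set w | renewal_time e k w <= f w /\
   forall m, renewal_time e m w <= f w -> (m <= k)%N].

Lemma renewal_countP u w k : renewal_time e k w <= u ->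
  (forall m, renewal_time e m w <= u -> (m <= k)%N) -> renewal_count e u w = k.
Proof.
move=> h1 h2; apply: xget_unique; first by split.
by move=> m [m1 m2]; apply/eqP; rewrite eqn_leq h2// m2.
Qed.

Lemma renewal_count_none u w :
  (forall k, ~ (renewal_time e k w <= u /\
     forall m, renewal_time e m w <= u -> (m <= k)%N)) -> renewal_count e u w = 0%N.
Proof.
move=> h; rewrite /renewal_count; case: xgetP => // k _ hk.
by have := h k hk.
Qed.

(** The value 0 needs separate care: besides the paths whose last renewal has index 0, it collects
    by default those for which no last renewal exists. *)
Lemma measurable_renewal_count (f : T -> R) k : measurable_fun setT f ->
  measurable [set w | renewal_count e (f w) w = k].
Proof.
move=> mf.
have mle m : measurable [set w | renewal_time e m w <= f w].
  rewrite -[X in measurable X]setTI.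
  rewrite (_ : _ `&` _ = setT `&` (fun w => f w - renewal_time e m w) @^-1` `[0, +oo[).
    by apply: measurable_funB => //; exact: measurable_renewal_time.
  by apply/seteqP; split => w /= []; rewrite in_itv/= andbT subr_ge0.
have mA i : measurable (last_renewal f i).
  apply: measurableI; first exact: mle.
  rewrite (_ : (fun w => forall m, _) =
      \bigcap_(m in [set m | (i < m)%N]) ~` [set w | renewal_time e m w <= f w]).
    by apply: bigcap_measurableType => m _; exact: measurableC.
  apply/seteqP; split => w /= h m.
    by move=> /= im tm; have := h _ tm; rewrite leqNgt im.
  by move=> tm; rewrite leqNgt; apply/negP => im; exact: (h m im tm).
have h1 i w : last_renewal f i w -> renewal_count e (f w) w = i.
  by move=> [h h']; exact: renewal_countP.
have [k0|k0] := eqVneq k 0%N; last first.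
  rewrite (_ : [set _ | _] = last_renewal f k)//.
  apply/seteqP; split => w /=; last exact: h1.
  rewrite /renewal_count; case: xgetP => [i _ hi <- //|_ kE].
  by move: k0; rewrite -kE.
rewrite (_ : [set _ | _] = last_renewal f k `|` ~` \bigcup_i last_renewal f i).
  by apply: measurableU => //; apply: measurableC; exact: bigcup_measurable.
apply/seteqP; split => w /=.
  rewrite /renewal_count; case: xgetP => [i _ hi <- //|h _]; first by left.
  by right => -[i _ hi]; apply: (h i).
move=> [/h1//|h]; rewrite k0; apply: renewal_count_none => i hi.
by apply: h; exists i.
Qed.

Lemma measurable_telegraph_position (f : T -> R) : measurable_fun setT f ->
  measurable_fun setT (fun w => telegraph_position (f w) w).
Proof.
move=> mf; apply: (measurable_fun_countable_glue (N := fun w => renewal_count e (f w) w)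
  (f := fun k w => telegraph_sum k w + theta k w * (f w - renewal_time e k w))).
  by move=> k; exact: measurable_renewal_count.
move=> k; apply: measurable_funD; first exact: measurable_telegraph_sum.
apply: measurable_funM => //; apply: measurable_funB => //; exact: measurable_renewal_time.
Qed.

Section good_path.
Variable w : T.
Hypothesis e_gt0 : forall j, 0 < e j w.
Hypothesis theta_sign : forall j, theta j w = 1 \/ theta j w = - 1.

Lemma renewal_time_lt m n : (m < n)%N -> renewal_time e m w < renewal_time e n w.
Proof.
elim: n => // n IH; rewrite ltnS leq_eqVlt => /predU1P[->|/IH h].
  by rewrite renewal_timeS ltrDl.
by rewrite renewal_timeS (lt_trans h)// ltrDl.
Qed.

Lemma renewal_time0 : renewal_time e 0 w = 0.
Proof. by rewrite /renewal_time big_ord0. Qed.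

Lemma renewal_count_itv n u : renewal_time e n w <= u < renewal_time e n.+1 w ->
  renewal_count e u w = n.
Proof.
move=> /andP[h1 h2]; apply: renewal_countP => // m hm; rewrite leqNgt; apply/negP.
rewrite leq_eqVlt => /predU1P[nm|/renewal_time_lt nm]; first by move: hm; rewrite -nm leNgt h2.
by move: (lt_le_trans (lt_trans h2 nm) hm); rewrite ltxx.
Qed.

Lemma telegraph_sum_bound n : `|telegraph_sum n w| <= renewal_time e n w.
Proof.
rewrite /telegraph_sum (le_trans (ler_norm_sum _ _ _))// ler_sum// => j _.
by case: (theta_sign j) => ->; rewrite ?mul1r ?mulN1r ?normrN gtr0_norm.
Qed.

Lemma telegraph_position_itv n u : renewal_time e n w <= u < renewal_time e n.+1 w ->
  telegraph_position u w = telegraph_sum n w + theta n w * (u - renewal_time e n w).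
Proof. by move=> h; rewrite /telegraph_position (renewal_count_itv h). Qed.

Hypothesis unbounded : forall K, exists n, K < renewal_time e n w.

Lemma renewal_itv_ex u : 0 <= u ->
  exists n, renewal_time e n w <= u < renewal_time e n.+1 w.
Proof.
move=> u0; have [n] := unbounded u; elim: n => [|n IH un].
  by rewrite renewal_time0 => /(le_lt_trans u0); rewrite ltxx.
by have [h|/IH//] := leP (renewal_time e n w) u; exists n; rewrite h.
Qed.

Lemma telegraph_position_bound u : 0 <= u -> `|telegraph_position u w| <= u.
Proof.
move=> u0; have [n h] := renewal_itv_ex u0; rewrite (telegraph_position_itv h).
have /andP[h1 h2] := h.
rewrite (le_trans (ler_normD _ _))// -[leRHS](subrKC (renewal_time e n w)).
rewrite lerD ?telegraph_sum_bound//.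
have d0 : 0 <= u - renewal_time e n w by rewrite subr_ge0.
by case: (theta_sign n) => ->; rewrite ?mul1r ?mulN1r ?normrN ger0_norm.
Qed.

End good_path.
End telegraph_position.

(** * Independence of successive renewals and almost sure path properties *)

Section renewal_independence.
Context (R : realType) d (Omega : measurableType d) (P : probability Omega R).
Variables (theta e : nat -> {RV P >-> R}) (r : R).
Hypothesis r0 : 0 < r.
Hypothesis theta_indep : mutually_independent P (fun j => sigma_rv (theta j)).
Hypothesis theta1 : forall j, P [set w | theta j w = 1] = (1 / 2)%:E.
Hypothesis thetaN1 : forall j, P [set w | theta j w = - 1] = (1 / 2)%:E.
Hypothesis e_indep : mutually_independent P (fun j => sigma_rv (e j)).
Hypothesis e_tail : forall j (t : R), 0 <= t -> P [set w | t < e j w] = (expR (- r * t))%:E.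
Hypothesis theta_e : independent P (sigma_family setT theta) (sigma_family setT e).

Let T n w := renewal_time (fun j => e j : Omega -> R) n w.
Let Y n w := telegraph_sum (fun j => theta j : Omega -> R) (fun j => e j : Omega -> R) n w.

Let measurable_theta j : measurable_fun setT (theta j). Proof. exact: measurable_funPT. Qed.
Let measurable_e j : measurable_fun setT (e j). Proof. exact: measurable_funPT. Qed.

Lemma measurable_fun_preimage (f g : Omega -> R) (G : set_system Omega) :
  measurable_fun setT (f : g_sigma_algebraType G -> R) ->
  measurable_fun setT (g : g_sigma_algebraType G -> R) ->
  forall A : set (R * R), measurable A -> <<s G >> ((fun w => (f w, g w)) @^-1` A).
Proof.
move=> mf mg A mA.
have := @measurable_fun_pair _ _ _ (g_sigma_algebraType G) _ _ f g mf mg measurableT A mA.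
by rewrite setTI.
Qed.

(** The past is generated by intersections of a [theta]-event and an [e]-event of indices below [n],
    the next pair by such intersections at [n]. Independence within each sequence and between the
    two sequences combine through [independent_setI]. *)
Lemma renewal_step_independent n (A B : set (R * R)) : measurable A -> measurable B ->
  P ((fun w => (T n w, Y n w)) @^-1` A `&` (fun w => (theta n w, e n w)) @^-1` B) =
  (P ((fun w => (T n w, Y n w)) @^-1` A) * P ((fun w => (theta n w, e n w)) @^-1` B))%E.
Proof.
move=> mA mB.
pose F1 := sigma_family [set j | (j < n)%N] theta.
pose F2 := sigma_family [set j | (j < n)%N] e.
pose G1 := sigma_rv (theta n); pose G2 := sigma_rv (e n).
pose F := [set A1 `&` A2 | A1 in F1 & A2 in F2].
pose G := [set B1 `&` B2 | B1 in G1 & B2 in G2].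
have setII C D : setI_closed C -> setI_closed D ->
    setI_closed [set A1 `&` A2 | A1 in C & A2 in D :> set_system Omega].
  move=> hC hD _ _ [a Ca [b Db <-]] [a' Ca' [b' Db' <-]].
  by rewrite setIACA; exists (a `&` a'); [exact: hC|exists (b `&` b') => //; exact: hD].
have sF1 : sigma_algebra setT F1 by exact: sigma_family_sigma_algebra.
have sF2 : sigma_algebra setT F2 by exact: sigma_family_sigma_algebra.
have sG1 : sigma_algebra setT G1 by exact: sigma_rv_sigma_algebra.
have sG2 : sigma_algebra setT G2 by exact: sigma_rv_sigma_algebra.
have T1 C : sigma_algebra setT C -> C [set: Omega].
  by move=> [C0 CC _]; rewrite -(setD0 setT); exact: CC.
have FG : independent P <<s F >> <<s G >>.
  apply: independent_sigma.
  - by apply: setII; exact: sigma_algebra_setI.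
  - by apply: setII; exact: sigma_algebra_setI.
  - move=> _ [a Fa [b Fb <-]]; 
    by apply: measurableI; [exact: sigma_family_measurable Fa|exact: sigma_family_measurable Fb].
  - move=> _ [a Fa [b Fb <-]]; 
    by apply: measurableI; [exact: sigma_rv_measurable Fa|exact: sigma_rv_measurable Fb].
  apply: (independent_setI (S1 := sigma_family setT theta) (S2 := sigma_family setT e)) => //.
  - by apply: sigma_algebra_setI; exact: sigma_family_sigma_algebra.
  - by apply: sigma_algebra_setI; exact: sigma_family_sigma_algebra.
  - exact: sigma_family_subset.
  - by move=> a ha; apply: sub_sigma_algebra; exists n.
  - exact: sigma_family_subset.
  - by move=> a ha; apply: sub_sigma_algebra; exists n.
  - exact: mutually_independent_prefix.
  - exact: mutually_independent_prefix.
have mthetaF j : (j < n)%N -> measurable_fun setT (theta j : g_sigma_algebraType F -> R).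
  move=> jn; apply: adapted_measurable_fun => _ [C mC <-]; apply: sub_sigma_algebra.
  exists (setT `&` theta j @^-1` C); first by rewrite setTI; exact: sigma_family_rv.
  by exists setT; [exact: T1|rewrite setIT].
have meF j : (j < n)%N -> measurable_fun setT (e j : g_sigma_algebraType F -> R).
  move=> jn; apply: adapted_measurable_fun => _ [C mC <-]; apply: sub_sigma_algebra.
  exists setT; first exact: T1.
  by exists (setT `&` e j @^-1` C); [rewrite setTI; exact: sigma_family_rv|rewrite setTI].
have mthetaG : measurable_fun setT (theta n : g_sigma_algebraType G -> R).
  apply: adapted_measurable_fun => _ [C mC <-]; apply: sub_sigma_algebra.
  by exists (setT `&` theta n @^-1` C); [exists C|exists setT; [exact: T1|rewrite setIT]].
have meG : measurable_fun setT (e n : g_sigma_algebraType G -> R).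
  apply: adapted_measurable_fun => _ [C mC <-]; apply: sub_sigma_algebra.
  by exists setT; [exact: T1|exists (setT `&` e n @^-1` C); [exists C|rewrite setTI]].
apply: FG.
  apply: measurable_fun_preimage => //.
    by apply: measurable_sum => j; exact: meF.
  by apply: measurable_sum => j; apply: measurable_funM; [exact: mthetaF|exact: meF].
exact: measurable_fun_preimage.
Qed.

Lemma renewal_pair_independent n (A B : set R) : measurable A -> measurable B ->
  P (e n @^-1` A `&` theta n @^-1` B) = (P (e n @^-1` A) * P (theta n @^-1` B))%E.
Proof.
by move=> mA mB; rewrite setIC theta_e 1?muleC//; exact: sigma_family_rv.
Qed.

Lemma renewal_good_path : {ae P, forall w, [/\ forall j, 0 < e j w,
  forall j, theta j w = 1 \/ theta j w = - 1 & forall K, exists n, K < T n w]}.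
Proof.
have h1 : {ae P, forall w, forall j, 0 < e j w}.
  by apply: ae_foralln => j; exact: (exponential_gt0 _ (e_tail j)).
have h2 : {ae P, forall w, forall j, theta j w = 1 \/ theta j w = - 1}.
  by apply: ae_foralln => j; exact: (two_point_ae _ (theta1 j) (thetaN1 j)).
(* A single long interval already pushes the renewal times past [K], so no law of large numbers is
   needed: all of the first [n] intervals are at most [K] with probability [q ^ n], where
   [q < 1]. *)
have h3 : {ae P, forall w, forall K : nat, exists n, K%:R < e n w}.
  apply: ae_foralln => K.
  pose A n := e n @^-1` `]-oo, K%:R].
  pose q : R := 1 - expR (- r * K%:R).
  have mA n : measurable (A n) by exact: measurable_funPTI.
  have AE n : P (A n) = q%:E.
    have -> : A n = ~` [set w | K%:R < e n w].
      by apply/seteqP; split => w; rewrite /A/= in_itv/= leNgt => /negP.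
    have : P (~` [set w | K%:R < e n w]) = (1 - P [set w | (K%:R < e n w)%R])%E.
      by apply: probability_setC; exact: measurable_gt_ray.
    by rewrite e_tail// => ->; rewrite -EFinB.
  have q0 : 0 <= q by rewrite subr_ge0 -expR0 ler_expR mulNr oppr_le0 mulr_ge0// ltW.
  have q1 : q < 1 by rewrite ltrBlDr ltrDl expR_gt0.
  have Aq n : P (\bigcap_(i in [set` iota 0 n]) A i) = (q ^+ n)%:E.
    rewrite (e_indep (iota_uniq 0 n)) => [|i _]; last by exists `]-oo, K%:R]%classic; rewrite ?setTI.
    under eq_bigr do rewrite AE.
    rewrite -[in RHS](size_iota 0 n); elim: (iota 0 n) => [|i l IH]; first by rewrite big_nil.
    by rewrite big_cons IH -EFinM -exprS.
  exists (\bigcap_i A i); split.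
  - exact: bigcap_measurableType.
  - apply/eqP; rewrite eq_le measure_ge0 andbT.
    have c : (q ^+ n)%:E @[n --> \oo] --> (0 : \bar R).
      by apply: cvg_EFin; [exact: nearW|apply: cvg_expr; rewrite ger0_norm].
    rewrite -(cvg_lim _ c)//; apply: lime_ge; first exact: cvgP c.
    apply: nearW => n; rewrite -Aq.
    apply: le_measure; rewrite ?inE.
    + exact: bigcap_measurableType.
    + exact: bigcap_measurableType.
    + by move=> w h i _; exact: h.
  - move=> w /= h i _; rewrite /A/= in_itv/= leNgt; apply/negP => Ke.
    by apply: h; exists i.
apply: filterS3 h1 h2 h3 => w e0 th eK; split => // K.
have [n hn] := eK (Num.truncn `|K|).+1; exists n.+1.
rewrite /T renewal_timeS (lt_le_trans _ (_ : e n w <= _))//.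
  by rewrite (le_lt_trans (ler_norm K))// (lt_trans _ hn)//; have /andP[] := truncn_itv (normr_ge0 K).
by rewrite lerDr sumr_ge0// => j _; exact: ltW.
Qed.

End renewal_independence.

(** * The renewal equation and the transform of the telegraph process *)

Section telegraph_law.
Context (R : realType) d (Omega : measurableType d) (P : probability Omega R).
Variables (theta e : nat -> {RV P >-> R}) (ell rho : R).
Hypotheses (ell0 : 0 < ell) (rho1 : 1 < rho).
Let r := 2 / ell.
Let r0 : 0 < r. Proof. by rewrite divr_gt0. Qed.
Hypothesis theta_indep : mutually_independent P (fun j => sigma_rv (theta j)).
Hypothesis theta1 : forall j, P [set w | theta j w = 1] = (1 / 2)%:E.
Hypothesis thetaN1 : forall j, P [set w | theta j w = - 1] = (1 / 2)%:E.
Hypothesis e_indep : mutually_independent P (fun j => sigma_rv (e j)).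
Hypothesis e_tail : forall j (t : R), 0 <= t -> P [set w | t < e j w] = (expR (- r * t))%:E.
Hypothesis theta_e : independent P (sigma_family setT theta) (sigma_family setT e).

Let T n w := renewal_time (fun j => e j : Omega -> R) n w.
Let Y n w := telegraph_sum (fun j => theta j : Omega -> R) (fun j => e j : Omega -> R) n w.
Let Z u w := telegraph_position (fun j => theta j : Omega -> R) (fun j => e j : Omega -> R) u w.
Let beta := (rho - rho^-1) / (2 * ell).
Let tt := telegraph_transform ell rho.

Let measurable_theta j : measurable_fun setT (theta j). Proof. exact: measurable_funPT. Qed.
Let measurable_e j : measurable_fun setT (e j). Proof. exact: measurable_funPT. Qed.

(** The candidate functional over a horizon [v], given the first direction [z] and interval [s]:
    restart after [s] with the remaining time, or a straight run when no renewal occurs by [v]. *)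
Let step v z s : R := if s <= v then expR (- (beta * (z * s))) * tt (v - s)
                      else expR (- (beta * (z * v))).

Let step_ge0 v z s : 0 <= step v z s.
Proof.
rewrite /step; case: ifP => _; last exact: expR_ge0.
by rewrite mulr_ge0 ?expR_ge0// telegraph_transform_ge0.
Qed.

Let measurable_step d' (S : measurableType d') (v z s : S -> R) :
  measurable_fun setT v -> measurable_fun setT z -> measurable_fun setT s ->
  measurable_fun setT (fun x => step (v x) (z x) (s x)).
Proof.
move=> mv mz ms.
have mexp (f : S -> R) : measurable_fun setT f -> measurable_fun setT (fun x => expR (- (beta * f x))).
  move=> mf; apply: measurableT_comp => //; apply: measurableT_comp => //.
  exact: measurable_funM.
rewrite /step; apply: measurable_fun_if => //; first exact: measurable_fun_ler.
  apply: measurable_funTS; apply: measurable_funM.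
    by apply: mexp; exact: measurable_funM.
  by apply: measurableT_comp; [exact: measurable_telegraph_transform|exact: measurable_funB].
by apply: measurable_funTS; apply: mexp; exact: measurable_funM.
Qed.

Let step_direction n v z : 0 <= v -> z = 1 \/ z = - 1 ->
  let K1 := (2 - rho - rho^-1) / (2 * ell) in
  let K2 := (2 + rho + rho^-1) / (2 * ell) in
  let d1 := K1 - beta * z - r in let d2 := K2 - beta * z - r in
  let B := expR (- ((beta * z + r) * v)) in
  (\int[P]_w (step v z (e n w))%:E = (r / (2 * (rho ^+ 2 + 1)) *
     ((rho + 1) ^+ 2 * (B - expR (- (K1 * v))) / d1 +
      (rho - 1) ^+ 2 * (B - expR (- (K2 * v))) / d2) + B)%:E)%E.
Proof.
move=> v0 zE K1 K2 d1 d2 B.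
pose g s := expR (- (beta * (z * s))) * tt (v - s).
have mg : measurable_fun setT g.
  apply: measurable_funM; last first.
    by apply: measurableT_comp; [exact: measurable_telegraph_transform|exact: measurable_funB].
  by apply: measurableT_comp => //; apply: measurableT_comp => //; exact: measurable_funM.
have g0 s : 0 <= g s by rewrite mulr_ge0 ?expR_ge0// telegraph_transform_ge0.
have mi : measurable [set w | v < e n w] by exact: measurable_gt_ray.
have m1 : measurable_fun setT (fun w => if 0 <= e n w <= v then g (e n w) else 0).
  apply: measurable_fun_if => //.
    by apply: measurable_and; exact: measurable_fun_ler.
  by apply: measurable_funTS; exact: measurableT_comp.
transitivity (\int[P]_w ((if 0 <= e n w <= v then g (e n w) else 0)%:E +
   (expR (- (beta * (z * v))))%:E * (\1_[set w | v < e n w] w)%:E))%E.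
  apply: ae_eq_integral => //.
  - by apply/measurable_EFinP; exact: measurable_step.
  - apply: emeasurable_funD; first exact/measurable_EFinP.
    by apply: emeasurable_funM => //; apply/measurable_EFinP; exact: measurable_indic.
  apply: filterS (exponential_gt0 (measurable_e n) (e_tail n)) => w e0 _.
  rewrite /step (ltW e0)/= indicE; case: leP => ev.
    by rewrite memNset/= ?mule0 ?adde0// => /(le_lt_trans ev); rewrite ltxx.
  by rewrite mem_set// mule1 add0e.
rewrite ge0_integralD//; last 3 first.
- by move=> w _; rewrite lee_fin; case: ifP.
- exact/measurable_EFinP.
- by apply: emeasurable_funM => //; apply/measurable_EFinP; exact: measurable_indic.
rewrite (exponential_expectation_itv (measurable_e n) r0 (e_tail n) v mg g0).
rewrite ge0_integralZl ?lee_fin ?expR_ge0//; last first.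
  by apply/measurable_EFinP; exact: measurable_indic.
rewrite integral_indic// setIT.
have -> : ((expR (- (beta * (z * v))))%:E * P [set w | (v < e n w)%R] = B%:E)%E.
  by rewrite e_tail// -EFinM -expRD; congr (expR _)%:E; rewrite /r; ring.
by rewrite (integral_telegraph_transform ell0 rho1 v0 zE) -EFinD.
Qed.

(** The renewal equation: averaging over the direction with the interval frozen, then over the
    interval, reproduces [tt]. *)
Let step_mean n v : 0 <= v ->
  (\int[P]_w (step v (theta n w) (e n w))%:E = (tt v)%:E)%E.
Proof.
move=> v0.
rewrite (@independent_fubini _ _ _ P _ _ _ _ (e n) (theta n)
  (fun x => (step v x.2 x.1)%:E))//; last 3 first.
- exact: renewal_pair_independent.
- by apply/measurable_EFinP; exact: measurable_step.
- by move=> x; rewrite lee_fin.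
transitivity (\int[P]_w ((1 / 2)%:E * (step v 1 (e n w))%:E +
    (1 / 2)%:E * (step v (- 1) (e n w))%:E))%E.
  apply: eq_integral => w _ /=.
  rewrite (two_point_expectation (measurable_theta n) (theta1 n) (thetaN1 n)
    (g := fun z => (step v z (e n w))%:E))//; first by move=> z; rewrite lee_fin.
  by apply/measurable_EFinP; exact: measurable_step.
have m z : measurable_fun setT (fun w => (step v z (e n w))%:E).
  by apply/measurable_EFinP; exact: measurable_step.
rewrite ge0_integralD//; last 4 first.
- by move=> w _; rewrite mule_ge0 ?lee_fin.
- exact: emeasurable_funM.
- by move=> w _; rewrite mule_ge0 ?lee_fin.
- exact: emeasurable_funM.
rewrite !ge0_integralZl//; try by (move=> w _; rewrite lee_fin).
rewrite !step_direction//; try (by left); try (by right).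
by rewrite -!EFinM -EFinD; congr EFin; exact: telegraph_transform_renewal.
Qed.

Variable u : R.
Hypothesis u0 : 0 <= u.

(* The Laplace functional at time [u], averaged over the path after the [n]-th renewal. *)
Let partial n w : R :=
  if T n w <= u then expR (- (beta * Y n w)) * tt (u - T n w) else expR (- (beta * Z u w)).

Let measurable_T n : measurable_fun setT (T n).
Proof. exact: measurable_renewal_time. Qed.

Let measurable_Y n : measurable_fun setT (Y n).
Proof. exact: measurable_telegraph_sum. Qed.

Let measurable_Z : measurable_fun setT (Z u).
Proof. exact: (measurable_telegraph_position _ _ (f := cst u)). Qed.

Let measurable_exp (f : Omega -> R) : measurable_fun setT f ->
  measurable_fun setT (fun w => expR (- (beta * f w))).
Proof.
move=> mf; apply: measurableT_comp => //; apply: measurableT_comp => //.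
exact: measurable_funM.
Qed.

Let measurable_tt n : measurable_fun setT (fun w => expR (- (beta * Y n w)) * tt (u - T n w)).
Proof.
apply: measurable_funM; first exact: measurable_exp.
by apply: measurableT_comp; [exact: measurable_telegraph_transform|exact: measurable_funB].
Qed.

Let measurable_partial n : measurable_fun setT (partial n).
Proof.
rewrite /partial; apply: measurable_fun_if => //; first exact: measurable_fun_ler.
  by apply: measurable_funTS; exact: measurable_tt.
by apply: measurable_funTS; exact: measurable_exp.
Qed.

(** When [T n <= u], the next pair is independent of [(T n, Y n)], and [step_mean] averages it out.
    When [T n > u], the value is already final and is carried along unchanged as [B]. *)
Let partial_mean_step n : (\int[P]_w (partial n.+1 w)%:E = \int[P]_w (partial n w)%:E)%E.
Proof.
pose A n w : R := if T n w <= u then expR (- (beta * Y n w)) * tt (u - T n w) else 0.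
pose B w : R := if T n w <= u then 0 else expR (- (beta * Z u w)).
pose f (x : (R * R) * (R * R)) : R :=
  if x.1.1 <= u then expR (- (beta * x.1.2)) * step (u - x.1.1) x.2.1 x.2.2 else 0.
have mB : measurable_fun setT B.
  apply: measurable_fun_if => //; first exact: measurable_fun_ler.
  by apply: measurable_funTS; exact: measurable_exp.
have mA : measurable_fun setT (A n).
  apply: measurable_fun_if => //; first exact: measurable_fun_ler.
  by apply: measurable_funTS; exact: measurable_tt.
have mf : measurable_fun setT f.
  have m11 : measurable_fun setT (fun x : (R * R) * (R * R) => x.1.1) by exact: measurableT_comp.
  have m12 : measurable_fun setT (fun x : (R * R) * (R * R) => x.1.2) by exact: measurableT_comp.
  have m21 : measurable_fun setT (fun x : (R * R) * (R * R) => x.2.1) by exact: measurableT_comp.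
  have m22 : measurable_fun setT (fun x : (R * R) * (R * R) => x.2.2) by exact: measurableT_comp.
  apply: measurable_fun_if => //; first exact: measurable_fun_ler.
  apply: measurable_funTS; apply: measurable_funM.
    by apply: measurableT_comp => //; apply: measurableT_comp => //; exact: measurable_funM.
  by apply: measurable_step => //; exact: measurable_funB.
have f0 x : 0 <= f x by rewrite /f; case: ifP => // _; rewrite mulr_ge0 ?expR_ge0.
have A0 w : 0 <= A n w.
  by rewrite /A; case: ifP => // _; rewrite mulr_ge0 ?expR_ge0 ?telegraph_transform_ge0.
have B0 w : 0 <= B w by rewrite /B; case: ifP => // _; rewrite expR_ge0.
pose U w := (T n w, Y n w); pose V w := (theta n w, e n w).
have mU : measurable_fun setT U by exact: measurable_fun_pair.
have mV : measurable_fun setT V by exact: measurable_fun_pair.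
transitivity (\int[P]_w ((f (U w, V w))%:E + (B w)%:E))%E.
  apply: ae_eq_integral => //.
  - exact/measurable_EFinP.
  - apply: emeasurable_funD; apply/measurable_EFinP => //.
    by apply: measurableT_comp => //; exact: measurable_fun_pair.
  apply: filterS (renewal_good_path r0 theta1 thetaN1 e_indep e_tail) => w [e0 th _] _.
  rewrite -EFinD; congr EFin; rewrite /partial /f /B/= /step.
  have Tlt : T n w < T n.+1 w by exact: renewal_time_lt.
  case: (leP (T n w) u) => Tu; last first.
    by rewrite leNgt (lt_trans Tu Tlt)/= add0r.
  have TS : T n.+1 w = T n w + e n w by exact: renewal_timeS.
  have YS : Y n.+1 w = Y n w + theta n w * e n w by exact: telegraph_sumS.
  rewrite addr0 TS -lerBrDl; case: (leP (e n w) (u - T n w)) => eu.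
    by rewrite YS opprD addrA (mulrA (expR _)) -expRD -opprD -mulrDr.
  rewrite -expRD -opprD -mulrDr; congr (expR (- (beta * _))).
  by apply: telegraph_position_itv => //; rewrite -/(T n w) -/(T n.+1 w) Tu/= TS -ltrBlDl.
rewrite ge0_integralD//; last 4 first.
- by move=> w _; rewrite lee_fin.
- by apply/measurable_EFinP; apply: measurableT_comp => //; exact: measurable_fun_pair.
- by move=> w _; rewrite lee_fin.
- exact/measurable_EFinP.
rewrite (independent_fubini (f := EFin \o f) mU mV); last 3 first.
- exact: renewal_step_independent.
- exact/measurable_EFinP.
- by move=> x; rewrite lee_fin.
transitivity (\int[P]_w (A n w)%:E + \int[P]_w (B w)%:E)%E; last first.
  rewrite -ge0_integralD//; try (by move=> w _; rewrite lee_fin); try exact/measurable_EFinP.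
  apply: eq_integral => w _; rewrite -EFinD; congr EFin; rewrite /A /B /partial.
  by case: ifP => _; rewrite ?addr0 ?add0r.
congr (_ + _)%E; apply: eq_integral => w _; rewrite /f /U /V /A/=.
case: (leP (T n w) u) => Tu; last by rewrite integral0.
under eq_integral do rewrite EFinM.
rewrite ge0_integralZl ?lee_fin ?expR_ge0//; last 2 first.
- by apply/measurable_EFinP; exact: measurable_step.
- by move=> w' _; rewrite lee_fin.
by rewrite step_mean ?subr_ge0// -EFinM.
Qed.

Lemma telegraph_position_transform :
  (\int[P]_w (expR (- (beta * Z u w)))%:E = (tt u)%:E)%E.
Proof.
have E n : (\int[P]_w (partial n w)%:E = (tt u)%:E)%E.
  elim: n => [|n <-]; last exact: partial_mean_step.
  rewrite (_ : (fun w => _) = cst (tt u)%:E); first last.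
    apply/funext => w; have TE : T 0%N w = 0 by exact: big_ord0.
    have YE : Y 0%N w = 0 by exact: big_ord0.
    by rewrite /partial TE YE u0 mulr0 oppr0 expR0 mul1r addr0.
  by rewrite integral_cst// [X in (_ * X)%E](_ : _ = 1%E) ?mule1//; exact: probability_setT.
(* Both [Y n], while [T n <= u], and [Z u] are at most [u] in absolute value. The second factor
   dominates [tt] on [[0, u]], and its [+ 1] accommodates the branch without [tt]. *)
pose C : R := expR (`|beta| * u) * (((rho + 1) ^+ 2 * expR (`|(2 - rho - rho^-1) / (2 * ell)| * u) +
  (rho - 1) ^+ 2 * expR (`|(2 + rho + rho^-1) / (2 * ell)| * u)) / (2 * (rho ^+ 2 + 1)) + 1).
have expC c y : `|y| <= u -> expR (- (c * y)) <= expR (`|c| * u).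
  move=> yu; rewrite ler_expR (le_trans (ler_norm _))// normrN normrM.
  by rewrite ler_wpM2l.
have r2 : 0 < 2 * (rho ^+ 2 + 1) by rewrite mulr_gt0// ltr_wpDl ?sqr_ge0.
have ttC v : 0 <= v <= u -> tt v <= ((rho + 1) ^+ 2 * expR (`|(2 - rho - rho^-1) / (2 * ell)| * u) +
  (rho - 1) ^+ 2 * expR (`|(2 + rho + rho^-1) / (2 * ell)| * u)) / (2 * (rho ^+ 2 + 1)).
  move=> /andP[v0 vu]; rewrite ler_pM2r ?invr_gt0//.
  by rewrite lerD// ler_wpM2l ?sqr_ge0// expC// ger0_norm.
have good := renewal_good_path r0 theta1 thetaN1 e_indep e_tail.
have cvg : {ae P, forall w, partial n w @[n --> \oo] --> expR (- (beta * Z u w))}.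
  apply: filterS good => w [e0 th ub].
  have [N uN] := ub u; apply: cvg_near_cst; exists N => // n /= Nn.
  rewrite /partial leNgt (lt_le_trans uN)//.
  move: Nn; rewrite leq_eqVlt => /predU1P[->//|Nn'].
  by apply: ltW; exact: renewal_time_lt.
have bnd : {ae P, forall w, forall n, `|partial n w| <= C}.
  apply: filterS good => w [e0 th ub] n.
  have ge1 : 1 <= expR (`|beta| * u) by rewrite -expR0 ler_expR mulr_ge0.
  have tt0 := le_trans (telegraph_transform_ge0 ell rho u) (ttC u _).
  rewrite /partial; case: (leP (T n w) u) => Tu.
    have T0 : 0 <= T n w by apply: sumr_ge0 => j _; exact: ltW.
    rewrite ger0_norm; last by apply: mulr_ge0; [exact: expR_ge0|exact: telegraph_transform_ge0].
    apply: ler_pM; [exact: expR_ge0|exact: telegraph_transform_ge0| |].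
      by apply: expC; exact: le_trans (telegraph_sum_bound e0 th n) Tu.
    rewrite (le_trans (ttC _ _)) ?lerDl//.
    by rewrite subr_ge0 Tu/= gerBl.
  rewrite ger0_norm ?expR_ge0// /C -[leLHS]mulr1.
  apply: ler_pM; rewrite ?expR_ge0//.
    by apply: expC; exact: telegraph_position_bound.
  by rewrite lerDr tt0// u0 lexx.
have := cvg_bounded_expectation measurable_partial (measurable_exp measurable_Z) bnd cvg.
rewrite (_ : (fun n => _) = fun=> (tt u)%:E); last exact/funext.
by move=> h; apply/esym; apply: (cvg_unique _ (cvg_cst _) h); exact: ereal_hausdorff.
Qed.

End telegraph_law.

(** * Reflected Brownian motion at the inverse local time *)

Section inverse_time_of_continuous.
Context (R : realType).
Variables (f : R -> R) (u : R).
Hypotheses (f0 : f 0 = 0) (u0 : 0 <= u).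
Hypothesis ndf : forall s t : R, 0 <= s -> s <= t -> f s <= f t.
Hypothesis cf : continuous (fun t : R => f (Num.max 0 t)).
Hypothesis unb : exists2 t, 0 <= t & u < f t.

Lemma lt_after_inverse_time t : inverse_time f u < t -> u < f t.
Proof.
move=> /(inverse_time_lt unb)[v [v0 vt uv]].
by rewrite (lt_le_trans uv)// ndf// ltW.
Qed.

Lemma inverse_timeK : f (inverse_time f u) = u.
Proof.
set sg := inverse_time f u; have sg0 : 0 <= sg := inverse_time_ge0 _ _.
apply/eqP; rewrite eq_le; apply/andP; split; rewrite leNgt; apply/negP => h.
- have e0 : 0 < f sg - u by rewrite subr_gt0.
  have sgp : 0 < sg.
    rewrite lt_neqAle sg0 andbT; apply/eqP => sgE.
    by move: h; rewrite -sgE f0 ltNge u0.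
  have := @cf sg => /(@cvgrPdist_lt _ R^o)/(_ _ e0)[r /= r0 rP].
  pose v := Num.max 0 (sg - r / 2).
  have v0 : 0 <= v by rewrite le_max lexx.
  have vs : v < sg by rewrite gt_max sgp ltrBlDr ltrDl divr_gt0.
  have /rP/= : `|sg - v| < r.
    rewrite ger0_norm ?subr_ge0 ?(ltW vs)//.
    have : sg - r / 2 <= v by rewrite le_max lexx orbT.
    lra.
  rewrite !max_r// ger0_norm ?subr_ge0 ?ndf ?(ltW vs)// => h2.
  have uv : u < f v by lra.
  by have := inverse_time_le v0 uv; rewrite -/sg leNgt vs.
- have e0 : 0 < u - f sg by rewrite subr_gt0.
  have := @cf sg => /(@cvgrPdist_lt _ R^o)/(_ _ e0)[r /= r0 rP].
  have v0 : 0 <= sg + r / 2 by rewrite addr_ge0// divr_ge0// ltW.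
  have sv : sg < sg + r / 2 by rewrite ltrDl divr_gt0.
  have /rP/= : `|sg - (sg + r / 2)| < r.
    by rewrite opprD addNKr normrN ger0_norm ?divr_ge0 ?(ltW r0)//; lra.
  rewrite !max_r// distrC ger0_norm ?subr_ge0 ?ndf ?(ltW sv)// => h2.
  by have := lt_after_inverse_time sv; lra.
Qed.

End inverse_time_of_continuous.

Section independent_mean.
Context (R : realType) (d : measure_display) (Omega : measurableType d).
Variable P : probability Omega R.

Lemma integrable_sumR (I : Type) (r : seq I) (f : I -> Omega -> R) :
  (forall i, P.-integrable setT (EFin \o f i)) ->
  P.-integrable setT (EFin \o (fun w => \sum_(i <- r) f i w)).
Proof.
move=> h; elim: r => [|i r IH].
  apply: eq_integrable (integrable0 _ _) => // w _ /=.
  by rewrite big_nil.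
apply: eq_integrable (integrableD measurableT (h i) IH) => // w _ /=.
by rewrite big_cons EFinD.
Qed.

Lemma Rintegral_sum (I : Type) (r : seq I) (f : I -> Omega -> R) :
  (forall i, P.-integrable setT (EFin \o f i)) ->
  \int[P]_w (\sum_(i <- r) f i w) = \sum_(i <- r) \int[P]_w f i w.
Proof.
move=> h; elim: r => [|i r IH].
  under eq_Rintegral do rewrite big_nil.
  by rewrite big_nil Rintegral_cst// mul0r.
under eq_Rintegral do rewrite big_cons.
by rewrite RintegralD//; [rewrite IH big_cons|exact: integrable_sumR].
Qed.

Lemma integrable_bounded_mul (Y Z : Omega -> R) (C : R) : measurable_fun setT Y ->
  (forall w, `|Y w| <= C) -> P.-integrable setT (EFin \o Z) ->
  P.-integrable setT (EFin \o (fun w => Y w * Z w)).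
Proof.
move=> mY YC iZ; have mZ : measurable_fun setT Z.
  exact/measurable_EFinP/measurable_int/iZ.
apply: (@le_integrable _ _ _ P setT measurableT _ (fun w => C%:E * (Z w)%:E)%E).
- by apply/measurable_EFinP; exact: measurable_funM.
- move=> w _; rewrite /= lee_fin !normrM ler_wpM2r// (le_trans (YC w))//.
  exact: ler_norm.
- exact: integrableZl.
Qed.

(** Only the nonnegative form of Fubini is at hand, so [Z] is split into positive and negative
    parts. As [Y >= 0], the split passes through the product, and mean zero makes both parts equal
    in mean. *)
Lemma independent_mul_mean0 (Y Z : Omega -> R) (C : R) : measurable_fun setT Y ->
  (forall w, 0 <= Y w <= C) -> P.-integrable setT (EFin \o Z) ->
  (forall A A' : set R, measurable A -> measurable A' ->
    P (Y @^-1` A `&` Z @^-1` A') = (P (Y @^-1` A) * P (Z @^-1` A'))%E) ->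
  (\int[P]_w (Z w)%:E)%E = 0%E -> \int[P]_w (Y w * Z w) = 0.
Proof.
move=> mY YC iZ h Z0; have mZ : measurable_fun setT Z.
  exact/measurable_EFinP/measurable_int/iZ.
have Y0 w : 0 <= Y w by have /andP[] := YC w.
have prod (g : R -> R) : measurable_fun setT g -> (forall x, 0 <= g x) ->
    (\int[P]_w (Y w * g (Z w))%:E =
     (\int[P]_w (g (Z w))%:E) * \int[P]_w (Y w)%:E)%E.
  move=> mg g0.
  (* The absolute value makes the integrand nonnegative on the whole plane; it disappears on the
     range of [Y]. *)
  pose k (x : R * R) : \bar R := (`|x.1| * g x.2)%:E.
  have mk : measurable_fun setT k.
    apply/measurable_EFinP; apply: measurable_funM; first exact: measurableT_comp.
    exact: measurableT_comp.
  have k0 x : (0 <= k x)%E by rewrite lee_fin mulr_ge0.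
  have := independent_fubini mY mZ h mk k0.
  rewrite /k/=; under eq_integral do rewrite ger0_norm//.
  move=> ->; rewrite muleC -ge0_integralZr//; last 3 first.
  - exact/measurable_EFinP.
  - by move=> w _; rewrite lee_fin.
  - by apply: integral_ge0 => w _; rewrite lee_fin.
  apply: eq_integral => w _; rewrite ger0_norm//.
  under eq_integral do rewrite EFinM.
  rewrite ge0_integralZl//.
  - by apply/measurable_EFinP; exact: measurableT_comp.
  - by move=> w' _; rewrite lee_fin.
  - by rewrite lee_fin.
have mpos : measurable_fun setT (fun x : R => Num.max x 0) by exact: measurable_maxr.
have mneg : measurable_fun setT (fun x : R => Num.max (- x) 0) by exact: measurable_maxr.
have pos0 (x : R) : 0 <= Num.max x 0 by rewrite le_max lexx orbT.
have posE (U : Omega -> R) : (\int[P]_w (U w)%:E = \int[P]_w (Num.max (U w) 0)%:E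
    - \int[P]_w (Num.max (- U w) 0)%:E)%E.
  rewrite integralE; congr (_ - _)%E; apply: eq_integral => w _.
    by rewrite funeposE/= -EFin_max.
  by rewrite funenegE/= -EFin_max.
have finpos : (\int[P]_w (Num.max (Z w) 0)%:E)%E \is a fin_num.
  rewrite ge0_fin_numE; last by apply: integral_ge0 => w _; rewrite lee_fin.
  have /integrableP[_] := iZ; apply: le_lt_trans.
  apply: ge0_le_integral => //=.
  - by move=> w _; rewrite lee_fin.
  - by apply/measurable_EFinP; exact: measurableT_comp mpos mZ.
  - by apply/measurable_EFinP; exact: measurableT_comp.
  - by move=> w _; rewrite lee_fin ge_max ler_norm/=.
have eqpos : (\int[P]_w (Num.max (Z w) 0)%:E = \int[P]_w (Num.max (- Z w) 0)%:E)%E.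
  move: Z0; rewrite posE => /eqP; rewrite sube_eq ?add0e//.
  by move=> /eqP.
rewrite /Rintegral posE.
have -> : (\int[P]_w (Num.max (Y w * Z w) 0)%:E =
    (\int[P]_w (Num.max (Z w) 0)%:E) * \int[P]_w (Y w)%:E)%E.
  rewrite -(prod (fun x => Num.max x 0))//; apply: eq_integral => w _.
  by rewrite maxr_pMr ?mulr0.
have -> : (\int[P]_w (Num.max (- (Y w * Z w)) 0)%:E =
    (\int[P]_w (Num.max (- Z w) 0)%:E) * \int[P]_w (Y w)%:E)%E.
  rewrite -(prod (fun x => Num.max (- x) 0))//; apply: eq_integral => w _.
  by rewrite maxr_pMr ?mulr0 ?mulrN.
rewrite -eqpos subee//.
rewrite fin_numM//; apply: integrable_fin_num => //.
by apply: (@bounded_integrable _ _ _ P Y C) => // w; rewrite ger0_norm//; have /andP[] := YC w.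
Qed.

End independent_mean.

(** * Optional stopping of the exponential martingale at a local time level *)

Section reflected_brownian_motion.
Context (R : realType) (d : measure_display) (Omega : measurableType d).
Variables (P : probability Omega R) (a b : R) (X B ga gb : R -> {RV P >-> R}).
Hypothesis ab : a < b.
Hypothesis HX : reflected_brownian_motion a b X B ga gb.

Let F (t : R) := completed P (natural_filtration X t).
Let HB : brownian_motion F 2 B := rbm_driving HX.
Let Ha := rbm_local_a HX.
Let Hb := rbm_local_b HX.

Definition local_time (t : R) (w : Omega) : R := ga t w + gb t w.

Lemma local_time0 w : local_time 0 w = 0.
Proof. by rewrite /local_time (lt_start Ha) (lt_start Hb) addr0. Qed.

Lemma local_time_nd w (s t : R) : 0 <= s -> s <= t -> local_time s w <= local_time t w.
Proof. by move=> s0 st; rewrite lerD// ?(lt_nondecreasing Ha)// (lt_nondecreasing Hb). Qed.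

Lemma local_time_ge0 w (t : R) : 0 <= t -> 0 <= local_time t w.
Proof. by move=> t0; rewrite -(local_time0 w) local_time_nd. Qed.

Lemma measurable_local_time t : measurable_fun setT (local_time t).
Proof. exact: measurable_funD. Qed.

Let cga w : continuous (fun t : R => ga (Num.max 0 t) w).
Proof. by apply: (@continuous_extension R (fun t => ga t w)); exact: (lt_continuous Ha). Qed.

Let cgb w : continuous (fun t : R => gb (Num.max 0 t) w).
Proof. by apply: (@continuous_extension R (fun t => gb t w)); exact: (lt_continuous Hb). Qed.

Let cB w : continuous (fun t : R => B (Num.max 0 t) w).
Proof. by apply: (@continuous_extension R (fun t => B t w)); exact: (bm_continuous HB). Qed.

Lemma local_time_continuous w : continuous (fun t : R => local_time (Num.max 0 t) w).
Proof. by move=> t; apply: cvgD; [exact: cga|exact: cgb]. Qed.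

Let XE w (t : R) : 0 <= t -> X t w = X 0 w + B t w + ga t w - gb t w.
Proof. exact: (rbm_skorokhod HX). Qed.

Let cX w : continuous (fun t : R => X (Num.max 0 t) w).
Proof.
have -> : (fun t : R => X (Num.max 0 t) w) = (fun t : R =>
    X 0 w + B (Num.max 0 t) w + ga (Num.max 0 t) w - gb (Num.max 0 t) w).
  by apply/funext => t; rewrite XE// le_max lexx.
move=> t; apply: cvgB; last exact: cgb.
apply: cvgD; last exact: cga.
by apply: cvgD; [exact: cvg_cst|exact: cB].
Qed.

Lemma right_continuous_of_extension (f : R -> R) :
  continuous (fun t : R => f (Num.max 0 t)) -> forall s, 0 <= s ->
  f s' @[s' --> s^'+] --> f s.
Proof.
move=> cf s s0; have := cvg_at_right_filter (cf s); rewrite max_r//.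
apply: cvg_trans; apply: near_eq_cvg; near=> v.
by rewrite max_r// (le_trans s0)//; apply: ltW; near: v; exact: nbhs_right_gt.
Unshelve. all: end_near. Qed.

(** A total local time at most [K] would force, by the Skorokhod decomposition,
    [|B t| <= K + (b - a)] at every time, an event whose probability at time [t] is of order
    [t ^ (- 1 / 2)]. *)
Lemma local_time_unbounded :
  {ae P, forall w, forall K : R, exists2 t, 0 <= t & K < local_time t w}.
Proof.
pose N (K : nat) := \bigcap_n [set w | local_time n%:R w <= K%:R].
have mle (t K : R) : measurable [set w | local_time t w <= K].
  have -> : [set w | local_time t w <= K] = ~` [set w | K < local_time t w].
    by apply/seteqP; split => w /=; rewrite leNgt => /negP.
  by apply: measurableC; apply: measurable_gt_ray; exact: measurable_local_time.
have mN K : measurable (N K) by apply: bigcapT_measurable => n; exact: mle.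
suff N0 K : P (N K) = 0%E.
  exists (\bigcup_K N K); split.
  - exact: bigcup_measurable.
  - apply/negligibleP; first exact: bigcup_measurable.
    by apply: negligible_bigcup => K; apply/negligibleP; [exact: mN|exact: N0].
  - move=> w /= /existsNP[K nK]; exists (Num.truncn `|K|).+1 => // n _ /=.
    rewrite leNgt; apply/negP => h; apply: nK; exists n%:R => //.
    rewrite (le_lt_trans _ h)// (le_trans (ler_norm K))// ltW//.
    by have /andP[] := truncn_itv (normr_ge0 K).
pose C := 2 * (K%:R + (b - a)) : R.
have C0 : 0 <= K%:R + (b - a) by rewrite addr_ge0// subr_ge0 ltW.
have PN : P (N K) \is a fin_num by rewrite fin_num_measure.
have bound n : fine (P (N K)) <= C * n.+1%:R^-1.
  (* Square times turn the decay [t ^ (- 1 / 2)] into a harmonic one. *)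
  pose t : R := (n.+1 ^ 2)%N%:R.
  have t0 : 0 < t by rewrite ltr0n expn_gt0.
  have s0 : 0 < Num.sqrt (2 * (t - 0)) by rewrite sqrtr_gt0 subr0 mulr_gt0.
  have mBt : measurable_fun setT (fun w => B t w - B 0 w) by exact: measurable_funB.
  rewrite -lee_fin fineK//.
  apply: le_trans (le_trans (gaussian_concentration s0
    (bm_gaussian HB (lexx 0) t0) C0) _).
    apply: le_measure; rewrite ?inE//.
      have -> : [set w | `|B t w - B 0 w| <= K%:R + (b - a)] =
          (fun w => B t w - B 0 w) @^-1` `[- (K%:R + (b - a)), K%:R + (b - a)].
        by apply/seteqP; split=> w /=; rewrite in_itv/= ler_norml.
      by rewrite -[X in measurable X]setTI; exact: mBt.
    move=> w /(_ (n.+1 ^ 2)%N I) /=; rewrite -/t => h.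
    rewrite (bm_start HB) subr0.
    have /andP[X0a X0b] := rbm_range HX w (lexx 0).
    have /andP[Xta Xtb] := rbm_range HX w (ltW t0).
    have := XE w (ltW t0).
    have := lt_nondecreasing Ha w (lexx 0) (ltW t0).
    have := lt_nondecreasing Hb w (lexx 0) (ltW t0).
    rewrite (lt_start Ha) (lt_start Hb).
    rewrite /local_time in h.
    by rewrite ler_norml => *; apply/andP; split; lra.
  rewrite lee_fin /C ler_wpM2l ?mulr_ge0// /normal_peak lef_pV2 ?posrE//; last first.
    by rewrite sqrtr_gt0 mulrn_wgt0// mulr_gt0 ?pi_gt0// exprn_gt0.
  rewrite sqr_sqrtr subr0; last by rewrite mulr_ge0// ltW.
  have k0 : (0 : R) <= n.+1%:R by [].
  rewrite -[leLHS](ger0_norm k0) -sqrtr_sqr ler_wsqrtr// /t natrX.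
  have := pi_ge2 R; have : (1 : R) <= n.+1%:R ^+ 2 by rewrite exprn_ege1// ler1n.
  set k := n.+1%:R ^+ 2; rewrite -mulr_natl; nra.
have h : (fun _ : nat => fine (P (N K))) n @[n --> \oo] --> 0.
  apply: (@cvg_of_harmonic_bound _ _ _ C) => n.
  by rewrite subr0 ger0_norm ?fine_ge0.
rewrite -[LHS]fineK//; congr EFin.
by apply: (cvg_unique _ _ h); [exact: norm_hausdorff|exact: cvg_cst].
Qed.

Section level.
Variables (u rho : R).
Hypotheses (u0 : 0 <= u) (rho0 : rho != 0).

Let weight (t : R) (w : Omega) := exp_weight a b rho (ga ^~ w) (gb ^~ w) t.
Let chi (t : R) (w : Omega) : R := (local_time t w <= u)%R%:R.
Let L := (`|rate_a a b rho| + `|rate_b a b rho|) * u.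

Let weight_bound t w : 0 <= t -> local_time t w <= u -> 0 <= weight t w <= expR L.
Proof.
move=> t0 h; apply: exp_weight_bound => //.
- exact: (lt_start Ha).
- exact: (lt_start Hb).
- exact: (lt_nondecreasing Ha).
- exact: (lt_nondecreasing Hb).
Qed.

Let chi_weight_bound t w : 0 <= t -> 0 <= chi t w * weight t w <= expR L.
Proof.
move=> t0; rewrite /chi; case: (leP (local_time t w) u) => h; last by rewrite /= mul0r lexx expR_ge0.
by rewrite /= mul1r; exact: weight_bound.
Qed.

Let measurable_chi_weight (d' : measure_display) (T : measurableType d') (pa pb : T -> R) :
  measurable_fun setT pa -> measurable_fun setT pb ->
  measurable_fun setT (fun w => (pa w + pb w <= u)%R%:R *
    expR (rate_a a b rho * pa w + rate_b a b rho * pb w) : R).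
Proof.
move=> mpa mpb; apply: measurable_funM; last first.
  apply: measurableT_comp => //.
  by apply: measurable_funD; exact: measurable_funM.
have -> : (fun w => (pa w + pb w <= u)%R%:R : R) =
    \1_(~` [set w | u < pa w + pb w]).
  apply/funext => w; rewrite indicE; case: leP => h.
    by rewrite mem_set//=; apply/negP; rewrite -leNgt.
  by rewrite memNset//= => /(_ h).
by apply: measurable_indic; apply: measurableC; apply: measurable_gt_ray; exact: measurable_funD.
Qed.

Let F_sigma t : sigma_algebra setT (F t).
Proof.
apply: completed_sigma_algebra; first exact: sigma_family_sigma_algebra.
exact: sigma_family_measurable.
Qed.

Let chi_weight_adapted t : 0 <= t -> sigma_rv (fun w => chi t w * weight t w) `<=` F t.
Proof.
move=> t0; rewrite -(sigma_algebra_id (F_sigma t)); apply: measurable_fun_sigma_rv.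
apply: (@measurable_chi_weight _ (g_sigma_algebraType (F t)) (ga t) (gb t)).
  by apply: adapted_measurable_fun; apply: subset_trans (lt_adapted Ha t0) _; exact: sub_sigma_algebra.
by apply: adapted_measurable_fun; apply: subset_trans (lt_adapted Hb t0) _; exact: sub_sigma_algebra.
Qed.

Let measurable_chi_weightT t : 0 <= t -> measurable_fun setT (fun w => chi t w * weight t w).
Proof. by move=> t0; exact: measurable_chi_weight. Qed.

Section increment.
Variables s t : R.
Hypotheses (s0 : 0 <= s) (st : s < t).
Let Z w := B t w - B s w.
Let sd := Num.sqrt (2 * (t - s)).
Let sd0 : 0 < sd. Proof. by rewrite sqrtr_gt0 mulr_gt0// subr_gt0. Qed.
Let mZ : measurable_fun setT Z. Proof. exact: measurable_funB. Qed.
Let lawZ A : measurable A -> P (Z @^-1` A) = normal_prob 0 sd A.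
Proof. exact: (bm_gaussian HB s0 st). Qed.

Lemma increment_integrable : P.-integrable setT (EFin \o Z).
Proof. exact: gaussian_integrable lawZ. Qed.

Lemma increment_fourth_integrable :
  P.-integrable setT (EFin \o (fun w => (Z w) ^+ 4)).
Proof.
apply/integrableP; split; first by apply/measurable_EFinP; exact: measurable_funX.
under eq_integral do rewrite /= ger0_norm ?exprn_even_ge0//.
by apply: le_lt_trans (gaussian_fourth_moment mZ sd0 lawZ) _; rewrite ltry.
Qed.

(** The variance is [2 (t - s)], so the bound [64 sd ^ 4] becomes [64 * 4 (t - s) ^ 2]. *)
Lemma increment_fourth_moment : \int[P]_w ((Z w) ^+ 4) <= 256 * (t - s) ^+ 2.
Proof.
rewrite -lee_fin /Rintegral fineK; last first.
  exact: (integrable_fin_num measurableT increment_fourth_integrable).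
apply: le_trans (gaussian_fourth_moment mZ sd0 lawZ) _.
rewrite lee_fin (exprM _ 2 2) sqr_sqrtr; last by rewrite mulr_ge0// subr_ge0 ltW.
by rewrite le_eqVlt; apply/orP; left; apply/eqP; ring.
Qed.

Lemma weighted_increment_mean0 : \int[P]_w (chi s w * weight s w * Z w) = 0.
Proof.
apply: (@independent_mul_mean0 _ _ _ P _ _ (expR L)).
- exact: measurable_chi_weightT.
- by move=> w; exact: chi_weight_bound.
- exact: increment_integrable.
- move=> A A' mA mA'; apply: (bm_independent HB s0 st).
    by apply: (chi_weight_adapted s0); exists A => //; rewrite setTI.
  by exists A' => //; rewrite setTI.
- exact: (gaussian_mean0 mZ sd0 lawZ).
Qed.

Lemma weighted_increment_integrable :
  P.-integrable setT (EFin \o (fun w => chi s w * weight s w * Z w)).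
Proof.
apply: (@integrable_bounded_mul _ _ _ P _ _ (expR L)).
- exact: measurable_chi_weightT.
- by move=> w; have /andP[h1 h2] := chi_weight_bound w s0; rewrite ger0_norm.
- exact: increment_integrable.
Qed.

End increment.

Let M t w := exp_martingale a b rho (X ^~ w) (ga ^~ w) (gb ^~ w) t.
Let sig w := inverse_time (local_time ^~ w) u.
Let N n : R := n.+1%:R.
(** With [N ^ 6] steps of mesh [N ^ -5] the horizon is [N]: it eventually passes any finite stopping
    time while the mesh tends to 0. *)
Let s n i : R := i%:R / N n ^+ 5.
Let m n := (n.+1 ^ 6)%N.
Let Z n i w := B (s n i.+1) w - B (s n i) w.
Let Q n w := stopped_sum a b u rho (X ^~ w) (B ^~ w) (ga ^~ w) (gb ^~ w) (s n) (m n).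
Let S n w := \sum_(i < m n) chi (s n i) w * weight (s n i) w * Z n i w.
(* At most one term of [W] is nonzero, and [|z| <= 1 / N + N ^ 3 * z ^ 4]; the fourth
   moments are of order [N ^ -10] and there are [N ^ 6] increments, so [E |W|] is of order
   [1 / N]. *)
Let W n w := \sum_(i < m n) (chi (s n i) w - chi (s n i.+1) w) * (weight (s n i) w * Z n i w).
Let V n w := expR L * ((N n)^-1 + N n ^+ 3 * \sum_(i < m n) Z n i w ^+ 4).

Let N_ge1 n : 1 <= N n. Proof. by rewrite /N ler1n. Qed.
Let N_gt0 n : 0 < N n. Proof. by rewrite /N. Qed.
Let s_ge0 n i : 0 <= s n i.
Proof. by rewrite divr_ge0// exprn_ge0// ltW. Qed.
Let s_step n i : s n i.+1 - s n i = (N n ^+ 5)^-1.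
Proof. by rewrite /s -mulrBl -natr1 addrAC subrr add0r mul1r. Qed.
Let s_lt n i : s n i < s n i.+1.
Proof. by rewrite -subr_gt0 s_step invr_gt0 exprn_gt0. Qed.
Let s00 n : s n 0%N = 0. Proof. by rewrite /s mul0r. Qed.

(** [Q] has its indicators at right ends and is bounded; [S] has them at left ends, is adapted and
    has mean zero; [W] is the price of the exchange. *)
Let stopped_decomposition n w : Q n w = M 0 w + slope a b rho * (S n w - W n w).
Proof.
rewrite /Q /stopped_sum -/(M 0 w); congr (_ + _ * _).
by rewrite /S /W -sumrB; apply: eq_bigr => i _; rewrite /chi /local_time /weight /Z; ring.
Qed.

Let chi_nonincreasing n i w : chi (s n i.+1) w <= chi (s n i) w.
Proof.
rewrite /chi; case: (leP (local_time (s n i.+1) w) u) => h; last by rewrite ler0n.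
by rewrite (le_trans _ h)// local_time_nd// ltW.
Qed.

Let abs_le_fourth (e z : R) : 0 < e -> `|z| <= e^-1 + e ^+ 3 * z ^+ 4.
Proof.
move=> e0; have -> : z ^+ 4 = `|z| ^+ 4 by rewrite -normrX ger0_norm// exprn_even_ge0.
set y := `|z|; have y0 : 0 <= y by exact: normr_ge0.
have [h|h] := leP y e^-1; first by rewrite ler_wpDr// mulr_ge0// exprn_ge0// ltW.
have ey : 1 < e * y by rewrite -ltr_pdivrMl// mulr1.
have h3 : 1 <= (e * y) ^+ 3 by rewrite exprn_ege1// ltW.
rewrite ler_wpDl ?invr_ge0 ?(ltW e0)//.
have -> : e ^+ 3 * y ^+ 4 = (e * y) ^+ 3 * y by ring.
by rewrite ler_peMl.
Qed.

(** The step at which the level is crossed need not be located: the indicator differences are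
    nonnegative and telescope to at most 1, and every increment is bounded by the same quantity, the
    sum of all fourth powers. *)
Let overshoot_bound n w : `|W n w| <= V n w.
Proof.
rewrite (le_trans (ler_norm_sum _ _ _))//.
pose T := \sum_(j < m n) Z n j w ^+ 4.
have T0 : 0 <= T by apply: sumr_ge0 => i _; rewrite exprn_even_ge0.
have N30 : 0 <= N n ^+ 3 by rewrite exprn_ge0// ltW.
have bnd0 : 0 <= expR L * ((N n)^-1 + N n ^+ 3 * T).
  by rewrite mulr_ge0 ?expR_ge0// addr_ge0 ?mulr_ge0// invr_ge0 ltW.
apply: (@le_trans _ _ (\sum_(i < m n) (chi (s n i) w - chi (s n i.+1) w) *
    (expR L * ((N n)^-1 + N n ^+ 3 * T)))).
  apply: ler_sum => i _; rewrite normrM ger0_norm ?subr_ge0 ?chi_nonincreasing//.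
  have [h|h] := leP (local_time (s n i) w) u; last first.
    have e0 : chi (s n i) w = 0 by rewrite /chi leNgt h.
    have e1 : chi (s n i.+1) w = 0.
      by apply/eqP; rewrite eq_le {2}/chi ler0n andbT -e0 chi_nonincreasing.
    by rewrite e0 e1 subrr !mul0r.
  rewrite ler_wpM2l ?subr_ge0 ?chi_nonincreasing//.
  have /andP[w0 wL] := weight_bound (s_ge0 n i) h.
  rewrite normrM ger0_norm// ler_pM//.
  rewrite (le_trans (abs_le_fourth (Z n i w) (N_gt0 n)))// lerD2l ler_wpM2l//.
  rewrite /T (bigD1 i)//= lerDl; apply: sumr_ge0 => j _; rewrite exprn_even_ge0//.
rewrite -mulr_suml ler_piMl//.
rewrite -(big_mkord xpredT (fun i => chi (s n i) w - chi (s n i.+1) w)).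
have -> : \sum_(0 <= i < m n) (chi (s n i) w - chi (s n i.+1) w) = chi (s n 0%N) w - chi (s n (m n)) w.
  rewrite -[LHS]opprK -sumrN; under eq_bigr do rewrite opprB.
  by rewrite telescope_sumr// opprB.
have c01 t : 0 <= chi t w <= 1 by rewrite /chi; case: (local_time t w <= u); rewrite /= ?lexx ?ler01.
by have := c01 (s n 0%N); have := c01 (s n (m n)); lra.
Qed.

Let measurable_chi t : measurable_fun setT (chi t).
Proof.
have -> : chi t = \1_(~` [set w | u < local_time t w]).
  apply/funext => w; rewrite indicE /chi; case: (leP (local_time t w) u) => h.
    by rewrite mem_set//=; apply/negP; rewrite -leNgt.
  by rewrite memNset//= => /(_ h).
apply: measurable_indic; apply: measurableC; apply: measurable_gt_ray.
exact: measurable_local_time.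
Qed.

Let measurable_weight t : measurable_fun setT (weight t).
Proof.
apply: measurableT_comp => //.
by apply: measurable_funD; exact: measurable_funM.
Qed.

Let measurable_Z n i : measurable_fun setT (Z n i). Proof. exact: measurable_funB. Qed.

Let measurable_S n : measurable_fun setT (S n).
Proof.
apply: measurable_sum => i; apply: measurable_funM; last exact: measurable_Z.
exact: measurable_funM.
Qed.

Let measurable_W n : measurable_fun setT (W n).
Proof.
apply: measurable_sum => i; apply: measurable_funM; first exact: measurable_funB.
exact: measurable_funM.
Qed.

Let integrable_V n : P.-integrable setT (EFin \o V n).
Proof.
have iT : P.-integrable setT (EFin \o (fun w => \sum_(i < m n) Z n i w ^+ 4)).
  apply: integrable_sumR => i; exact: (increment_fourth_integrable (s_ge0 n i) (s_lt n i)).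
have i1 : P.-integrable setT (fun=> (N n)^-1%:E) by exact: finite_measure_integrable_cst.
have := integrableZl measurableT (expR L) (integrableD measurableT i1
  (integrableZl measurableT (N n ^+ 3) iT)).
by apply: eq_integrable => // w _ /=; rewrite /V EFinM EFinD EFinM.
Qed.

Let integrable_S n : P.-integrable setT (EFin \o S n).
Proof.
apply: integrable_sumR => i; exact: (weighted_increment_integrable (s_ge0 n i) (s_lt n i)).
Qed.

Let integrable_W n : P.-integrable setT (EFin \o W n).
Proof.
apply: le_integrable (integrable_V n) => //; first exact/measurable_EFinP.
by move=> w _; rewrite /= lee_fin (le_trans (overshoot_bound n w))// ler_norm.
Qed.

Let mean_S n : \int[P]_w S n w = 0.
Proof.
rewrite Rintegral_sum.
  by apply: big1 => i _; exact: (weighted_increment_mean0 (s_ge0 n i) (s_lt n i)).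
by move=> i; exact: (weighted_increment_integrable (s_ge0 n i) (s_lt n i)).
Qed.

(** [1 / N + N ^ 3 * N ^ 6 * 256 * N ^ -10] equals [257 / N]. *)
Let mean_V n : \int[P]_w V n w <= expR L * 257 * n.+1%:R^-1.
Proof.
have iZ i := increment_fourth_integrable (s_ge0 n i) (s_lt n i).
have iT : P.-integrable setT (EFin \o (fun w => \sum_(i < m n) Z n i w ^+ 4)).
  by apply: integrable_sumR => i; exact: iZ.
have i1 : P.-integrable setT (EFin \o (fun=> (N n)^-1)) by exact: finite_measure_integrable_cst.
have i2 : P.-integrable setT (EFin \o (fun w => N n ^+ 3 * \sum_(i < m n) Z n i w ^+ 4)).
  by have := integrableZl measurableT (N n ^+ 3) iT; apply: eq_integrable => // w _ /=; rewrite EFinM.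
rewrite /V RintegralZl//; last first.
  by have := integrableD measurableT i1 i2; apply: eq_integrable => // w _ /=; rewrite EFinD.
rewrite -mulrA ler_wpM2l ?expR_ge0// RintegralD//.
rewrite Rintegral_cst//= probability_setT mulr1 RintegralZl// Rintegral_sum//; last first.
  by move=> i; exact: iZ.
have h : \sum_(i < m n) \int[P]_w Z n i w ^+ 4 <= N n ^+ 6 * (256 * ((N n ^+ 5)^-1) ^+ 2).
  apply: (@le_trans _ _ (\sum_(i < m n) (256 * ((N n ^+ 5)^-1) ^+ 2))).
    apply: ler_sum => i _; rewrite -(s_step n i).
    exact: (increment_fourth_moment (s_ge0 n i) (s_lt n i)).
  by rewrite sumr_const card_ord -[leLHS]mulr_natl /m natrX.
rewrite (le_trans (lerD (lexx _) (ler_wpM2l _ h)))//; first by rewrite exprn_ge0// ltW.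
rewrite -/(N n) le_eqVlt; apply/orP; left; apply/eqP; field.
by rewrite gt_eqF.
Qed.

Let M_bound : exists C, forall n w, `|Q n w| <= C.
Proof.
eexists => n w; apply: stopped_sum_bounded => //.
- exact: (XE w).
- exact: (rbm_range HX w).
- exact: (lt_start Ha).
- exact: (lt_start Hb).
- exact: (lt_nondecreasing Ha).
- exact: (lt_nondecreasing Hb).
- exact: (lt_support Ha).
- exact: (lt_support Hb).
- by move=> i; exact/ltW/s_lt.
Qed.

Let cvg_Q : {ae P, forall w, Q n w @[n --> \oo] --> M (sig w) w}.
Proof.
apply: filterS local_time_unbounded => w /(_ u) unb.
have sigu : local_time (sig w) w = u.
  apply: (inverse_timeK (f := fun t => local_time t w)) => //.
  - exact: local_time0.
  - exact: local_time_nd.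
  - exact: local_time_continuous.
apply/(@cvgrPdist_le _ R^o) => e e0.
have [|||||||||r r0 rP] := @stopped_sum_cvg R a b u rho ab rho0 u0 (X ^~ w) (B ^~ w)
  (ga ^~ w) (gb ^~ w) (XE w) _ _ _ _ _ _ _ (@cga w) (@cgb w) (@cX w)
  (sig w) e (inverse_time_ge0 _ _) _ _ e0.
- exact: (rbm_range HX w).
- exact: (lt_start Ha).
- exact: (lt_start Hb).
- exact: (lt_nondecreasing Ha).
- exact: (lt_nondecreasing Hb).
- exact: (lt_support Ha).
- exact: (lt_support Hb).
- by rewrite -/(local_time _ w) sigu.
- by move=> t; apply: (lt_after_inverse_time (f := fun t => local_time t w)) => //; exact: local_time_nd.
(* The first bound makes the mesh finer than [r]; the second puts the horizon [N] beyond [sig w]. *)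
have c0 : 0 < Num.min r (1 + sig w)^-1.
  by rewrite lt_min r0 invr_gt0 ltr_pwDl// inverse_time_ge0.
have := near_infty_natSinv_lt (PosNum c0); apply: filterS => n /=.
rewrite lt_min => /andP[nr ns]; rewrite distrC; apply: rP.
- exact: s00.
- by move=> i; exact/ltW/s_lt.
- move=> i; rewrite s_step (le_lt_trans _ nr)// lef_pV2 ?posrE ?exprn_gt0//.
  by rewrite -/(N n) -[leLHS]expr1 ler_weXn2l.
- have -> : s n (m n) = N n.
    by rewrite /s /m natrX -/(N n) (exprD _ 1 5) expr1 mulfK// gt_eqF// exprn_gt0.
  have s0 := inverse_time_ge0 (local_time ^~ w) u.
  move: ns; rewrite ltf_pV2 ?posrE//; last by rewrite ltr_pwDl.
  by rewrite -/(sig w) -/(N n); lra.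
Qed.

Let measurable_sig : measurable_fun setT sig.
Proof.
apply: measurable_inverse_time => //.
- by move=> t _; exact: measurable_local_time.
- by move=> w t t'; exact: local_time_nd.
Qed.

Lemma measurable_at_level (Y : R -> {RV P >-> R}) :
  (forall w, continuous (fun t : R => Y (Num.max 0 t) w)) ->
  measurable_fun setT (fun w => Y (sig w) w).
Proof.
move=> cY; apply: (measurable_at_random_time (X := fun t => Y t : Omega -> R)) => //.
- by move=> w t t0; apply: (right_continuous_of_extension (f := fun t => Y t w)).
- by move=> w; exact: inverse_time_ge0.
Qed.

Let measurable_M_sig : measurable_fun setT (fun w => M (sig w) w).
Proof.
have mX := measurable_at_level cX.
have ma := measurable_at_level cga.
have mb := measurable_at_level cgb.
apply: measurable_funM.
  by apply: measurable_funD => //; apply: measurable_funM => //; exact: measurable_funB.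
apply: measurableT_comp => //.
by apply: measurable_funD; exact: measurable_funM.
Qed.

Let measurable_M0 : measurable_fun setT (M 0).
Proof.
apply: measurable_funM; last exact: measurable_weight.
by apply: measurable_funD => //; apply: measurable_funM => //; exact: measurable_funB.
Qed.

Let integrable_M0 : P.-integrable setT (EFin \o M 0).
Proof.
apply: (@bounded_integrable _ _ _ P _ (1 + `|slope a b rho| * (b - a))) => // w.
rewrite /M /exp_martingale /exp_weight (lt_start Ha) (lt_start Hb) !mulr0 addr0 expR0 mulr1.
rewrite /affine_weight (le_trans (ler_normD _ _))// normr1 lerD2l normrM ler_wpM2l//.
have /andP[h1 h2] := rbm_range HX w (lexx 0).
by rewrite ger0_norm; lra.
Qed.

(** The means of [Q n] have two limits: the stopped mean by dominated convergence, and the initial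
    mean because [S n] has mean zero and the mean of [W n] is of order [1 / N]. *)
Lemma exp_martingale_stopped_mean :
  (\int[P]_w (M (sig w) w)%:E = \int[P]_w (M 0 w)%:E)%E.
Proof.
have [C QC] := M_bound.
have mQ n : measurable_fun setT (Q n).
  rewrite (_ : Q n = fun w => M 0 w + slope a b rho * (S n w - W n w)); last first.
    by apply/funext => w; exact: stopped_decomposition.
  by apply: measurable_funD => //; apply: measurable_funM => //; exact: measurable_funB.
have h1 := cvg_bounded_expectation (P := P) mQ measurable_M_sig (aeW _ (fun w n => QC n w)) cvg_Q.
have QE n : \int[P]_w Q n w = \int[P]_w M 0 w - slope a b rho * \int[P]_w W n w.
  under eq_Rintegral do rewrite stopped_decomposition.
  have iSW : P.-integrable setT (EFin \o (fun w => S n w - W n w)).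
    by have := integrableB measurableT (integrable_S n) (integrable_W n);
      apply: eq_integrable => // w _ /=; rewrite EFinB.
  rewrite RintegralD//; last first.
    by have := integrableZl measurableT (slope a b rho) iSW; apply: eq_integrable => // w _ /=; rewrite EFinM.
  by rewrite RintegralZl// RintegralB// mean_S sub0r mulrN.
have h2 : \int[P]_w Q n w @[n --> \oo] --> \int[P]_w M 0 w.
  apply: (@cvg_of_harmonic_bound _ _ _ (`|slope a b rho| * (expR L * 257))) => n.
  rewrite QE addrAC subrr add0r normrN normrM -mulrA ler_wpM2l//.
  apply: le_trans (mean_V n); apply: (le_trans (le_normr_Rintegral _ (integrable_W n))) => //.
  apply: le_Rintegral => //.
  by have := integrable_abse (integrable_W n); apply: eq_integrable => // w _ /=.
have QF n : (\int[P]_w (Q n w)%:E)%E = (\int[P]_w Q n w)%:E.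
  rewrite /Rintegral fineK//; apply: integrable_fin_num => //.
  exact: (bounded_integrable P (mQ n) (QC n)).
have -> : (\int[P]_w (M 0 w)%:E)%E = (\int[P]_w M 0 w)%:E.
  by rewrite /Rintegral fineK//; exact: integrable_fin_num.
apply: (cvg_unique _ h1); first exact: ereal_hausdorff.
rewrite /= (_ : (fun n => _) = EFin \o (fun n => \int[P]_w Q n w)); last exact/funext.
by apply: cvg_EFin; [exact: nearW|exact: h2].
Qed.

(** True for every [w]: if the level is never exceeded, [sig w] is the default 0, where the local
    time vanishes. Hence bounds at [sig] hold everywhere and not only almost surely. *)
Lemma local_time_at_level w : local_time (sig w) w <= u.
Proof.
have [unb|nb] := pselect (exists2 t, 0 <= t & u < local_time t w).
  rewrite (_ : local_time (sig w) w = u)//.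
  apply: (inverse_timeK (f := fun t => local_time t w)) => //.
  - exact: local_time0.
  - exact: local_time_nd.
  - exact: local_time_continuous.
rewrite /sig /inverse_time (_ : [set _ | _] = set0) ?inf0 ?local_time0//.
by rewrite -subset0 => t [t0 ut]; apply: nb; exists t.
Qed.

Lemma exp_martingale_stopped_integrable :
  P.-integrable setT (fun w => (M (sig w) w)%:E).
Proof.
apply: (bounded_integrable P measurable_M_sig
  (C := (1 + `|slope a b rho| * (b - a)) * expR L)) => w.
have /andP[w0 wL] := weight_bound (inverse_time_ge0 _ _) (local_time_at_level w).
rewrite /M /exp_martingale normrM ler_pM// ?(ger0_norm w0)//.
rewrite /affine_weight (le_trans (ler_normD _ _))// normr1 lerD2l normrM ler_wpM2l//.
have /andP[h1 h2] := rbm_range HX w (inverse_time_ge0 (local_time ^~ w) u).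
by rewrite ger0_norm; rewrite /sig; lra.
Qed.

(** At time 0 the exponential is 1, and the affine weight is 1 at [a] and [rho] at [b], each with
    probability one half. *)
Lemma exp_martingale0_mean :
  P [set w | X 0 w = a] = (1 / 2)%:E -> P [set w | X 0 w = b] = (1 / 2)%:E ->
  (\int[P]_w (M 0 w)%:E)%E = ((1 + rho) / 2)%:E.
Proof.
move=> Pa Pb.
have mX y : measurable [set w | X 0 w = y].
  by rewrite (_ : [set _ | _] = X 0 @^-1` [set y]).
have dab : [set w | X 0 w = a] `&` [set w | X 0 w = b] = set0.
  by rewrite -subset0 => w [/= -> abE]; move: ab; rewrite abE ltxx.
pose g w : R := \1_[set w | X 0 w = a] w + rho * \1_[set w | X 0 w = b] w.
transitivity (\int[P]_w (g w)%:E)%E.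
  apply: ae_eq_integral => //.
  - exact/measurable_EFinP.
  - apply/measurable_EFinP; apply: measurable_funD; first exact: measurable_indic.
    by apply: measurable_funM => //; exact: measurable_indic.
  exists (~` ([set w | X 0 w = a] `|` [set w | X 0 w = b])); split.
  - by apply: measurableC; exact: measurableU.
  - have e1 : P ([set w | X 0 w = a] `|` [set w | X 0 w = b]) = 1%E.
      have -> : P ([set w | X 0 w = a] `|` [set w | X 0 w = b]) =
          (P [set w | X 0%R w = a] + P [set w | X 0%R w = b])%E by exact: measureU.
      by rewrite Pa Pb -EFinD; congr EFin; field.
    have : P (~` ([set w | X 0 w = a] `|` [set w | X 0 w = b])) = 0%E.
      by rewrite probability_setC ?e1 ?subee//; exact: measurableU.
    by [].
  - move=> w /= h Xab; apply: h => _; congr EFin.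
    rewrite /M /exp_martingale /exp_weight (lt_start Ha) (lt_start Hb).
    rewrite !mulr0 addr0 expR0 mulr1 /affine_weight /slope /g !indicE.
    have ba : b - a != 0 by rewrite subr_eq0 gt_eqF.
    case: Xab => XE0.
      rewrite mem_set// memNset/= ?XE0 => [|abE]; last by move: ab; rewrite abE ltxx.
      by rewrite subrr !mulr0 addr0.
    rewrite memNset/= ?mem_set//= XE0 ?divfK//; first by ring.
    by move=> abE; move: ab; rewrite abE ltxx.
have i1 : P.-integrable setT (EFin \o (\1_[set w | X 0 w = a] : Omega -> R)).
  by apply: (@bounded_integrable _ _ _ P _ 1) => // w; rewrite indicE; case: (_ \in _); rewrite ?normr1 ?normr0.
have i2 : P.-integrable setT (EFin \o (\1_[set w | X 0 w = b] : Omega -> R)).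
  by apply: (@bounded_integrable _ _ _ P _ 1) => // w; rewrite indicE; case: (_ \in _); rewrite ?normr1 ?normr0.
have i3 := integrableZl measurableT rho i2.
have mE y : (\int[P]_w ((\1_[set w | X 0 w = y] : Omega -> R) w)%:E)%E =
    P [set w | X 0 w = y].
  by rewrite integral_indic// setIT.
transitivity ((\int[P]_w ((\1_[set w | X 0 w = a] : Omega -> R) w)%:E) +
    rho%:E * \int[P]_w ((\1_[set w | X 0 w = b] : Omega -> R) w)%:E)%E.
  by rewrite -(integralZl measurableT i2) -(integralD measurableT i1 i3).
by rewrite !mE Pa Pb -EFinM -EFinD; congr EFin; field.
Qed.

End level.

Definition signed_local_time (u : R) (w : Omega) : R :=
  ga (inverse_time (local_time ^~ w) u) w - gb (inverse_time (local_time ^~ w) u) w.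

Lemma measurable_signed_local_time u : measurable_fun setT (signed_local_time u).
Proof. by apply: measurable_funB; apply: measurable_at_level => //. Qed.

Lemma signed_local_time_bound u w : 0 <= u -> `|signed_local_time u w| <= u.
Proof.
move=> u0; have := local_time_at_level u0 w; rewrite /signed_local_time /local_time.
have t0 := inverse_time_ge0 (local_time ^~ w) u.
have := lt_nondecreasing Ha w (lexx 0) t0; have := lt_nondecreasing Hb w (lexx 0) t0.
rewrite (lt_start Ha) (lt_start Hb) /local_time => *.
by rewrite ler_norml; apply/andP; split; lra.
Qed.

(* The parameters [rho] and [- rho^-1] give two exponential martingales with the same
   weight [exp(- beta (ga - gb))]; their combination cancels the dependence on [X]. *)
Lemma signed_local_time_transform (u rho : R) : 0 <= u -> 0 < rho ->
  P [set w | X 0 w = a] = (1 / 2)%:E -> P [set w | X 0 w = b] = (1 / 2)%:E ->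
  (\int[P]_w (expR (- ((rho - rho^-1) / (2 * (b - a)) * signed_local_time u w)))%:E)%E =
  (telegraph_transform (b - a) rho u)%:E.
Proof.
move=> u0 rho0 Pa Pb.
have r0 : rho != 0 by rewrite gt_eqF.
have r0' : - rho^-1 != 0 by rewrite oppr_eq0 invr_eq0.
have ba : b - a != 0 by rewrite subr_eq0 gt_eqF.
have r1 : rho ^+ 2 + 1 != 0 by rewrite gt_eqF// ltr_wpDl ?sqr_ge0.
pose sg w := inverse_time (local_time ^~ w) u.
pose Mr r w := exp_martingale a b r (X ^~ w) (ga ^~ w) (gb ^~ w) (sg w).
(* The weight solving [x (rho - 1) + (1 - x) (- 1 / rho - 1) = 0], so that the two slopes cancel and
   the combined affine function is constantly 1. *)
pose x := (rho + 1) / (rho ^+ 2 + 1).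
pose c1 := x * expR (- ((2 - rho - rho^-1) / (2 * (b - a)) * u)).
pose c2 := (1 - x) * expR (- ((2 + rho + rho^-1) / (2 * (b - a)) * u)).
have I1 := exp_martingale_stopped_integrable rho u0.
have I2 := exp_martingale_stopped_integrable (- rho^-1) u0.
have E1 : (\int[P]_w (Mr rho w)%:E)%E = ((1 + rho) / 2)%:E.
  exact: (etrans (exp_martingale_stopped_mean u0 r0) (exp_martingale0_mean rho Pa Pb)).
have E2 : (\int[P]_w (Mr (- rho^-1) w)%:E)%E = ((1 - rho^-1) / 2)%:E.
  exact: (etrans (exp_martingale_stopped_mean u0 r0') (exp_martingale0_mean (- rho^-1) Pa Pb)).
transitivity (\int[P]_w (c1%:E * (Mr rho w)%:E + c2%:E * (Mr (- rho^-1) w)%:E))%E.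
  apply: ae_eq_integral => //.
  - apply/measurable_EFinP; apply: measurableT_comp => //; apply: measurableT_comp => //.
    by apply: measurable_funM => //; exact: measurable_signed_local_time.
  - by apply: emeasurable_funD; apply: emeasurable_funM => //; [exact: measurable_int I1|exact: measurable_int I2].
  apply: filterS local_time_unbounded => w /(_ u) unb _.
  have sgu : ga (sg w) w + gb (sg w) w = u.
    apply: (inverse_timeK (f := fun t => local_time t w)) => //.
    - exact: local_time0.
    - exact: local_time_nd.
    - exact: local_time_continuous.
  rewrite -!EFinM -EFinD; congr EFin.
  rewrite /signed_local_time -/(sg w) /Mr /exp_martingale /exp_weight /c1 /c2.
  set ya := ga (sg w) w in sgu *; set yb := gb (sg w) w in sgu *; set y := X (sg w) w.
  (* Since [ya + yb = u], the exponent splits along [ya + yb] and [ya - yb]. The half-sum of the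
     rates is the constant cancelled by [c1], and the half-difference is [- beta]; the same happens
     below for [- rho^-1] and [c2]. *)
  have -> : x * expR (- ((2 - rho - rho^-1) / (2 * (b - a)) * u)) *
      (affine_weight a b rho y * expR (rate_a a b rho * ya + rate_b a b rho * yb)) =
      x * affine_weight a b rho y * expR (- ((rho - rho^-1) / (2 * (b - a)) * (ya - yb))).
    rewrite mulrACA -expRD; congr (_ * expR _).
    by rewrite -sgu /rate_a /rate_b /slope; field; rewrite ba.
  have -> : (1 - x) * expR (- ((2 + rho + rho^-1) / (2 * (b - a)) * u)) *
      (affine_weight a b (- rho^-1) y *
        expR (rate_a a b (- rho^-1) * ya + rate_b a b (- rho^-1) * yb)) =
      (1 - x) * affine_weight a b (- rho^-1) y *
        expR (- ((rho - rho^-1) / (2 * (b - a)) * (ya - yb))).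
    rewrite mulrACA -expRD; congr (_ * expR _).
    by rewrite -sgu /rate_a /rate_b /slope; field; rewrite ba r0.
  rewrite -mulrDl -[LHS]mul1r; congr (_ * _).
  by rewrite /affine_weight /slope /x; field; rewrite r0 ba r1.
rewrite integralD//; [|exact: integrableZl|exact: integrableZl].
rewrite !integralZl// E1 E2 -!EFinM -EFinD; congr EFin.
rewrite /c1 /c2 /telegraph_transform /x; set e1 := expR _; set e2 := expR _.
by field; rewrite r0 r1.
Qed.

End reflected_brownian_motion.

(** * Time change by an independent subordinator *)

Section time_change.
Context (R : realType).
Variables (g H : R -> R) (t : R).
Hypotheses (g0 : g 0 = 0).
Hypothesis ndg : forall s s' : R, 0 <= s -> s <= s' -> g s <= g s'.
Hypothesis cg : continuous (fun s : R => g (Num.max 0 s)).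
Hypothesis unbg : forall K, exists2 s, 0 <= s & K < g s.
Hypothesis ndH : forall s s' : R, 0 <= s -> s <= s' -> H s <= H s'.
Hypothesis unbH : exists2 s, 0 <= s & t < H s.

(** [H] may jump over [t], so [H \o g] need not take the value [t]. But exceeding [t] lies between
    [g > L] and [g >= L] ([gtL] and [leL]), and continuity of [g] forces the value [L] at the first
    such time. *)
Lemma inverse_time_comp : g (inverse_time (H \o g) t) = inverse_time H t.
Proof.
set L := inverse_time H t; set tau := inverse_time _ t.
have L0 : 0 <= L := inverse_time_ge0 _ _.
have tau0 : 0 <= tau := inverse_time_ge0 _ _.
have gge0 s : 0 <= s -> 0 <= g s by move=> s0; rewrite -g0 ndg.
have gtL s : L < g s -> t < H (g s).
  by apply: lt_after_inverse_time => //; exact: ndH.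
have leL s : 0 <= s -> t < H (g s) -> L <= g s.
  by move=> s0; apply: inverse_time_le; exact: gge0.
have unb : exists2 s, 0 <= s & t < (H \o g) s.
  by have [s s0 Ls] := unbg L; exists s => //; exact: gtL.
apply/eqP; rewrite eq_le; apply/andP; split; rewrite leNgt; apply/negP => h.
- have e0 : 0 < g tau - L by rewrite subr_gt0.
  have taup : 0 < tau.
    rewrite lt_neqAle tau0 andbT; apply/eqP => tauE.
    by move: h; rewrite -tauE g0 ltNge L0.
  have := @cg tau => /(@cvgrPdist_lt _ R^o)/(_ _ e0)[r /= r0 rP].
  pose v := Num.max 0 (tau - r / 2).
  have v0 : 0 <= v by rewrite le_max lexx.
  have vs : v < tau by rewrite gt_max taup ltrBlDr ltrDl divr_gt0.
  have /rP/= : `|tau - v| < r.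
    rewrite ger0_norm ?subr_ge0 ?(ltW vs)//.
    have : tau - r / 2 <= v by rewrite le_max lexx orbT.
    lra.
  rewrite !max_r// ger0_norm ?subr_ge0 ?ndg ?(ltW vs)// => h2.
  have Lv : L < g v by lra.
  by have := inverse_time_le (f := H \o g) v0 (gtL _ Lv); rewrite -/tau leNgt vs.
- have e0 : 0 < L - g tau by rewrite subr_gt0.
  have := @cg tau => /(@cvgrPdist_lt _ R^o)/(_ _ e0)[r /= r0 rP].
  have sv : tau < tau + r by rewrite ltrDl.
  have [v [v0 vr tv]] := inverse_time_lt unb sv.
  have tauv : tau <= v by exact: inverse_time_le.
  have /rP/= : `|tau - v| < r.
    by rewrite distrC ger0_norm ?subr_ge0//; lra.
  rewrite !max_r// distrC ger0_norm ?subr_ge0 ?ndg// => h2.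
  by have := leL _ v0 tv; lra.
Qed.

End time_change.

(** * The inverse of the stable subordinator *)

Section subordinator.
Context (R : realType) (alpha : R) (d : measure_display) (Omega : measurableType d).
Variable P : probability Omega R.
Variable H : R -> {RV P >-> R}.
Hypothesis HS : stable_subordinator alpha H.

Lemma subordinator_ge0 s w : 0 <= s -> 0 <= H s w.
Proof. by move=> s0; rewrite -(sub_start HS w) (sub_nondecreasing HS). Qed.

Lemma subordinator_laplace (s l : R) : 0 <= s -> 0 < l ->
  (\int[P]_w (expR (- (l * H s w)))%:E = (expR (- s * l `^ alpha))%:E)%E.
Proof.
move=> s0 l0; rewrite -(sub_laplace HS s0 l0) unlock.
by apply: eq_integral => w _; rewrite mulNr.
Qed.

(** A Chernoff bound with parameter 1: [H n <= K] has probability at most [exp(K) exp(- n)]. *)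
Lemma subordinator_unbounded : {ae P, forall w, forall K : R, exists2 s, 0 <= s & K < H s w}.
Proof.
have h : {ae P, forall w, forall K : nat, exists2 s, 0 <= s & K%:R < H s w}.
  apply: ae_foralln => K; pose A n := H n%:R @^-1` `]-oo, K%:R].
  have mA n : measurable (A n) by exact: measurable_funPTI.
  have PA n : (P (A n) <= (expR K%:R * expR (- 1) ^+ n)%:E)%E.
    have -> : (expR K%:R * expR (- 1) ^+ n)%:E =
        (\int[P]_w ((expR K%:R)%:E * (expR (- (1 * H n%:R w)))%:E))%E.
      rewrite ge0_integralZl ?lee_fin ?expR_ge0//; last first.
        apply/measurable_EFinP; apply: measurableT_comp => //.
        by apply: measurableT_comp => //; exact: measurable_funM.
      by rewrite subordinator_laplace// powR1 mulr1 -EFinM -expRM_natl mulrN1.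
    rewrite -[A n]setIT -integral_indic//; apply: ge0_le_integral => //.
    - by apply/measurable_EFinP; exact: measurable_indic.
    - apply: emeasurable_funM => //; apply/measurable_EFinP; apply: measurableT_comp => //.
      by apply: measurableT_comp => //; exact: measurable_funM.
    move=> w _; rewrite -EFinM lee_fin -expRD indicE mul1r.
    case: (boolP (w \in A n)) => [/set_mem|_]; last exact: expR_ge0.
    rewrite /A/= in_itv/= => HK.
    by rewrite -[leLHS]expR0 ler_expR subr_ge0.
  exists (\bigcap_i A i); split.
  - exact: bigcap_measurableType.
  - apply/eqP; rewrite eq_le measure_ge0 andbT.
    have c : (expR K%:R * expR (- 1) ^+ n)%:E @[n --> \oo] --> (0 : \bar R).
      apply: cvg_EFin; first exact: nearW.
      rewrite -[0](mulr0 (expR K%:R)); apply: cvgM; first exact: cvg_cst.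
      by apply: cvg_expr; rewrite ger0_norm ?expR_ge0// -expR0 ltr_expR ltrN10.
    rewrite -(cvg_lim _ c)//; apply: lime_ge; first exact: cvgP c.
    apply: nearW => n; apply: le_trans (PA n).
    apply: le_measure; rewrite ?inE//; first exact: bigcap_measurableType.
    by move=> w; exact.
  - move=> w /= hw i _; rewrite /A/= in_itv/= leNgt; apply/negP => Ke.
    by apply: hw; exists i%:R.
apply: filterS h => w h K; have [s s0 hs] := h (Num.truncn `|K|).+1; exists s => //.
rewrite (le_lt_trans (ler_norm K))// (lt_trans _ hs)//.
by have /andP[] := truncn_itv (normr_ge0 K).
Qed.

Let L t w := inverse_time (H ^~ w) t.

Lemma measurable_inverse_subordinator t : measurable_fun setT (L t).
Proof.
apply: (measurable_inverse_time (V := fun s => H s : Omega -> R)) => //.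
by move=> w s s'; exact: (sub_nondecreasing HS).
Qed.

Lemma sigma_inverse_subordinator t : sigma_rv (L t) `<=` sigma_process H.
Proof.
have e : <<s sigma_process H >> = sigma_process H.
  by apply: sigma_algebra_id; exact: sigma_family_sigma_algebra.
rewrite -e; apply: measurable_fun_sigma_rv.
apply: (@measurable_inverse_time _ _ (g_sigma_algebraType (sigma_process H)) (fun s => H s)) => //.
  move=> s s0; apply: adapted_measurable_fun => A hA; apply: sub_sigma_algebra.
  by apply: sub_sigma_algebra; exists s.
by move=> w s s'; exact: (sub_nondecreasing HS).
Qed.

(** This reduces the law of the inverse to one-dimensional laws of [H]. The two events agree only
    almost surely, because the inverse is 0 by default when [t] is never exceeded; the times beyond
    [s] turn the strict inequality into an increasing union. *)
Lemma inverse_subordinator_gt t s : 0 <= s ->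
  P [set w | s < L t w] = P (\bigcup_n [set w | H (s + n.+1%:R^-1) w <= t]).
Proof.
move=> s0; have m1 : measurable [set w | s < L t w].
  by apply: measurable_gt_ray; exact: measurable_inverse_subordinator.
have mle (v : R) : measurable [set w | H v w <= t].
  have -> : [set w | H v w <= t] = ~` [set w | t < H v w].
    by apply/seteqP; split => w /=; rewrite leNgt => /negP.
  by apply: measurableC; exact: measurable_gt_ray.
have m2 : measurable (\bigcup_n [set w | H (s + n.+1%:R^-1) w <= t]).
  by apply: bigcup_measurable.
rewrite -[X in P X = _]setIT -[X in _ = P X]setIT -!integral_indic//.
apply: ae_eq_integral => //; try by apply/measurable_EFinP; exact: measurable_indic.
apply: filterS subordinator_unbounded => w unb _; rewrite !indicE; congr (_%:R)%:E.
have [u u0 tu] := unb t.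
have sv n : 0 <= s + n.+1%:R^-1 by rewrite addr_ge0// invr_ge0.
congr nat_of_bool; apply/idP/idP => /set_mem/= h; apply/mem_set.
  have e0 : 0 < L t w - s by rewrite subr_gt0.
  have [N _ /(_ N)/=] := near_infty_natSinv_lt (PosNum e0).
  move=> /(_ (leqnn _)) hN; exists N => //=; rewrite leNgt; apply/negP => /(inverse_time_le (f := H ^~ w) (sv N)).
  by rewrite leNgt -/(L t w) -ltrBrDl hN.
case: h => n _ /= h; rewrite ltNge; apply/negP => Ls.
have : L t w < s + n.+1%:R^-1 by rewrite (le_lt_trans Ls)// ltrDl invr_gt0.
have nd : forall a b : R, 0 <= a -> a <= b -> H a w <= H b w by exact: (sub_nondecreasing HS).
move=> /(lt_after_inverse_time nd (ex_intro2 _ _ u u0 tu)).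
by rewrite ltNge h.
Qed.

End subordinator.

Section subordinator_law.
Context (R : realType) (alpha : R).
Context d1 (T1 : measurableType d1) (P1 : probability T1 R) (H1 : R -> {RV P1 >-> R}).
Context d2 (T2 : measurableType d2) (P2 : probability T2 R) (H2 : R -> {RV P2 >-> R}).
Hypotheses (HS1 : stable_subordinator alpha H1) (HS2 : stable_subordinator alpha H2).

Lemma subordinator_eq_in_law s : 0 <= s -> eq_in_law P1 P2 (H1 s) (H2 s).
Proof.
move=> s0; apply: eq_in_law_of_laplace => //.
- by move=> w; exact: (subordinator_ge0 HS1).
- by move=> w; exact: (subordinator_ge0 HS2).
- by move=> l l0; rewrite (subordinator_laplace HS1)// (subordinator_laplace HS2).
Qed.

Lemma inverse_subordinator_eq_in_law t :
  eq_in_law P1 P2 (fun w => inverse_time (H1 ^~ w) t) (fun w => inverse_time (H2 ^~ w) t).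
Proof.
apply: eq_in_law_of_rays; try exact: measurable_inverse_subordinator.
- exact: (measurable_inverse_subordinator HS1).
- exact: (measurable_inverse_subordinator HS2).
move=> s; have [s0|s0] := leP 0 s; last first.
  have e T (f : T -> R -> R) : [set w | s < inverse_time (f w) t] = setT.
    by apply/seteqP; split => // w _ /=; exact: lt_le_trans s0 (inverse_time_ge0 _ _).
  by rewrite !e (probability_setT P1) (probability_setT P2).
rewrite (inverse_subordinator_gt HS1)// (inverse_subordinator_gt HS2)//.
have sv n : 0 <= s + n.+1%:R^-1 by rewrite addr_ge0// invr_ge0.
have cvg d (T : measurableType d) (P : probability T R) (H : R -> {RV P >-> R}) :
    stable_subordinator alpha H ->
    P (H (s + n.+1%:R^-1) @^-1` `]-oo, t]) @[n --> \oo] -->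
    P (\bigcup_n [set w | H (s + n.+1%:R^-1) w <= t]).
  move=> HS.
  have e n : [set w | H (s + n.+1%:R^-1) w <= t] = H (s + n.+1%:R^-1) @^-1` `]-oo, t].
    by apply/seteqP; split => w /=; rewrite in_itv.
  rewrite (eq_bigcupr (fun n _ => e n)).
  apply: nondecreasing_cvg_mu.
  - by move=> n; exact: measurable_funPTI.
  - by apply: bigcup_measurable => n _; exact: measurable_funPTI.
  - move=> n m nm; apply/subsetPset => w /=; rewrite !in_itv/=; apply: le_trans.
    by apply: (sub_nondecreasing HS) => //; rewrite lerD2l lef_pV2 ?posrE// ler_nat.
apply: (cvg_unique _ (cvg _ _ _ _ HS1)); first exact: ereal_hausdorff.
have -> : (fun n => P1 (H1 (s + n.+1%:R^-1) @^-1` `]-oo, t])) =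
    (fun n => P2 (H2 (s + n.+1%:R^-1) @^-1` `]-oo, t])).
  by apply/funext => n; have [_ _] := subordinator_eq_in_law (sv n); apply.
exact: cvg.
Qed.

End subordinator_law.

(** * A process evaluated at an independent random level *)

Section mixture.
Context (R : realType) d (Omega : measurableType d) (P : probability Omega R).
Variables (G : set_system Omega) (f : R -> Omega -> R) (L : Omega -> R).
Hypothesis Gm : <<s G >> `<=` measurable.
Hypothesis mf : measurable_fun setT
  (fun x : R * g_sigma_algebraType G => f x.1 x.2).
Hypothesis mL : measurable_fun setT L.
Hypothesis GL : independent P <<s G >> (sigma_rv L).
Variable A : set R.
Hypothesis mA : measurable A.

Let mid : measurable_fun setT (id : Omega -> g_sigma_algebraType G).
Proof. by move=> _ B mB; rewrite setTI; exact: Gm. Qed.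

Let mfA : measurable_fun setT (fun x : R * g_sigma_algebraType G => (\1_A (f x.1 x.2) : R)%:E).
Proof.
by apply/measurable_EFinP; apply: measurableT_comp; [exact: measurable_indic|exact: mf].
Qed.

Let mfu u : measurable_fun setT (f u).
Proof.
have m1 : measurable_fun setT (fun w : Omega => (u, w : g_sigma_algebraType G)).
  by apply: measurable_fun_pair.
exact: measurableT_comp mf m1.
Qed.

Let section_integral u : (\int[P]_w (\1_A (f u w) : R)%:E = P (f u @^-1` A))%E.
Proof.
rewrite -[RHS](_ : \int[P]_w (\1_(f u @^-1` A) w)%:E = _)%E; first by [].
rewrite integral_indic ?setIT//.
by rewrite -[X in measurable X]setTI; exact: mfu.
Qed.

Lemma measurable_section_prob : measurable_fun setT (fun u => P (f u @^-1` A)).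
Proof.
have h : measurable_fun setT (fun x : R * Omega => (\1_A (f x.1 x.2) : R)%:E).
  have m1 : measurable_fun setT (fun x : R * Omega => (x.1, x.2 : g_sigma_algebraType G)).
    by apply: measurable_fun_pair; [exact: measurable_fst|exact: (measurableT_comp mid measurable_snd)].
  exact: measurableT_comp mfA m1.
rewrite (_ : (fun u => _) = fun u => (\int[P]_w (\1_A (f u w) : R)%:E)%E).
  have h0 (x : R * Omega) : (0 <= (\1_A (f x.1 x.2) : R)%:E)%E by rewrite lee_fin.
  exact: (@measurable_fun_fubini_tonelli_F _ _ _ Omega R P
    (fun x : R * Omega => (\1_A (f x.1 x.2) : R)%:E) h h0).
by apply/funext => u; rewrite section_integral.
Qed.

(** The identity into [Omega] equipped with [G] plays the role of the whole random path.
    Independence of [L] from [G] then becomes independence of two random variables, and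
    [independent_fubini] freezes the level. *)
Lemma mixture_prob : P [set w | A (f (L w) w)] = (\int[P]_w P (f (L w) @^-1` A))%E.
Proof.
have m1 : measurable_fun setT (fun w : Omega => (L w, w : g_sigma_algebraType G)).
  by apply: measurable_fun_pair.
have mfL : measurable_fun setT (fun w => f (L w) w) by exact: measurableT_comp mf m1.
transitivity (\int[P]_w (\1_A (f (L w) w) : R)%:E)%E.
  rewrite -[RHS](_ : \int[P]_w (\1_((fun w => f (L w) w) @^-1` A) w)%:E = _)%E; last by [].
  rewrite integral_indic ?setIT//.
  by rewrite -[X in measurable X]setTI; exact: mfL.
rewrite (independent_fubini (f := fun x : R * g_sigma_algebraType G => (\1_A (f x.1 x.2) : R)%:E) mL mid)//.
- by apply: eq_integral => w _ /=; rewrite section_integral.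
- move=> B C mB mC; rewrite setIC GL 1?muleC//.
  by exists B => //; rewrite setTI.
Qed.

End mixture.

(** Once the independent level is frozen, only the laws at each fixed level enter; joint laws of the
    processes at several levels never have to be compared. *)
Lemma mixture_eq_prob (R : realType)
  d1 (T1 : measurableType d1) (P1 : probability T1 R) (G1 : set_system T1)
  (f1 : R -> T1 -> R) (L1 : T1 -> R)
  d2 (T2 : measurableType d2) (P2 : probability T2 R) (G2 : set_system T2)
  (f2 : R -> T2 -> R) (L2 : T2 -> R) (A : set R) :
  <<s G1 >> `<=` measurable -> <<s G2 >> `<=` measurable ->
  measurable_fun setT (fun x : R * g_sigma_algebraType G1 => f1 x.1 x.2) ->
  measurable_fun setT (fun x : R * g_sigma_algebraType G2 => f2 x.1 x.2) ->
  independent P1 <<s G1 >> (sigma_rv L1) -> independent P2 <<s G2 >> (sigma_rv L2) ->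
  eq_in_law P1 P2 L1 L2 -> (forall w, 0 <= L1 w) ->
  (forall u, 0 <= u -> P1 (f1 u @^-1` A) = P2 (f2 u @^-1` A)) -> measurable A ->
  P1 [set w | A (f1 (L1 w) w)] = P2 [set w | A (f2 (L2 w) w)].
Proof.
move=> Gm1 Gm2 mf1 mf2 GL1 GL2 [mL1 mL2 LE] L0 fE mA.
rewrite (mixture_prob Gm1 mf1 mL1 GL1 mA) (mixture_prob Gm2 mf2 mL2 GL2 mA).
transitivity (\int[P1]_w P2 (f2 (L1 w) @^-1` A))%E.
  by apply: eq_integral => w _; rewrite fE.
pose V1 : {mfun T1 >-> R} := mfun_Sub (mem_set mL1).
pose V2 : {mfun T2 >-> R} := mfun_Sub (mem_set mL2).
pose phi u := P2 (f2 u @^-1` A).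
have mphi : measurable_fun setT phi := measurable_section_prob P2 Gm2 mf2 mA.
have phi0 u : (0 <= phi u)%E by exact: measure_ge0.
have e1 := ge0_integral_distribution V1 mphi phi0.
have e2 := ge0_integral_distribution V2 mphi phi0.
rewrite -[LHS]e1 -[RHS]e2.
by apply: eq_measure_integral => B mB _; exact: LE.
Qed.

Section clamp.
Context (R : realType).

(** Turns an almost sure bound into a pointwise one, as the characterization by Laplace transforms
    asks for variables nonnegative everywhere. *)
Definition clamp (u x : R) : R := Num.max (- u) (Num.min u x).

Lemma clamp_id u x : `|x| <= u -> clamp u x = x.
Proof. by rewrite ler_norml /clamp => /andP[h1 h2]; rewrite min_r// max_r. Qed.

Lemma clamp_ge u x : 0 <= clamp u x + u.
Proof. by rewrite -lerBlDr sub0r /clamp le_max lexx. Qed.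

Lemma measurable_clamp d (T : measurableType d) u (f : T -> R) :
  measurable_fun setT f -> measurable_fun setT (fun x => clamp u (f x)).
Proof. by move=> mf; apply: measurable_maxr => //; exact: measurable_minr. Qed.

End clamp.

Lemma ae_eq_prob (R : realType) d (T : measurableType d) (P : probability T R) (f g : T -> R)
  (A : set R) : measurable_fun setT f -> measurable_fun setT g -> measurable A ->
  {ae P, forall w, f w = g w} -> P (f @^-1` A) = P (g @^-1` A).
Proof.
move=> mf mg mA fg.
have m1 : measurable (f @^-1` A) by rewrite -[X in measurable X]setTI; exact: mf.
have m2 : measurable (g @^-1` A) by rewrite -[X in measurable X]setTI; exact: mg.
rewrite -[X in P X = _]setIT -[X in _ = P X]setIT -!integral_indic//.
apply: ae_eq_integral => //; try by apply/measurable_EFinP; exact: measurable_indic.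
apply: filterS fg => w fgw _; rewrite !indicE; congr (_ (_ : bool))%:R%:E.
by apply/idP/idP => /set_mem/= h; apply/mem_set; rewrite /= ?fgw// -fgw.
Qed.

(* A bounded variable is shifted to a nonnegative one, whose law is determined by
   its Laplace transform. *)
Lemma bounded_eq_in_law (R : realType)
  d1 (T1 : measurableType d1) (P1 : probability T1 R) (f : T1 -> R)
  d2 (T2 : measurableType d2) (P2 : probability T2 R) (g : T2 -> R) (u : R) (A : set R) :
  measurable_fun setT f -> measurable_fun setT g ->
  {ae P1, forall w, `|f w| <= u} -> {ae P2, forall w, `|g w| <= u} ->
  (forall l, 0 < l -> (\int[P1]_w (expR (- (l * f w)))%:E =
                       \int[P2]_w (expR (- (l * g w)))%:E)%E) ->
  measurable A -> P1 (f @^-1` A) = P2 (g @^-1` A).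
Proof.
move=> mf mg fu gu h mA.
have clampE d (T : measurableType d) (P : probability T R) (k : T -> R) :
    measurable_fun setT k -> {ae P, forall w, `|k w| <= u} ->
    P (k @^-1` A) = P ((fun w => clamp u (k w) + u) @^-1` ((fun x => x - u) @^-1` A)) /\
    (forall l, \int[P]_w (expR (- (l * (clamp u (k w) + u))))%:E =
      (expR (- (l * u)))%:E * \int[P]_w (expR (- (l * k w)))%:E)%E.
  move=> mk ku; have mc := measurable_clamp u mk.
  have kE : {ae P, forall w, k w = clamp u (k w)}.
    by apply: filterS ku => w kw; rewrite clamp_id.
  split.
    rewrite (ae_eq_prob mk mc mA kE); congr (P _).
    by apply/seteqP; split => w /=; rewrite addrK.
  have mexp l (k' : T -> R) : measurable_fun setT k' ->
      measurable_fun setT (fun w => (expR (- (l * k' w)))%:E).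
    move=> mk'; apply/measurable_EFinP; apply: measurableT_comp => //.
    by apply: measurableT_comp => //; exact: measurable_funM.
  move=> l; rewrite -ge0_integralZl ?lee_fin ?expR_ge0//; last exact: mexp.
  apply: ae_eq_integral => //.
  - by apply: mexp; exact: measurable_funD.
  - by apply: emeasurable_funM => //; exact: mexp.
  - apply: filterS kE => w kw _; rewrite -kw -EFinM -expRD; congr (expR _)%:E; ring.
have [-> e1] := clampE _ _ P1 f mf fu; have [-> e2] := clampE _ _ P2 g mg gu.
have [_ _ ] : eq_in_law P1 P2 (fun w => clamp u (f w) + u) (fun w => clamp u (g w) + u).
  apply: eq_in_law_of_laplace.
  - by apply: measurable_funD => //; exact: measurable_clamp.
  - by apply: measurable_funD => //; exact: measurable_clamp.
  - by move=> w; exact: clamp_ge.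
  - by move=> w; exact: clamp_ge.
  - by move=> l l0; rewrite e1 e2 h.
apply; rewrite -[X in measurable X]setTI.
have ms : measurable_fun setT (fun x : R => x - u) by exact: measurable_funB.
exact: ms.
Qed.

Section reflected_brownian_motion_mixture.
Context (R : realType) (d : measure_display) (Omega : measurableType d).
Variables (P : probability Omega R) (a b : R) (X B ga gb : R -> {RV P >-> R}).
Hypothesis ab : a < b.
Hypothesis HX : reflected_brownian_motion a b X B ga gb.
Let Ha := rbm_local_a HX.
Let Hb := rbm_local_b HX.
Let F := completed P (sigma_process X).

Let cg x (g : R -> {RV P >-> R}) : boundary_local_time X x g ->
  forall w, continuous (fun s : R => g (Num.max 0 s) w).
Proof.
by move=> Hg w; apply: (@continuous_extension R (fun t => g t w)); exact: (lt_continuous Hg).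
Qed.

Lemma sigma_completed_process : <<s F >> = completed P (sigma_process X).
Proof.
apply: sigma_algebra_id; apply: completed_sigma_algebra.
  exact: sigma_family_sigma_algebra.
exact: sigma_family_measurable.
Qed.

Let mg x (g : R -> {RV P >-> R}) : boundary_local_time X x g ->
  forall s, 0 <= s -> measurable_fun setT (fun z : R * g_sigma_algebraType F => g s z.2).
Proof.
move=> Hg s s0.
have m : measurable_fun setT (g s : g_sigma_algebraType F -> R).
  apply: adapted_measurable_fun => A hA; apply: sub_sigma_algebra.
  have := lt_adapted Hg s0 hA; apply: completedS.
  by apply: sigma_family_subset => v /= /andP[].
exact: (measurableT_comp m measurable_snd).
Qed.

(** Measurability is relative to the completed sigma-algebra of [X], the one to which the local
    times are adapted. Treating the level as a coordinate reduces the claim to the lemmas on inverse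
    times and random times. *)
Lemma joint_measurable_signed_local_time :
  measurable_fun setT (fun z : R * g_sigma_algebraType F => signed_local_time ga gb z.1 z.2).
Proof.
pose tau (z : R * g_sigma_algebraType F) := inverse_time (local_time ga gb ^~ z.2) z.1.
have mtau : measurable_fun setT tau.
  apply: (measurable_inverse_time
    (V := fun s (z : R * g_sigma_algebraType F) => local_time ga gb s z.2)
    (t := fst)) => //.
  - by move=> s s0; apply: measurable_funD; [exact: mg Ha _ _|exact: mg Hb _ _].
  - by move=> z s s'; exact: (local_time_nd HX).
have m x (g : R -> {RV P >-> R}) : boundary_local_time X x g ->
    measurable_fun setT (fun z => g (tau z) z.2).
  move=> Hg; apply: (measurable_at_random_time
    (X := fun s (z : R * g_sigma_algebraType F) => g s z.2) (tau := tau)) => //.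
  - exact: mg Hg.
  - move=> z s s0; apply: (right_continuous_of_extension (f := fun t => g t z.2)) => //.
    exact: cg Hg _.
  - by move=> z; exact: inverse_time_ge0.
by apply: measurable_funB; [exact: m Ha|exact: m Hb].
Qed.

Variables (alpha : R) (H : R -> {RV P >-> R}) (t : R).
Hypothesis HS : stable_subordinator alpha H.

Let V s w := H (local_time ga gb s w) w.
Let tau w := inverse_time (V ^~ w) t.

Let measurable_tau : measurable_fun setT tau.
Proof.
apply: (measurable_inverse_time (V := V)) => //.
- move=> s s0; apply: (measurable_at_random_time (X := fun s => H s : Omega -> R)) => //.
  + by move=> w v v0; exact: (sub_right_continuous HS).
  + by move=> w; exact: (local_time_ge0 HX).
  + exact: measurable_local_time.
- move=> w s s' s0 ss'; apply: (sub_nondecreasing HS); first exact: (local_time_ge0 HX).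
  exact: (local_time_nd HX).
Qed.

Lemma measurable_time_changed_local_difference :
  measurable_fun setT (time_changed_local_difference ga gb H t).
Proof.
have m x (g : R -> {RV P >-> R}) : boundary_local_time X x g ->
    measurable_fun setT (fun w => g (tau w) w).
  move=> Hg; apply: (measurable_at_random_time (X := fun s => g s : Omega -> R)) => //.
  - move=> w s s0; apply: (right_continuous_of_extension (f := fun t => g t w)) => //.
    exact: cg Hg _.
  - by move=> w; exact: inverse_time_ge0.
by apply: measurable_funB; [exact: m Ha|exact: m Hb].
Qed.

(* [ga] and [gb] are nondecreasing, so each of them is a function of [ga + gb]. *)
Lemma time_changed_local_differenceE :
  {ae P, forall w, time_changed_local_difference ga gb H t w =
     signed_local_time ga gb (inverse_time (H ^~ w) t) w}.
Proof.
apply: filterS2 (local_time_unbounded ab HX) (subordinator_unbounded HS) => w unbg unbH.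
pose L := inverse_time (H ^~ w) t.
have L0 : 0 <= L := inverse_time_ge0 _ _.
have nd : forall s s' : R, 0 <= s -> s <= s' -> local_time ga gb s w <= local_time ga gb s' w.
  by move=> s s'; exact: (local_time_nd HX).
have e1 : local_time ga gb (tau w) w = L.
  apply: (@inverse_time_comp R (local_time ga gb ^~ w) (H ^~ w)) => //.
  - exact: (local_time0 HX).
  - exact: (local_time_continuous HX).
  - by move=> s s'; exact: (sub_nondecreasing HS).
have e2 : local_time ga gb (inverse_time (local_time ga gb ^~ w) L) w = L.
  apply: (@inverse_timeK R (local_time ga gb ^~ w)) => //.
  - exact: (local_time0 HX).
  - exact: (local_time_continuous HX).
rewrite /time_changed_local_difference /signed_local_time -/L.
change (ga (tau w) w - gb (tau w) w =
  ga (inverse_time (local_time ga gb ^~ w) L) w - gb (inverse_time (local_time ga gb ^~ w) L) w).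
move: e1 e2; have := inverse_time_ge0 (local_time ga gb ^~ w) L.
have : 0 <= tau w by exact: inverse_time_ge0.
set x := tau w; set y := inverse_time _ _ => x0 y0; rewrite /local_time => e1 e2.
have [xy|/ltW yx] := leP x y.
  have := lt_nondecreasing Ha w x0 xy; have := lt_nondecreasing Hb w x0 xy; lra.
have := lt_nondecreasing Ha w y0 yx; have := lt_nondecreasing Hb w y0 yx; lra.
Qed.

End reflected_brownian_motion_mixture.

Section telegraph_mixture.
Context (R : realType) (d : measure_display) (Omega : measurableType d).
Variables (P : probability Omega R) (theta e : nat -> {RV P >-> R}) (alpha : R).
Variables (H : R -> {RV P >-> R}).
Hypothesis indep : mutually_independent P
  (tnth [tuple sigma_family setT theta; sigma_family setT e; sigma_process H]).

Lemma mutually_independent3 A B C : sigma_family setT theta A -> sigma_family setT e B ->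
  sigma_process H C -> P (A `&` B `&` C) = (P A * P B * P C)%E.
Proof.
move=> hA hB hC.
pose D (i : 'I_3) := nth setT [:: A; B; C] i.
have hD (i : 'I_3) : tnth [tuple sigma_family setT theta; sigma_family setT e; sigma_process H] i (D i).
  by case: i => -[|[|[|//]]] h; rewrite (tnth_nth set0).
have := indep (s := enum 'I_3) (A := D) (enum_uniq _) (fun i _ => hD i).
rewrite big_enum/= !big_ord_recl big_ord0 mule1 muleA => <-; congr (P _).
apply/seteqP; split => w /=.
  by move=> [[Aw Bw] Cw] [[|[|[|//]]] h] _.
move=> h; have {}h (i : 'I_3) : D i w by apply: h; rewrite /= mem_enum.
split; first split.
- exact: (h ord0).
- exact: (h (Ordinal (isT : (1 < 3)%N))).
- exact: (h (Ordinal (isT : (2 < 3)%N))).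
Qed.

Let T1 (I : Type) (D : set I) (Y : I -> {RV P >-> R}) : sigma_family D Y setT.
Proof.
have [s0 sC _] := sigma_family_sigma_algebra D Y.
by rewrite -(setD0 setT); exact: sC.
Qed.

Lemma telegraph_independent : independent P (sigma_family setT theta) (sigma_family setT e).
Proof.
move=> A B hA hB; rewrite -[_ `&` _]setIT mutually_independent3//; last exact: T1.
by rewrite (probability_setT P) mule1.
Qed.

(** A pi-system generating the joint sigma-algebra of directions and intervals; independence from
    [H] is checked on it and then extended. *)
Definition telegraph_events := [set A `&` B | A in sigma_family setT theta & B in sigma_family setT e].

Lemma telegraph_events_measurable : telegraph_events `<=` measurable.
Proof.
move=> _ [A hA [B hB <-]].
by apply: measurableI; [exact: sigma_family_measurable hA|exact: sigma_family_measurable hB].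
Qed.

Lemma telegraph_subordinator_independent :
  independent P <<s telegraph_events >> (sigma_process H).
Proof.
apply: independent_sigmal.
- move=> _ _ [A hA [B hB <-]] [A' hA' [B' hB' <-]]; rewrite setIACA.
  exists (A `&` A'); first exact: (sigma_algebra_setI (sigma_family_sigma_algebra _ _) hA hA').
  by exists (B `&` B') => //; exact: (sigma_algebra_setI (sigma_family_sigma_algebra _ _) hB hB').
- exact: telegraph_events_measurable.
- exact: sigma_family_measurable.
- move=> _ C [A hA [B hB <-]] hC.
  by rewrite mutually_independent3// telegraph_independent.
Qed.

Lemma joint_measurable_telegraph_position :
  measurable_fun setT (fun z : R * g_sigma_algebraType telegraph_events =>
    telegraph_position (fun j => theta j : Omega -> R) (fun j => e j : Omega -> R) z.1 z.2).
Proof.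
have mtheta j : measurable_fun setT (theta j : g_sigma_algebraType telegraph_events -> R).
  apply: adapted_measurable_fun => _ [C mC <-]; apply: sub_sigma_algebra.
  exists (setT `&` theta j @^-1` C); first by rewrite setTI; exact: sigma_family_rv.
  by exists setT; [exact: T1|rewrite setIT].
have me j : measurable_fun setT (e j : g_sigma_algebraType telegraph_events -> R).
  apply: adapted_measurable_fun => _ [C mC <-]; apply: sub_sigma_algebra.
  exists setT; first exact: T1.
  by exists (setT `&` e j @^-1` C); [rewrite setTI; exact: sigma_family_rv|rewrite setTI].
apply: (@measurable_telegraph_position _ _ (R * g_sigma_algebraType telegraph_events)%type
  (fun j z => theta j z.2) (fun j z => e j z.2) _ _ fst) => //.
- by move=> j; exact: (measurableT_comp (mtheta j) measurable_snd).
- by move=> j; exact: (measurableT_comp (me j) measurable_snd).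
Qed.

End telegraph_mixture.

Theorem theorem4 (R : realType) (alpha eta sigma : R)
    (d : measure_display) (Omega : measurableType d) (P : probability Omega R)
    (X B ga gb H : R -> {RV P >-> R})
    (d' : measure_display) (Omega' : measurableType d')
    (P' : probability Omega' R)
    (theta e : nat -> {RV P' >-> R}) (H' : R -> {RV P' >-> R}) :
  0 < alpha -> alpha <= 1 -> 0 < eta -> 0 < sigma ->
  let a := - (eta / sigma) in
  let b := eta / sigma in
  reflected_brownian_motion a b X B ga gb ->
  P [set w | X 0 w = a] = (1 / 2)%:E ->
  P [set w | X 0 w = b] = (1 / 2)%:E ->
  stable_subordinator alpha H ->
  independent P (sigma_process X) (sigma_process H) ->
  mutually_independent P' (fun j => sigma_rv (theta j)) ->
  (forall j, P' [set w | theta j w = 1] = (1 / 2)%:E) ->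
  (forall j, P' [set w | theta j w = - 1] = (1 / 2)%:E) ->
  mutually_independent P' (fun j => sigma_rv (e j)) ->
  (forall j (t : R), 0 <= t ->
     P' [set w | t < e j w] = (expR (- (sigma / eta) * t))%:E) ->
  stable_subordinator alpha H' ->
  mutually_independent P'
    (tnth [tuple sigma_family setT theta;
                 sigma_family setT e;
                 sigma_process H']) ->
  forall t : R, 0 <= t ->
    eq_in_law P P' (time_changed_local_difference ga gb H t)
                   (Ztel theta e H' t).
Proof.
move=> _ _ eta0 sigma0 a b HX Pa Pb HS XH theta_indep theta1 thetaN1 e_indep e_tail HS' indep t _.
have b0 : 0 < b by rewrite divr_gt0.
have ab : a < b by rewrite /a -/b; lra.
have ell0 : 0 < b - a by rewrite subr_gt0.
(* This is where the interval matches the renewal rate: for length [ell] the two transforms agree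
   exactly when the rate is [2 / ell]. *)
have rE : 2 / (b - a) = sigma / eta.
  rewrite (_ : b - a = 2 * b); last by rewrite /a -/b; ring.
  by rewrite invfM mulrA divff ?mul1r ?invf_div.
have theta_e := telegraph_independent indep.
pose Z u w := telegraph_position (fun j => theta j : Omega' -> R) (fun j => e j : Omega' -> R) u w.
have mZ u : measurable_fun setT (Z u).
  exact: (measurable_telegraph_position _ _ (f := cst u)).
have e_tail' : forall j (s : R), 0 <= s ->
    P' [set w | s < e j w] = (expR (- (2 / (b - a)) * s))%:E.
  by move=> j s s0; rewrite rE; exact: e_tail.
have r0 : 0 < 2 / (b - a) by rewrite divr_gt0.
have mTC := measurable_time_changed_local_difference HX t HS.
have mL' := measurable_inverse_subordinator HS' t.
have mZtel : measurable_fun setT (Ztel theta e H' t).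
  exact: (measurable_telegraph_position (theta := fun j => theta j : Omega' -> R)
    (e := fun j => e j : Omega' -> R) _ _ (f := fun w => inverse_time (H' ^~ w) t)).
split => // A mA.
have lawE u : 0 <= u -> P (signed_local_time ga gb u @^-1` A) = P' (Z u @^-1` A).
  move=> u0; apply: (bounded_eq_in_law (u := u)) => //.
  - exact: (measurable_signed_local_time HX).
  - by apply: aeW => w; exact: (signed_local_time_bound HX).
  - apply: filterS (renewal_good_path r0 theta1 thetaN1 e_indep e_tail') => w [e0 th ub].
    exact: telegraph_position_bound.
  (* Every positive Laplace parameter is the [beta] of some [rho > 1], so the two explicit
     transforms cover all that is needed. *)
  - move=> l l0; have [rho rho1 rhoE] := laplace_parameter ell0 l0; rewrite -rhoE.
    rewrite (signed_local_time_transform ab HX u0 _ Pa Pb); last by apply: lt_trans rho1.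
    by rewrite (telegraph_position_transform ell0 rho1 theta_indep theta1 thetaN1 e_indep e_tail' theta_e u0).
have mL := measurable_inverse_subordinator HS t.
have sX : <<s completed P (sigma_process X) >> = completed P (sigma_process X).
  exact: sigma_completed_process.
have Xm : completed P (sigma_process X) `<=` measurable by exact: completed_measurable.
have mD := joint_measurable_signed_local_time HX.
have mDL : measurable_fun setT (fun w => signed_local_time ga gb (inverse_time (H ^~ w) t) w).
  have mid : measurable_fun setT (id : Omega -> g_sigma_algebraType (completed P (sigma_process X))).
    by move=> _ C mC; rewrite setTI; apply: Xm; rewrite -sX.
  exact: (measurableT_comp mD (measurable_fun_pair mL mid)).
rewrite (ae_eq_prob mTC mDL mA (time_changed_local_differenceE ab HX t HS)).
apply: (mixture_eq_prob (G1 := completed P (sigma_process X)) (G2 := telegraph_events theta e)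
  (f1 := signed_local_time ga gb) (f2 := Z)
  (L1 := fun w => inverse_time (H ^~ w) t) (L2 := fun w => inverse_time (H' ^~ w) t)) => //.
- by rewrite sX.
- by apply: sigma_measurable; exact: telegraph_events_measurable.
- exact: joint_measurable_telegraph_position.
- rewrite sX; apply: independent_completed.
  + exact: sigma_family_measurable.
  + exact: sigma_rv_measurable.
  + by apply: independent_subr XH; exact: (sigma_inverse_subordinator HS).
- apply: independent_subr (telegraph_subordinator_independent indep).
  exact: (sigma_inverse_subordinator HS').
- exact: (inverse_subordinator_eq_in_law HS HS' t).
- by move=> w; exact: inverse_time_ge0.
Qed.
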